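(* Let $k$ be an algebraically closed field and let $\Lambda = k(\Gamma,\mathcal{A})$ be a generalized path algebra, where $\Gamma$ is a finite quiver without oriented cycles with $|\Gamma_0|\geq 2$, $\mathcal{A}=\{A_i : i\in\Gamma_0\}$ is a family of basic finite dimensional $k$-algebras, and $\Lambda$ is indecomposable as an algebra (so $\Gamma$ is connected). Let $\Lambda\cong kQ/I$ be its realization as a quotient of a path algebra by an admissible ideal. Assume that none of the ordinary quivers $\Sigma_i$ of the algebras $A_i$ has loops. Then $\Lambda$ is representation-finite if and only if the underlying graph of $\Gamma$ is Dynkin and the following hold: (i) If $\Gamma$ is of type $\mathbb{D}_n$ ($n\geq 4$), $\mathbb{E}_6$, $\mathbb{E}_7$ or $\mathbb{E}_8$, then $A_i = k$ for each $i\in\Gamma_0$. (ii) If $\Gamma$ is of type $\mathbb{A}_2$, then either (a) $A_1=k=A_2$; or (b) one and only one of $A_1$ or $A_2$ is $k^l$ with $l\in\{2,3\}$, and the other is $k$. (iii) If $\Gamma$ is of type $\mathbb{A}_n$ with $n\geq 3$, then either (a) $A_i=k$ for each $i\in\Gamma_0$; or (b) one and only one of $A_1$ or $A_n$ is $k^2$ and all the other algebras are $k$. Moreover, in this case, $I=0$ and $\Lambda$ is a path algebra of Dynkin type (that is, $\Lambda \cong kQ$ with the underlying graph of $Q$ Dynkin).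
   Context: A quiver $Q=(Q_0,Q_1,s,e)$ consists of finite sets of vertices $Q_0$ and arrows $Q_1$ with start and target maps $s,e$; its underlying graph is obtained by replacing arrows by (unoriented) edges; a loop is an arrow starting and ending at the same vertex. Paths are composed from left to right. An ideal of $kQ$ is admissible if it is generated by linear combinations of paths of length at least two and contains all paths of length at least $m$ for some $m$. Every basic finite dimensional $k$-algebra $A$ is isomorphic to $kQ_A/I_A$ with $I_A$ admissible; $Q_A$ is called the ordinary quiver of $A$. An algebra is representation-finite if it has only finitely many isomorphism classes of (finitely generated) indecomposable modules. Equalities such as $A_i=k$ or $A_i=k^l$ mean isomorphism of $k$-algebras, with $k^l=k\times\cdots\times k$ ($l$ factors); the individual algebras $A_i$ need not be indecomposable. Generalized path algebra: for a quiver $\Gamma$ without oriented cycles and a family $\mathcal{A}=\{A_i: i\in\Gamma_0\}$ of basic finite dimensional $k$-algebras, $k(\Gamma,\mathcal{A})$ is the $k$-algebra spanned by the expressions $a_0\alpha_1a_1\alpha_2\cdots\alpha_na_n$, where $n\ge 0$, $\alpha_1\cdots\alpha_n$ is a path in $\Gamma$, $a_{t-1}\in A_{s(\alpha_t)}$ and $a_t\in A_{e(\alpha_t)}$, subject to $k$-multilinearity in the $a_t$, with multiplication given by concatenation together with multiplication in the algebras $A_i$ where the expressions meet (zero if the vertices do not match). Equivalently, it is the tensor algebra over $A=\prod_{i}A_i$ of the $A$-$A$-bimodule $\bigoplus_{\alpha:i\to j\in\Gamma_1}A_i\otimes_kA_j$. Realization: write $A_i\cong k\Sigma_i/I_i$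 with $\Sigma_i$ the ordinary quiver of $A_i$ and $I_i$ admissible. Then $\Lambda\cong kQ/I$, where $Q_0=\bigsqcup_i(\Sigma_i)_0$; for $a\in(\Sigma_i)_0$, $b\in(\Sigma_j)_0$, the number of arrows $a\to b$ in $Q$ is the number of arrows $i\to j$ in $\Gamma$ if $i\neq j$, and the number of arrows $a\to b$ in $\Sigma_i$ if $i=j$; and $I$ is the admissible ideal of $kQ$ generated by all the $I_i$. Dynkin graphs and vertex numbering: $\mathbb{A}_n$ ($n\geq1$) is the path $1-2-\cdots-n$; $\mathbb{D}_n$ ($n\geq4$) has vertices $1,\dots,n$ and edges $1-3$, $2-3$, $3-4$, $4-5,\dots,(n-1)-n$; $\mathbb{E}_6,\mathbb{E}_7,\mathbb{E}_8$ (for $m=6,7,8$) have vertices $1,\dots,m$, the path $1-2-3-5-6-\cdots-m$ and the extra edge $3-4$. ''$\Gamma$ is of type $X$'' means that the underlying graph of $\Gamma$ is $X$, with vertices numbered as here. *)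

(* Defs.v *)
From HB Require Import structures.
From mathcomp Require Import all_boot all_algebra all_field.
From mathcomp Require Import finmap.
From mathcomp Require Import boolp.
From mathcomp.multinomials Require Import monalg.

Set Implicit Arguments.
Unset Strict Implicit.
Unset Printing Implicit Defensive.

Import GRing.Theory.
Local Open Scope ring_scope.

Definition alg_iso (k : fieldType) (A B : algType k) : Prop :=
  exists f : {lrmorphism A -> B}, bijective f.

(* Closure under scalars is implied by closure under multiplication; ideals   *)
(* are proper because algTypes are nonzero rings.                             *)
Record ideal (k : fieldType) (A : algType k) := Ideal {
  ideal_pred :> A -> Prop;
  ideal0 : ideal_pred 0;
  idealD : forall x y, ideal_pred x -> ideal_pred y -> ideal_pred (x + y);
  idealMl : forall a x, ideal_pred x -> ideal_pred (a * x);
  idealMr : forall a x, ideal_pred x -> ideal_pred (x * a);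
  ideal1 : ~ ideal_pred 1
}.

Inductive ideal_gen (k : fieldType) (A : algType k) (G : A -> Prop) :
    A -> Prop :=
| ideal_gen_in x : G x -> ideal_gen G x
| ideal_gen0 : ideal_gen G 0
| ideal_genD x y : ideal_gen G x -> ideal_gen G y -> ideal_gen G (x + y)
| ideal_genMl a x : ideal_gen G x -> ideal_gen G (a * x)
| ideal_genMr a x : ideal_gen G x -> ideal_gen G (x * a).

Inductive lin_span (k : fieldType) (V : lmodType k) (G : V -> Prop) :
    V -> Prop :=
| lin_span0 : lin_span G 0
| lin_spanP c x y : G x -> lin_span G y -> lin_span G (c *: x + y).

Lemma lin_spanD (k : fieldType) (V : lmodType k) (G : V -> Prop) x y :
  lin_span G x -> lin_span G y -> lin_span G (x + y).
Proof.
elim=> [|c g x' Gg _ IH] hy; first by rewrite add0r.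
by rewrite -addrA; apply: lin_spanP => //; apply: IH.
Qed.

Lemma lin_spanZ (k : fieldType) (V : lmodType k) (G : V -> Prop) c x :
  lin_span G x -> lin_span G (c *: x).
Proof.
elim=> [|d g x' Gg _ IH]; first by rewrite scaler0; constructor.
by rewrite scalerDr scalerA; apply: lin_spanP.
Qed.

Lemma lin_spanG (k : fieldType) (V : lmodType k) (G : V -> Prop) x : G x -> lin_span G x.
Proof.
by move=> Gx; rewrite -[x]scale1r -[_ *: _]addr0; apply: lin_spanP => //;
  constructor.
Qed.

Section IdealQuotient.
Variables (k : fieldType) (A : algType k) (I : ideal A).

Definition ideal_bpred (x : A) : bool := `[< I x >].

Fact ideal_zmod_closed : zmod_closed ideal_bpred.
Proof.
split; first by apply/asboolP/ideal0.
move=> x y /asboolP Ix /asboolP Iy; apply/asboolP; apply: idealD => //.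
by rewrite -mulN1r; apply: idealMl.
Qed.
HB.instance Definition _ :=
  GRing.isZmodClosed.Build A ideal_bpred ideal_zmod_closed.

Local Notation alg_quot_base :=
  (Quotient.quot (Algebra.ZmodClosed.clone A ideal_bpred _)).
Definition alg_quot := alg_quot_base.
HB.instance Definition _ := GRing.Zmodule.on alg_quot.

Definition quot_pi (x : A) : alg_quot := \pi_(alg_quot_base)%qT x.
Definition quot_repr (x : alg_quot) : A := generic_quotient.repr x.

Lemma quot_reprK : cancel quot_repr quot_pi.
Proof. exact: reprK. Qed.

Lemma quot_piP x y : quot_pi x = quot_pi y <-> I (x - y).
Proof.
split.
  by move/eqP; rewrite -Quotient.idealrBE => /asboolP.
by move=> h; apply/eqP; rewrite -Quotient.idealrBE; apply/asboolP.
Qed.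

Lemma quot_piD x y : quot_pi (x + y) = quot_pi x + quot_pi y.
Proof. exact: (raddfD (\pi_(alg_quot_base)%qT)). Qed.

Lemma quot_pi_repr x : I (quot_repr (quot_pi x) - x).
Proof. by apply/quot_piP; rewrite quot_reprK. Qed.

Definition quot_one : alg_quot := quot_pi 1.
Definition quot_mul (x y : alg_quot) : alg_quot :=
  quot_pi (quot_repr x * quot_repr y).
Definition quot_scale (c : k) (x : alg_quot) : alg_quot :=
  quot_pi (c *: quot_repr x).

Lemma quot_piM x y : quot_pi (x * y) = quot_mul (quot_pi x) (quot_pi y).
Proof.
apply/esym/quot_piP.
set x' := quot_repr _; set y' := quot_repr _.
have -> : x' * y' - x * y = (x' - x) * y' + x * (y' - y).
  by rewrite mulrBl mulrBr addrA subrK.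
by apply: idealD; [apply: idealMr|apply: idealMl]; apply: quot_pi_repr.
Qed.

Lemma quot_piZ c x : quot_pi (c *: x) = quot_scale c (quot_pi x).
Proof.
apply/esym/quot_piP; rewrite -scalerBr -[_ - x]mul1r scalerAl.
by apply: idealMl; apply: quot_pi_repr.
Qed.

Local Ltac lift := move=> *; repeat match goal with
  | x : alg_quot |- _ => rewrite -(quot_reprK x); move: (quot_repr x) => {}x
  end.

Fact quot_mulA : associative quot_mul.
Proof. by lift; rewrite -!quot_piM mulrA. Qed.
Fact quot_mul1l : left_id quot_one quot_mul.
Proof. by lift; rewrite -!quot_piM mul1r. Qed.
Fact quot_mul1r : right_id quot_one quot_mul.
Proof. by lift; rewrite -!quot_piM mulr1. Qed.
Fact quot_mulDl : left_distributive quot_mul +%R.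
Proof. by lift; rewrite -!(quot_piM, quot_piD) mulrDl. Qed.
Fact quot_mulDr : right_distributive quot_mul +%R.
Proof. by lift; rewrite -!(quot_piM, quot_piD) mulrDr. Qed.
Fact quot_one_neq0 : quot_one != 0.
Proof.
apply/eqP; have -> : 0 = quot_pi 0 :> alg_quot.
  by apply/esym; exact: (raddf0 (\pi_(alg_quot_base)%qT)).
by move/quot_piP; rewrite subr0; apply: ideal1.
Qed.

HB.instance Definition _ := GRing.Zmodule_isNzRing.Build alg_quot
  quot_mulA quot_mul1l quot_mul1r quot_mulDl quot_mulDr quot_one_neq0.

Fact quot_scaleA a b x : quot_scale a (quot_scale b x) = quot_scale (a * b) x.
Proof. by lift; rewrite -!quot_piZ scalerA. Qed.
Fact quot_scale1 : left_id 1 quot_scale.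
Proof. by lift; rewrite -!quot_piZ scale1r. Qed.
Fact quot_scaleDr : right_distributive quot_scale +%R.
Proof. by lift; rewrite -!(quot_piZ, quot_piD) scalerDr. Qed.
Fact quot_scaleDl x : {morph quot_scale^~ x : a b / a + b}.
Proof. by lift; rewrite -!(quot_piZ, quot_piD) scalerDl. Qed.

HB.instance Definition _ := GRing.Zmodule_isLmodule.Build k alg_quot
  quot_scaleA quot_scale1 quot_scaleDr quot_scaleDl.

Fact quot_scaleAl (c : k) (x y : alg_quot) : c *: (x * y) = (c *: x) * y.
Proof.
rewrite -[RHS]/(quot_mul (quot_scale c x) y) -[LHS]/(quot_scale c (quot_mul x y)).
by lift; rewrite -!(quot_piZ, quot_piM) -?quot_piZ -?quot_piM scalerAl.
Qed.
HB.instance Definition _ :=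
  GRing.Lmodule_isLalgebra.Build k alg_quot quot_scaleAl.

Fact quot_scaleAr (c : k) (x y : alg_quot) : c *: (x * y) = x * (c *: y).
Proof.
rewrite -[RHS]/(quot_mul x (quot_scale c y)) -[LHS]/(quot_scale c (quot_mul x y)).
by lift; rewrite -!(quot_piZ, quot_piM) -?quot_piZ -?quot_piM scalerAr.
Qed.
HB.instance Definition _ :=
  GRing.Lalgebra_isAlgebra.Build k alg_quot quot_scaleAr.

End IdealQuotient.

(* [comp f g] is "first f, then g"; it is meaningful only when cod f = dom g. *)
(* Path algebras and the algebra spanned by the expressions                   *)
(* a_0 alpha_1 a_1 ... alpha_n a_n are both algebras of small categories: the *)
(* morphisms are a basis, the product is composition or 0, and 1 is the sum of *)
(* the identities.                                                            *)
Record smallcat := SmallCat {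
  obj : finType;
  mor : choiceType;
  dom : mor -> obj;
  cod : mor -> obj;
  idm : obj -> mor;
  comp : mor -> mor -> mor;
  obj_gt0 : (0 < #|obj|)%N;
  dom_id : forall v, dom (idm v) = v;
  cod_id : forall v, cod (idm v) = v;
  dom_comp : forall f g, cod f = dom g -> dom (comp f g) = dom f;
  cod_comp : forall f g, cod f = dom g -> cod (comp f g) = cod g;
  comp_idl : forall f, comp (idm (dom f)) f = f;
  comp_idr : forall f, comp f (idm (cod f)) = f;
  compA : forall f g h, cod f = dom g -> cod g = dom h ->
    comp f (comp g h) = comp (comp f g) h
}.

Definition lin_ext (k : fieldType) (S : choiceType) (V : lmodType k)
  (h : S -> V) (x : {malg k[S]}) : V := \sum_(p <- msupp x) x@_p *: h p.

Section LinExt.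
Variables (k : fieldType) (S : choiceType).

Lemma lin_extw (V : lmodType k) (h : S -> V) (x : {malg k[S]}) (d : {fset S}) :
  (msupp x `<=` d)%fset -> lin_ext h x = \sum_(p <- d) x@_p *: h p.
Proof.
move=> le; rewrite /lin_ext (big_fset_incl _ le) //= => p _ /mcoeff_outdom ->.
by rewrite scale0r.
Qed.

Fact lin_ext_is_linear (V : lmodType k) (h : S -> V) : linear (lin_ext h).
Proof.
move=> c x y; pose d := (msupp x `|` msupp y)%fset.
have lx : (msupp x `<=` d)%fset by apply: fsubsetUl.
have ly : (msupp y `<=` d)%fset by apply: fsubsetUr.
have lz : (msupp (c *: x + y) `<=` d)%fset.
  by apply: fsubset_trans (msuppD_le _ _) _; apply: fsetSU; apply: msuppZ_le.
rewrite (lin_extw _ lx) (lin_extw _ ly) (lin_extw _ lz) scaler_sumr -big_split.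
by apply: eq_bigr => p _ /=; rewrite mcoeffD mcoeffZ scalerDl scalerA.
Qed.
HB.instance Definition _ (V : lmodType k) (h : S -> V) :=
  GRing.isLinear.Build k {malg k[S]} V *:%R (lin_ext h) (lin_ext_is_linear h).

Lemma lin_extU (V : lmodType k) (h : S -> V) p :
  lin_ext h (<< p >> : {malg k[S]}) = h p.
Proof.
rewrite (lin_extw _ (@msuppU_le S k p 1)) big_seq_fset1.
by rewrite mcoeffUU scale1r.
Qed.

Lemma lin_ext_hD (V : lmodType k) (h h1 h2 : S -> V) (c : k) x :
  (forall p, h p = c *: h1 p + h2 p) ->
  lin_ext h x = c *: lin_ext h1 x + lin_ext h2 x.
Proof.
move=> H; rewrite /lin_ext scaler_sumr -big_split; apply: eq_bigr => p _.
by rewrite H /= scalerDr !scalerA mulrC.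
Qed.

End LinExt.

Definition cat_alg (k : fieldType) (C : smallcat) := {malg k[mor C]}.

Section CatAlg.
Variables (k : fieldType) (C : smallcat).
Local Notation E := (cat_alg k C).
HB.instance Definition _ := GRing.Lmodule.on E.

Definition cbasis (f : mor C) : E := << f >>.
Definition cmul1 (f g : mor C) : E :=
  if cod f == dom g then cbasis (comp f g) else 0.
Definition cmul (x y : E) : E :=
  lin_ext (fun f => lin_ext (fun g => cmul1 f g) y) x.
Definition cone : E := \sum_(v : obj C) cbasis (idm v).

Lemma cmulUU f g : cmul (cbasis f) (cbasis g) = cmul1 f g.
Proof. by rewrite /cmul !lin_extU. Qed.

Fact cmul_linearl y : linear (cmul^~ y).
Proof. by move=> c x1 x2; rewrite /cmul linearP. Qed.
Fact cmul_linearr x : linear (cmul x).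
Proof.
by move=> c y1 y2; rewrite /cmul; apply: lin_ext_hD => f; rewrite linearP.
Qed.

Fact cmulDl : left_distributive cmul +%R.
Proof.
by move=> x y z; have := cmul_linearl z 1 x y; rewrite !scale1r.
Qed.
Fact cmulDr : right_distributive cmul +%R.
Proof.
by move=> x y z; have := cmul_linearr x 1 y z; rewrite !scale1r.
Qed.
Lemma cmul0l x : cmul 0 x = 0. Proof. exact: raddf0. Qed.
Lemma cmul0r x : cmul x 0 = 0.
Proof. by apply: (addrI (cmul x 0)); rewrite -cmulDr !addr0. Qed.
Lemma cmulZl c x y : cmul (c *: x) y = c *: cmul x y.
Proof. by have := cmul_linearl y c x 0; rewrite cmul0l !addr0. Qed.
Lemma cmulZr c x y : cmul x (c *: y) = c *: cmul x y.
Proof. by have := cmul_linearr x c y 0; rewrite cmul0r !addr0. Qed.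

Lemma cbasis_ind (P : E -> Prop) : P 0 ->
  (forall c f x, P x -> P (c *: cbasis f + x)) -> forall x, P x.
Proof.
move=> P0 PD x; rewrite (monalgE (x : {malg k[mor C]})).
elim: (msupp _ : seq (mor C)) => [|f s IH]; first by rewrite big_nil.
rewrite big_cons.
have -> : << x@_f *g f >> = x@_f *: cbasis f.
  by apply/malgP=> q; rewrite mcoeffZ !mcoeffU mulrnAr mulr1.
exact: PD.
Qed.

Lemma cmulPl c x1 x2 y :
  cmul (c *: x1 + x2) y = c *: cmul x1 y + cmul x2 y.
Proof. exact: cmul_linearl. Qed.
Lemma cmulPr c x y1 y2 :
  cmul x (c *: y1 + y2) = c *: cmul x y1 + cmul x y2.
Proof. exact: cmul_linearr. Qed.

Lemma cmul_step c (a b r : E) : a = b -> c *: a + r = c *: b + r.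
Proof. by move=> ->. Qed.

Fact cmulA : associative cmul.
Proof.
move=> x y z.
elim/cbasis_ind: x => [|c f x IHx]; first by rewrite !cmul0l.
rewrite (cmulPl c (cbasis f) x y) (cmulPl c (cbasis f) x (cmul y z)).
rewrite (cmulPl c (cmul (cbasis f) y)) IHx; apply: cmul_step => {IHx}.
elim/cbasis_ind: y => [|d g y IHy]; first by rewrite !(cmul0l, cmul0r).
rewrite (cmulPl d (cbasis g) y z) (cmulPr d (cbasis f) (cbasis g) y).
rewrite (cmulPr d (cbasis f) (cmul (cbasis g) z)).
rewrite (cmulPl d (cmul (cbasis f) (cbasis g))) IHy.
apply: cmul_step => {IHy}.
elim/cbasis_ind: z => [|e h z IHz]; first by rewrite !cmul0r.
rewrite (cmulPr e (cbasis g) (cbasis h) z) (cmulPr e (cbasis f)).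
rewrite (cmulPr e (cmul (cbasis f) (cbasis g))) IHz.
apply: cmul_step => {IHz}.
rewrite !cmulUU /cmul1.
case: (eqVneq (cod f) (dom g)) => [fg|nfg].
  case: (eqVneq (cod g) (dom h)) => [gh|ngh].
    rewrite !cmulUU /cmul1 dom_comp // cod_comp // fg gh !eqxx.
    by rewrite compA.
  by rewrite cmul0r cmulUU /cmul1 cod_comp // (negPf ngh).
rewrite cmul0l; case: eqVneq => [gh|_]; last by rewrite cmul0r.
by rewrite cmulUU /cmul1 dom_comp // (negPf nfg).
Qed.

Fact cmul1l : left_id cone cmul.
Proof.
move=> x; elim/cbasis_ind: x => [|c f x IHx]; first by rewrite cmul0r.
rewrite (cmulPr c) IHx; apply: cmul_step.
rewrite /cone (big_morph (cmul^~ _) (fun x y => cmulDl x y _) (cmul0l _)) (bigD1 (dom f)) //=.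
rewrite cmulUU /cmul1 cod_id eqxx comp_idl big1 ?addr0 // => v nv.
by rewrite cmulUU /cmul1 cod_id (negPf nv).
Qed.

Fact cmul1r : right_id cone cmul.
Proof.
move=> x; elim/cbasis_ind: x => [|c f x IHx]; first by rewrite cmul0l.
rewrite (cmulPl c) IHx; apply: cmul_step.
rewrite /cone (big_morph (cmul _) (cmulDr _) (cmul0r _)) (bigD1 (cod f)) //=.
rewrite cmulUU /cmul1 dom_id eqxx comp_idr big1 ?addr0 // => v nv.
by rewrite cmulUU /cmul1 dom_id eq_sym (negPf nv).
Qed.

Fact cone_neq0 : cone != 0.
Proof.
have [v _] : exists v : obj C, true.
  by have /card_gt0P [v _] := obj_gt0 C; exists v.
apply/eqP => /(congr1 (fun x : {malg k[mor C]} => x@_(idm v))).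
rewrite mcoeff0 /cone (raddf_sum (mcoeff (idm v))) (bigD1 v) //=.
rewrite mcoeffUU big1 ?addr0 => [/eqP|w nw]; first by rewrite oner_eq0.
rewrite mcoeffU; case: eqP => // /(congr1 (@dom C)); rewrite !dom_id => /eqP.
by rewrite (negPf nw).
Qed.

HB.instance Definition _ := GRing.Zmodule_isNzRing.Build E
  cmulA cmul1l cmul1r cmulDl cmulDr cone_neq0.
Fact cscaleAl (c : k) (x y : E) : c *: (x * y) = (c *: x) * y.
Proof. by apply/esym; apply: cmulZl. Qed.
HB.instance Definition _ := GRing.Lmodule_isLalgebra.Build k E cscaleAl.
Fact cscaleAr (c : k) (x y : E) : c *: (x * y) = x * (c *: y).
Proof. by apply/esym; apply: cmulZr. Qed.
HB.instance Definition _ := GRing.Lalgebra_isAlgebra.Build k E cscaleAr.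

Lemma cbasisM f g : cbasis f * cbasis g = cmul1 f g.
Proof. exact: cmulUU. Qed.

End CatAlg.

(* Nonemptiness makes path algebras nonzero rings, as algType requires.       *)
Record quiver := Quiver {
  vert : finType;
  arr : finType;
  src : arr -> vert;
  tgt : arr -> vert;
  vert_gt0 : (0 < #|vert|)%N
}.

Section Paths.
Variable Q : quiver.

Fixpoint is_walk (v : vert Q) (p : seq (arr Q)) : bool :=
  if p is a :: p' then (src a == v) && is_walk (tgt a) p' else true.
Definition walk_end (v : vert Q) (p : seq (arr Q)) : vert Q :=
  last v [seq tgt a | a <- p].

(* The start vertex is recorded to distinguish the paths of length zero.      *)
Definition qpath := {w : vert Q * seq (arr Q) | is_walk w.1 w.2}.
HB.instance Definition _ := Choice.on qpath.

Definition path_start (p : qpath) : vert Q := (val p).1.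
Definition path_end (p : qpath) : vert Q := walk_end (val p).1 (val p).2.
Definition path_length (p : qpath) : nat := size (val p).2.
Definition path_id (v : vert Q) : qpath := exist _ (v, [::]) isT.
(* When the concatenation is not a path, the default value p is never used.   *)
Definition path_cat (p q : qpath) : qpath :=
  insubd p ((val p).1, (val p).2 ++ (val q).2).

Definition acyclic : Prop :=
  forall v a p, is_walk v (a :: p) -> walk_end v (a :: p) <> v.

Lemma is_walk_cat v p q :
  is_walk v (p ++ q) = is_walk v p && is_walk (walk_end v p) q.
Proof. by elim: p v => [|a p IH] v //=; rewrite IH andbA. Qed.

Lemma walk_end_cat v p q : walk_end v (p ++ q) = walk_end (walk_end v p) q.
Proof. by rewrite /walk_end map_cat last_cat. Qed.

Lemma val_path_cat p q : path_end p = path_start q ->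
  val (path_cat p q) = ((val p).1, (val p).2 ++ (val q).2).
Proof.
move=> pq; rewrite val_insubd /= is_walk_cat (valP p) /=.
by rewrite -[walk_end _ _]/(path_end p) pq (valP q).
Qed.

Fact path_start_cat p q : path_end p = path_start q ->
  path_start (path_cat p q) = path_start p.
Proof. by move=> pq; rewrite /path_start val_path_cat. Qed.
Fact path_end_cat p q : path_end p = path_start q ->
  path_end (path_cat p q) = path_end q.
Proof.
move=> pq; rewrite /path_end val_path_cat //= walk_end_cat.
by rewrite -[walk_end (val p).1 _]/(path_end p) pq.
Qed.
Fact path_cat_idl p : path_cat (path_id (path_start p)) p = p.
Proof. by case: p => [[v p] hp]; apply: val_inj; rewrite val_path_cat. Qed.
Fact path_cat_idr p : path_cat p (path_id (path_end p)) = p.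
Proof.
by case: p => [[v p] hp]; apply: val_inj; rewrite val_path_cat //= cats0.
Qed.
Fact path_catA p q r : path_end p = path_start q -> path_end q = path_start r ->
  path_cat p (path_cat q r) = path_cat (path_cat p q) r.
Proof.
move=> pq qr; apply: val_inj.
have pqr : path_end p = path_start (path_cat q r) by rewrite path_start_cat.
have pqr' : path_end (path_cat p q) = path_start r by rewrite path_end_cat.
by rewrite !val_path_cat //= catA.
Qed.

Definition path_category : smallcat :=
  @SmallCat (vert Q) qpath path_start path_end path_id path_cat (vert_gt0 Q)
    (fun=> erefl) (fun=> erefl) path_start_cat path_end_cat
    path_cat_idl path_cat_idr path_catA.

End Paths.

Definition path_alg (k : fieldType) (Q : quiver) : algType k :=
  cat_alg k (path_category Q).
Definition path_elt (k : fieldType) (Q : quiver) (p : qpath Q) :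
  path_alg k Q := cbasis k (C := path_category Q) p.

Definition long_path (k : fieldType) (Q : quiver) (m : nat)
  (x : path_alg k Q) : Prop :=
  exists2 p : qpath Q, (m <= path_length p)%N & x = path_elt k p.

Definition admissible (k : fieldType) (Q : quiver) (I : path_alg k Q -> Prop) :
    Prop :=
  (exists2 G : path_alg k Q -> Prop,
     forall g, G g -> lin_span (@long_path k Q 2) g &
     forall x, I x <-> ideal_gen G x) /\
  (exists m : nat, forall x, long_path m x -> I x).

Section GeneralizedPathAlgebra.
Variables (k : fieldType) (Q : quiver) (A : vert Q -> falgType k).

(* A letter is an element of some A_i together with the index i.  The         *)
(* expression a_0 alpha_1 a_1 ... alpha_n a_n is encoded as                   *)
(* (a_0, [:: (alpha_1, a_1); ...; (alpha_n, a_n)]).                           *)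
Definition letter := {i : vert Q & A i}.
HB.instance Definition _ := Choice.on letter.
Definition raw_expr := (letter * seq (arr Q * letter))%type.
HB.instance Definition _ := Choice.on raw_expr.

Fixpoint is_expr (x : letter) (s : seq (arr Q * letter)) : bool :=
  if s is ay :: s' then
    [&& src ay.1 == tag x, tgt ay.1 == tag ay.2 & is_expr ay.2 s']
  else true.
Definition last_letter (w : raw_expr) : letter := last w.1 [seq ay.2 | ay <- w.2].

Definition expr := {w : raw_expr | is_expr w.1 w.2}.
HB.instance Definition _ := Choice.on expr.

Definition expr_start (w : expr) : vert Q := tag (val w).1.
Definition expr_end (w : expr) : vert Q := tag (last_letter (val w)).
Definition expr_id (i : vert Q) : expr :=
  exist _ (Tagged (fun i => A i) (1 : A i), [::]) isT.

(* Meaningful only for letters at the same vertex i, where it is the product  *)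
(* of A_i.                                                                    *)
Definition letter_mul (x y : letter) : letter :=
  Tagged (fun i => A i) (tagged x * tagged_as x y).

(* Concatenation, multiplying the last letter of the first expression with    *)
(* the first letter of the second one.                                        *)
Fixpoint raw_mul (x : letter) (s : seq (arr Q * letter)) (w : raw_expr) :
    raw_expr :=
  if s is ay :: s' then
    let u := raw_mul ay.2 s' w in (x, (ay.1, u.1) :: u.2)
  else (letter_mul x w.1, w.2).
Definition expr_mul (u w : expr) : expr :=
  insubd u (raw_mul (val u).1 (val u).2 (val w)).

Lemma letter_mulE i (a b : A i) :
  letter_mul (Tagged (fun i => A i) a) (Tagged (fun i => A i) b) =
  Tagged (fun i => A i) (a * b).
Proof. by rewrite /letter_mul (@tagged_asE _ _ (Tagged (fun i => A i) a) b). Qed.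

Lemma tag_raw_mul x s w : tag (raw_mul x s w).1 = tag x.
Proof. by case: s. Qed.

Lemma letter_mulA x y z : tag x = tag y -> tag y = tag z ->
  letter_mul x (letter_mul y z) = letter_mul (letter_mul x y) z.
Proof.
case: x y z => i a [j b] [l c] /= ij jl; subst j; subst l.
rewrite (letter_mulE b c) (letter_mulE a b) (letter_mulE a (b * c)).
by rewrite (letter_mulE (a * b) c) mulrA.
Qed.

Lemma is_expr_tag x y s : tag x = tag y -> is_expr x s = is_expr y s.
Proof. by case: s => //= ay s ->. Qed.

Lemma is_expr_mul x s w : tag (last_letter (x, s)) = tag w.1 ->
  is_expr x s -> is_expr w.1 w.2 ->
  is_expr (raw_mul x s w).1 (raw_mul x s w).2.
Proof.
elim: s x => [|[a y] s IH] x /=.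
  by move=> xw _; rewrite (@is_expr_tag (letter_mul x w.1) w.1).
move=> xw /and3P [-> ay hs] hw /=.
by rewrite tag_raw_mul ay; apply: IH.
Qed.

Lemma val_expr_mul u w : expr_end u = expr_start w ->
  val (expr_mul u w) = raw_mul (val u).1 (val u).2 (val w).
Proof.
by move=> uw; rewrite val_insubd is_expr_mul ?(valP u) ?(valP w).
Qed.

Lemma tag_last_raw_mul x s w : tag (last_letter (x, s)) = tag w.1 ->
  tag (last_letter (raw_mul x s w)) = tag (last_letter w).
Proof.
rewrite /last_letter /=; elim: s x => [|[a y] s IH] x //= xw.
  by case: w xw => [y [|b t]].
by rewrite -(IH y xw).
Qed.

Fact expr_start_mul u w : expr_end u = expr_start w ->
  expr_start (expr_mul u w) = expr_start u.
Proof. by move=> uw; rewrite /expr_start val_expr_mul // tag_raw_mul. Qed.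
Fact expr_end_mul u w : expr_end u = expr_start w ->
  expr_end (expr_mul u w) = expr_end w.
Proof.
move=> uw; rewrite /expr_end val_expr_mul //; apply: tag_last_raw_mul.
by move: uw; rewrite /expr_end; case: (val u).
Qed.

Fact expr_mul_idl u : expr_mul (expr_id (expr_start u)) u = u.
Proof.
case: u => [[[i a] s] hu]; apply: val_inj; rewrite val_expr_mul //=.
by rewrite -[X in letter_mul _ X]/(Tagged (fun i => A i) a) letter_mulE mul1r.
Qed.
Fact expr_mul_idr u : expr_mul u (expr_id (expr_end u)) = u.
Proof.
case: u => [[x s] hu]; apply: val_inj; rewrite val_expr_mul //= /expr_end.
rewrite /last_letter /= {hu}; elim: s x => [|[a y] s IH] [i b] /=.
  by rewrite (letter_mulE b 1) mulr1.
by rewrite IH.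
Qed.
Fact expr_mulA u v w : expr_end u = expr_start v -> expr_end v = expr_start w ->
  expr_mul u (expr_mul v w) = expr_mul (expr_mul u v) w.
Proof.
move=> uv vw; apply: val_inj.
have uvw : expr_end u = expr_start (expr_mul v w) by rewrite expr_start_mul.
have uvw' : expr_end (expr_mul u v) = expr_start w by rewrite expr_end_mul.
rewrite !val_expr_mul //; move: uv vw {uvw uvw'}.
rewrite /expr_end /expr_start /last_letter.
case: u v w => [[x s] hu] [[y t] hv] [[z' r] hw] /= {hu hv hw}.
elim: s x => [|[a z] s IH] x /= xy yw; last by rewrite IH.
case: t yw => [|b t] /= yw //.
by rewrite letter_mulA.
Qed.

Definition expr_category : smallcat :=
  @SmallCat (vert Q) expr expr_start expr_end expr_id expr_mul (vert_gt0 Q)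
    (fun=> erefl) (fun=> erefl) expr_start_mul expr_end_mul
    expr_mul_idl expr_mul_idr expr_mulA.

(* The algebra with the expressions as a basis, before multilinearity is      *)
(* imposed.                                                                   *)
Definition expr_alg : algType k := cat_alg k expr_category.
Definition expr_elt (w : raw_expr) : expr_alg :=
  if insub w is Some u then cbasis k (C := expr_category) u else 0.

(* A slot is an expression with one letter left open.                         *)
Inductive slot : (letter -> raw_expr) -> Prop :=
| slot_head s : slot (fun x => (x, s))
| slot_tail x0 s1 a s2 : slot (fun x => (x0, s1 ++ (a, x) :: s2)).

Inductive mlin_rel : expr_alg -> Prop :=
| MlinRel C i (c : k) (a b : A i) : slot C ->
    mlin_rel (expr_elt (C (Tagged (fun i => A i) (c *: a + b)))
              - c *: expr_elt (C (Tagged (fun i => A i) a))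
              - expr_elt (C (Tagged (fun i => A i) b))).


Local Notation tagA := (Tagged (fun i => A i)).

Lemma slot_cons C x a : slot C ->
  slot (fun y => (x, (a, (C y).1) :: (C y).2)).
Proof.
case=> [s|x0 s1 b s2] /=; first exact: (slot_tail x [::] a s).
exact: (slot_tail x ((a, x0) :: s1) b s2).
Qed.

Lemma slot_valid C x y : slot C -> tag x = tag y ->
  is_expr (C x).1 (C x).2 = is_expr (C y).1 (C y).2.
Proof.
case=> [s|x0 s1 b s2] xy /=; first exact: is_expr_tag.
elim: s1 x0 => [|[a z] s1 IH] x0 /=; last by rewrite IH.
by rewrite xy (is_expr_tag s2 xy).
Qed.

Lemma slot_start C x y : slot C -> tag x = tag y -> tag (C x).1 = tag (C y).1.
Proof. by case. Qed.

Lemma slot_end C x y : slot C -> tag x = tag y ->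
  tag (last_letter (C x)) = tag (last_letter (C y)).
Proof.
rewrite /last_letter; case=> [s|x0 s1 b s2] xy /=.
  by case: s.
by rewrite !map_cat !last_cat /=; case: s2.
Qed.

Definition slot_map i (C C' : letter -> raw_expr) (F : raw_expr -> raw_expr) :=
  slot C' /\ exists f : A i -> A i,
    (forall c a b, f (c *: a + b) = c *: f a + f b) /\
    forall a, F (C (tagA a)) = C' (tagA (f a)).

Lemma slot_mull i C x s : slot C ->
  tag (last_letter (x, s)) = tag (C (tagA (0 : A i))).1 ->
  exists C', slot_map i C C' (raw_mul x s).
Proof.
move=> sC; elim: s x => [|[al z] s IH] x /=.
  case: sC => [s|x0 s1 b s2] /= tx.
    case: x tx => j d; rewrite /last_letter /= => ji; subst j.
    exists (fun y => (y, s)); split; first exact: slot_head.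
    exists (fun a => d * a); split=> [c a b|a].
      by rewrite mulrDr scalerAr.
    by rewrite letter_mulE.
  exists (fun y => (letter_mul x x0, s1 ++ (b, y) :: s2)).
  by split; [exact: slot_tail|exists id].
move=> tx; have [C' [sC' [f [fl fE]]]] := IH z tx.
exists (fun y => (x, (al, (C' y).1) :: (C' y).2)).
split; first exact: slot_cons.
by exists f; split=> // a; rewrite fE.
Qed.

Lemma slot_mulr i C w : slot C ->
  tag (last_letter (C (tagA (0 : A i)))) = tag w.1 ->
  exists C', slot_map i C C' (fun u => raw_mul u.1 u.2 w).
Proof.
have head s : tag (last_letter (tagA (0 : A i), s)) = tag w.1 ->
  exists C', slot_map i (fun y => (y, s)) C' (fun u => raw_mul u.1 u.2 w).
  case: s => [|[al z] s] /= tw.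
    case: w tw => [[j d] t]; rewrite /last_letter /= => ij; subst j.
    exists (fun y => (y, t)); split; first exact: slot_head.
    exists (fun a => a * d); split=> [c a b|a].
      by rewrite mulrDl scalerAl.
    by rewrite /= (letter_mulE a d).
  exists (fun y => (y, (al, (raw_mul z s w).1) :: (raw_mul z s w).2)).
  by split; [exact: slot_head|exists id].
case=> [s|x0 s1 b s2]; first exact: head.
elim: s1 x0 => [|[al z] s1 IH] x0 tw.
  have [C' [sC' [f [fl fE]]]] := head s2 tw.
  exists (fun y => (x0, (b, (C' y).1) :: (C' y).2)).
  split; first exact: slot_cons.
  by exists f; split=> // a /=; rewrite -fE.
have [C' [sC' [f [fl fE]]]] := IH z tw.
exists (fun y => (x0, (al, (C' y).1) :: (C' y).2)).
split; first exact: slot_cons.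
by exists f; split=> // a /=; rewrite -fE.
Qed.

Lemma expr_eltE (w : raw_expr) (hw : is_expr w.1 w.2) :
  expr_elt w = cbasis k (C := expr_category) (exist _ w hw).
Proof. by rewrite /expr_elt insubT. Qed.

Lemma expr_elt0 (w : raw_expr) : ~~ is_expr w.1 w.2 -> expr_elt w = 0.
Proof. by move=> hw; rewrite /expr_elt insubN. Qed.

Lemma expr_val (u : expr) : expr_elt (val u) = cbasis k (C := expr_category) u.
Proof. by rewrite /expr_elt valK. Qed.

Lemma expr_eltM (u w : raw_expr) :
  is_expr u.1 u.2 -> is_expr w.1 w.2 ->
  expr_elt u * expr_elt w =
    if tag (last_letter u) == tag w.1 then expr_elt (raw_mul u.1 u.2 w) else 0.
Proof.
move=> hu hw; rewrite (expr_eltE hu) (expr_eltE hw) cbasisM /cmul1 /=.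
rewrite -[expr_end _]/(tag (last_letter u)) -[expr_start _]/(tag w.1).
by case: eqP => // uw; rewrite -expr_val val_expr_mul.
Qed.

Lemma mlin_mull (u : expr) x : mlin_rel x ->
  lin_span mlin_rel (cbasis k (C := expr_category) u * x).
Proof.
case=> C i c a b sC; rewrite -expr_val !mulrBr -scalerAr.
have Q0 := lin_span0 mlin_rel.
have [h0|h0] := boolP (is_expr (C (tagA (0 : A i))).1 (C (tagA (0 : A i))).2).
  have hE d : is_expr (C (tagA (d : A i))).1 (C (tagA d)).2.
    by rewrite (@slot_valid C _ (tagA (0 : A i)) sC).
  have hu := valP u.
  have tE d : tag (C (tagA (d : A i))).1 = tag (C (tagA (0 : A i))).1.
    exact: slot_start.
  rewrite !expr_eltM // !tE; case: eqP => [uC|_]; last by rewrite scaler0 !subr0.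
  have [|C' [sC' [f [fl fE]]]] := @slot_mull i C (val u).1 (val u).2 sC.
    by rewrite -uC; case: (val u).
  by rewrite !fE fl; apply/lin_spanG/MlinRel.
have hE d : expr_elt (C (tagA (d : A i))) = 0.
  by apply: expr_elt0; rewrite (@slot_valid C _ (tagA (0 : A i)) sC).
by rewrite !hE mulr0 scaler0 !subr0.
Qed.

Lemma mlin_mulr (u : expr) x : mlin_rel x ->
  lin_span mlin_rel (x * cbasis k (C := expr_category) u).
Proof.
case=> C i c a b sC; rewrite -expr_val !mulrBl -scalerAl.
have Q0 := lin_span0 mlin_rel.
have [h0|h0] := boolP (is_expr (C (tagA (0 : A i))).1 (C (tagA (0 : A i))).2).
  have hE d : is_expr (C (tagA (d : A i))).1 (C (tagA d)).2.
    by rewrite (@slot_valid C _ (tagA (0 : A i)) sC).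
  have hu := valP u.
  have tE d : tag (last_letter (C (tagA (d : A i)))) =
    tag (last_letter (C (tagA (0 : A i)))) by exact: slot_end.
  rewrite !expr_eltM // !tE; case: eqP => [uC|_]; last by rewrite scaler0 !subr0.
  have [C' [sC' [f [fl fE]]]] := @slot_mulr i C (val u) sC uC.
  by rewrite !fE fl; apply/lin_spanG/MlinRel.
have hE d : expr_elt (C (tagA (d : A i))) = 0.
  by apply: expr_elt0; rewrite (@slot_valid C _ (tagA (0 : A i)) sC).
by rewrite !hE mul0r scaler0 !subr0.
Qed.

Definition mlin_span : expr_alg -> Prop := lin_span mlin_rel.

Fact mlin_spanMl (x y : expr_alg) : mlin_span y -> mlin_span (x * y).
Proof.
elim=> [|c g y' Gg _ IH]; first by rewrite mulr0; constructor.
rewrite mulrDr -scalerAr; apply: lin_spanD => //; apply: lin_spanZ.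
elim/cbasis_ind: x {IH} => [|d u x IH]; first by rewrite mul0r; constructor.
rewrite mulrDl -scalerAl; apply: lin_spanD => //.
by apply: lin_spanZ; apply: mlin_mull.
Qed.

Fact mlin_spanMr (x y : expr_alg) : mlin_span y -> mlin_span (y * x).
Proof.
elim=> [|c g y' Gg _ IH]; first by rewrite mul0r; constructor.
rewrite mulrDl -scalerAl; apply: lin_spanD => //; apply: lin_spanZ.
elim/cbasis_ind: x {IH} => [|d u x IH]; first by rewrite mulr0; constructor.
rewrite mulrDr -scalerAr; apply: lin_spanD => //.
by apply: lin_spanZ; apply: mlin_mulr.
Qed.

(* The component at the vertex i of the degree zero part, used to show that   *)
(* the quotient is nonzero.                                                   *)
Definition deg0_letter (i : vert Q) (u : expr) : A i :=
  if nilp (val u).2 then tagged_as (tagA (0 : A i)) (val u).1 else 0.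

Lemma tagged_asN (x y : letter) : tag x != tag y -> tagged_as x y = tagged x.
Proof. by rewrite /tagged_as; case: eqP. Qed.

Lemma deg0_mlin i x :
  mlin_span x -> lin_ext (deg0_letter i) (x : {malg k[expr]}) = 0.
Proof.
pose phi (y : expr_alg) := lin_ext (deg0_letter i) (y : {malg k[expr]}).
have phiL : linear phi by move=> c y z; rewrite /phi linearP.
have phi0 : phi 0 = 0 by rewrite /phi raddf0.
have phiB y z : phi (y - z) = phi y - phi z by rewrite /phi raddfB.
have phiZ c y : phi (c *: y) = c *: phi y.
  by have := phiL c y 0; rewrite phi0 !addr0.
have phiE w : phi (expr_elt w) =
    if nilp w.2 then tagged_as (tagA (0 : A i)) w.1 else 0.
  have [hw|hw] := boolP (is_expr w.1 w.2).
    by rewrite (expr_eltE hw) /phi lin_extU.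
  rewrite (expr_elt0 hw) phi0; case: w hw => [y [|ay s]] //=.
rewrite -/(phi x); elim=> // c _ y [C j d a b sC] _ IH.
rewrite phiL IH addr0 !phiB phiZ !phiE; case: sC => [s|x0 s1 al s2] /=.
  case: (nilp s); last by rewrite scaler0 !subr0 scaler0.
  case: (eqVneq j i) => [ji|nji].
    by subst j; rewrite !tagged_asE addrAC addrK subrr scaler0.
  by rewrite !tagged_asN 1?eq_sym //= scaler0 !subr0 scaler0.
by case: s1 => [|? ?] /=; rewrite scaler0 !subr0 scaler0.
Qed.

Fact mlin_span1 : ~ mlin_span 1.
Proof.
have [i _] : exists i : vert Q, true.
  by have /card_gt0P [i _] := vert_gt0 Q; exists i.
move/(deg0_mlin i); rewrite -[1]/(cone k expr_category) /cone.
rewrite raddf_sum (bigD1 i) //= lin_extU big1 => [|j nj].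
  by rewrite /deg0_letter /= tagged_asE addr0 => /eqP; rewrite oner_eq0.
by rewrite lin_extU /deg0_letter /= tagged_asN // eq_sym.
Qed.

Definition mlin_ideal : ideal expr_alg :=
  @Ideal k expr_alg mlin_span (lin_span0 mlin_rel)
    (@lin_spanD k expr_alg mlin_rel) mlin_spanMl mlin_spanMr mlin_span1.

Definition gen_path_alg : algType k := alg_quot mlin_ideal.

End GeneralizedPathAlgebra.

Section Realization.
Variables (k : fieldType) (Q : quiver) (S : vert Q -> quiver).

Definition real_vert := {i : vert Q & vert (S i)}.
HB.instance Definition _ := Finite.on real_vert.
Local Notation tagV := (Tagged (fun i => vert (S i))).

(* The arrows of the S i, and, for every arrow alpha : i -> j of Q, an arrow  *)
(* from a to b for each vertex a of S i and each vertex b of S j.             *)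
Definition real_arr :=
  ({i : vert Q & arr (S i)} +
   {al : arr Q & (vert (S (src al)) * vert (S (tgt al)))%type})%type.
HB.instance Definition _ := Finite.on real_arr.

Definition real_src (x : real_arr) : real_vert :=
  match x with
  | inl a => tagV (src (tagged a))
  | inr y => tagV (tagged y).1
  end.
Definition real_tgt (x : real_arr) : real_vert :=
  match x with
  | inl a => tagV (tgt (tagged a))
  | inr y => tagV (tagged y).2
  end.

Fact real_vert_gt0 : (0 < #|{: real_vert}|)%N.
Proof.
have /card_gt0P [i _] := vert_gt0 Q; have /card_gt0P [a _] := vert_gt0 (S i).
by apply/card_gt0P; exists (tagV a).
Qed.

Definition real_quiver : quiver :=
  @Quiver real_vert real_arr real_src real_tgt real_vert_gt0.

Section Embedding.
Variable i : vert Q.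

Definition emb_arr (a : arr (S i)) : arr real_quiver :=
  inl (Tagged (fun i => arr (S i)) a).

Fact emb_walk (v : vert (S i)) (p : seq (arr (S i))) :
  is_walk v p -> @is_walk real_quiver (tagV v) [seq emb_arr a | a <- p].
Proof.
elim: p v => [|a p IH] v //= /andP [/eqP <- hp].
by apply/andP; split; [exact: eqxx | exact: IH].
Qed.

Definition emb_path (p : qpath (S i)) : qpath real_quiver :=
  exist _ (tagV (val p).1, [seq emb_arr a | a <- (val p).2])
    (emb_walk (valP p)).

Definition emb : path_alg k (S i) -> path_alg k real_quiver :=
  lin_ext (fun p => path_elt k (emb_path p)).

End Embedding.

Definition real_ideal (I : forall i, path_alg k (S i) -> Prop) :
    path_alg k real_quiver -> Prop :=
  ideal_gen (fun y => exists i (x : path_alg k (S i)), I i x /\ y = emb x).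

End Realization.

Section Modules.
Variable R : nzRingType.

Definition mod_iso (M N : lmodType R) : Prop :=
  exists f : {linear M -> N}, bijective f.

Definition fin_generated (M : lmodType R) : Prop :=
  exists n (g : 'I_n -> M), forall x, exists c : 'I_n -> R,
    x = \sum_(i < n) c i *: g i.

Definition mod_indecomposable (M : lmodType R) : Prop :=
  (exists x : M, x <> 0) /\
  forall U V : {pred M}, GRing.submod_closed U -> GRing.submod_closed V ->
    (forall x, exists u v, [/\ u \in U, v \in V & x = u + v]) ->
    (forall x, x \in U -> x \in V -> x = 0) ->
    (forall x, x \in U -> x = 0) \/ (forall x, x \in V -> x = 0).

(* Modules are left modules.  For a finite dimensional algebra this property  *)
(* does not depend on the side, by the duality Hom_k(-, k).                   *)
Definition rep_finite : Prop :=
  exists n (F : 'I_n -> lmodType R), forall M : lmodType R,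
    fin_generated M -> mod_indecomposable M -> exists i, mod_iso M (F i).

End Modules.

Definition alg_indecomposable (k : fieldType) (A : algType k) : Prop :=
  forall B C : algType k, ~ alg_iso A (B * C)%type.

Definition primitive_idem (k : fieldType) (A : algType k) (e : A) : Prop :=
  [/\ e * e = e, e <> 0 &
    forall f g : A, f * f = f -> g * g = g -> f * g = 0 -> g * f = 0 ->
      e = f + g -> f = 0 \/ g = 0].

(* The left modules Ae and Af are isomorphic; as they are direct summands of  *)
(* A, homomorphisms between them are restrictions of endomorphisms of A.      *)
Definition idem_iso (k : fieldType) (A : algType k) (e f : A) : Prop :=
  exists phi psi : {linear A^o -> A^o},
    (forall x : A, exists y : A, phi (x * e) = y * f) /\
    (forall y : A, exists x : A, psi (y * f) = x * e) /\
    (forall x : A, psi (phi (x * e)) = x * e) /\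
    (forall y : A, phi (psi (y * f)) = y * f).

Definition basic (k : fieldType) (A : algType k) : Prop :=
  exists n (e : 'I_n -> A),
    [/\ forall i, primitive_idem (e i),
        forall i j, i != j -> e i * e j = 0,
        \sum_(i < n) e i = 1 &
        forall i j, i != j -> ~ idem_iso (e i) (e j)].

(* The product of l copies of k, for l > 0 only: an algType is nonzero.       *)
Fixpoint kpow (k : fieldType) (l : nat) : algType k :=
  match l with
  | 0 | 1 => k^o
  | l'.+1 => (k^o * kpow k l')%type
  end.

Definition num_edges (Q : quiver) (x y : vert Q) : nat :=
  #|[pred a : arr Q | (src a == x) && (tgt a == y) ||
                      (src a == y) && (tgt a == x)]|.

(* Edges of the Dynkin graphs on the vertices 1, 2, ...                       *)
Definition sym_rel (r : rel nat) : rel nat := fun i j => r i j || r j i.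
Definition edgeA : rel nat := sym_rel (fun i j => j == i.+1).
Definition edgeD : rel nat := sym_rel (fun i j =>
  (i == 1%N) && (j == 3%N) || (2 <= i)%N && (j == i.+1)).
Definition edgeE : rel nat := sym_rel (fun i j =>
  (i == 3%N) && (j == 5%N) || (i != 4%N) && (j == i.+1)).

(* phi i is the vertex numbered i + 1; since edgeX i i is false, there are no *)
(* loops.                                                                     *)
Definition numbering (Q : quiver) (edgeX : rel nat) (n : nat)
    (phi : 'I_n -> vert Q) : Prop :=
  bijective phi /\
  forall i j : 'I_n, num_edges (phi i) (phi j) = edgeX i.+1 j.+1.

Definition of_type (Q : quiver) (edgeX : rel nat) (n : nat) : Prop :=
  exists phi : 'I_n -> vert Q, numbering edgeX phi.

Definition dynkinDE (Q : quiver) : Prop :=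
  (exists2 n, (4 <= n)%N & of_type Q edgeD n) \/
  of_type Q edgeE 6 \/ of_type Q edgeE 7 \/ of_type Q edgeE 8.

Definition dynkin (Q : quiver) : Prop :=
  (exists2 n, (1 <= n)%N & of_type Q edgeA n) \/ dynkinDE Q.

(* Main.v *)
Require Import Defs.
From HB Require Import structures.
From mathcomp Require Import all_boot all_order fingroup perm all_algebra all_field.
From mathcomp Require Import boolp finmap zify ring.
From mathcomp.multinomials Require Import monalg.

Set Implicit Arguments.
Unset Strict Implicit.
Unset Printing Implicit Defensive.

Import Order.TTheory GRing.Theory Num.Theory.
Local Open Scope ring_scope.

(** The theorem is reduced to a statement about the Tits form of the quiver [Q]
   of the realization, the quadratic form that sends [d] to the sum of the
   [d i ^ 2] over the vertices minus the sum of the [d (src a) * d (tgt a)] over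
   the arrows; call it positive when it is positive on nonzero vectors with
   nonnegative entries ([weakly_positive]).

   The path algebra of a quiver without oriented cycles is representation-finite
   if and only if the form is positive. If it is, then every indecomposable
   representation is a brick ([indec_brick]). A brick has no self-extension, since
   the kernel and the cokernel of the map [f |-> F f - f F] are the endomorphisms
   and the self-extensions, and their dimensions differ by a positive value of the
   form. Therefore a brick is isomorphic to almost all points of any line through
   it, two bricks of equal dimension vector are isomorphic ([brick_iso]), and
   their dimension vectors are roots of the form, of which there are finitely many
   because the gradient of the form at a root is bounded and determines the root
   ([dim_class]); this is [wpos_rep_finite]. Conversely, if there are finitely many
   indecomposables, then there are finitely many orbits of representations with
   dimension vector [d]. A count of polynomial functions shows that then the group
   of base changes, modulo scalars, has at least as many parameters as the space of
   representations, that is, the form is positive at [d] ([rep_finite_wpos]).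

   Representation-finiteness passes to quotients ([rep_finite_quotient]). The
   generalized path algebra maps onto the path algebra of a quiver that keeps all
   arrows that come from [Gamma] and a single arrow of one [Sigma i]
   ([blow_map]). As [Gamma] is connected and has a second vertex, this quiver
   contains a triangle, and its form is not positive. Hence in the
   representation-finite case no [Sigma i] has an arrow, every [A i] is a power
   [k ^ l i], the ideal is zero, and the generalized path algebra is the path
   algebra of [Q], which is [Gamma] with the vertex [i] replaced by [l i] copies
   ([no_arrow_iso]); the same holds under the conditions of the theorem.

   The rest concerns the form of [Q]. A connected quiver with positive form is
   Dynkin: take a longest path; every further configuration of edges carries one
   of the null vectors of the extended Dynkin graphs ([wpos_dynkin]). The same kind
   of test vectors, now on [Gamma] with multiplicities, excludes all multiplicities
   but the listed ones ([positive_dynkin_mult]). Each of the listed ones has a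
   vector with positive entries and positive gradient, and this forces the form to
   be positive ([dynkin_mult_wpos]). *)

(** * Homogeneous linear systems indexed by finite types *)

Section LinearSystems.
Variables (k : fieldType) (J V : finType).
Implicit Type P : J -> V -> k.

Definition sys_mx P : 'M[k]_(#|J|, #|V|) :=
  \matrix_(i, j) P (enum_val i) (enum_val j).

Lemma sys_mxE P (u : J -> k) (v : V) :
  \sum_j u j * P j v = ((\row_i u (enum_val i)) *m sys_mx P) 0 (enum_rank v).
Proof.
rewrite mxE (reindex_onto (@enum_val J J) enum_rank) /=; last first.
  by move=> j _; rewrite enum_rankK.
rewrite (eq_bigl predT) => [|i]; last by rewrite enum_valK eqxx.
by apply: eq_bigr => i _; rewrite !mxE enum_rankK.
Qed.

Lemma lin_sys_sol P : (#|V| < #|J|)%N ->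
  exists u : J -> k, (exists j, u j <> 0) /\ forall v, \sum_j u j * P j v = 0.
Proof.
move=> lt; have : kermx (sys_mx P) != 0.
  rewrite kermx_eq0 /row_free neq_ltn; apply/orP; left.
  exact: leq_ltn_trans (rank_leq_col _) lt.
case/matrix0Pn => i [j /eqP nz].
exists (fun x => kermx (sys_mx P) i (enum_rank x)); split.
  by exists (enum_val j); rewrite enum_valK.
move=> v; rewrite sys_mxE.
have -> : (\row_l kermx (sys_mx P) i (enum_rank (enum_val l))) = row i (kermx (sys_mx P)).
  by apply/rowP => l; rewrite [RHS]mxE [LHS]mxE enum_valK.
by rewrite -row_mul mulmx_ker !mxE.
Qed.

(** With more unknowns than equations, a kernel of dimension at most one leaves no
   room for a cokernel. *)
Lemma lin_sys_onto P (v0 : J -> k) : (#|V| < #|J|)%N ->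
  (forall u, (forall v, \sum_j u j * P j v = 0) ->
     exists c, forall j, u j = c * v0 j) ->
  forall psi : V -> k, exists u, forall v, \sum_j u j * P j v = psi v.
Proof.
move=> lt ker1 psi; pose A := sys_mx P.
pose r : 'rV[k]_#|J| := \row_j v0 (enum_val j).
have kr : (kermx A <= r)%MS.
  apply/row_subP => i; pose u x := kermx A i (enum_rank x).
  have [v|c uc] := ker1 u.
    rewrite sys_mxE.
    have -> : (\row_l u (enum_val l)) = row i (kermx A).
      by apply/rowP => l; rewrite [RHS]mxE [LHS]mxE /u enum_valK.
    by rewrite -row_mul mulmx_ker !mxE.
  have -> : row i (kermx A) = c *: r.
    by apply/rowP => l; rewrite mxE [RHS]mxE [r _ _]mxE -uc /u enum_valK.
  by apply: scalemx_sub; apply: submx_refl.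
have rA : row_full A.
  rewrite /row_full eqn_leq rank_leq_col /=.
  have := mxrankS kr; rewrite mxrank_ker => le1.
  have := leq_trans le1 (rank_leq_row r); rewrite leq_subLR => le2.
  by move: (leq_trans lt le2); rewrite addn1 ltnS.
pose s := (\row_j psi (enum_val j)) *m pinvmx A.
exists (fun j => s 0 (enum_rank j)) => v; rewrite sys_mxE.
have -> : (\row_l s 0 (enum_rank (enum_val l))) = s.
  by apply/rowP => l; rewrite [LHS]mxE enum_valK.
by rewrite -/A /s -mulmxA mulVpmx // mulmx1 mxE enum_rankK.
Qed.

End LinearSystems.

(** The equation that kills a coordinate where [v0] does not vanish excludes the
   multiples of [v0]. *)
Lemma lin_sys_sol2 (k : fieldType) (J V : finType) (P : J -> V -> k)
    (v0 : J -> k) : (#|V|.+1 < #|J|)%N -> (exists j, v0 j <> 0) ->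
  exists u, (forall v, \sum_j u j * P j v = 0) /\
    ~ exists c, forall j, u j = c * v0 j.
Proof.
move=> lt [j0 nz].
pose P' j (v : option V) := if v is Some v then P j v else (j == j0)%:R.
have [|u [[j1 u1] us]] := @lin_sys_sol k J (option V) P'; first by rewrite card_option.
exists u; split=> [v|[c uc]]; first exact: (us (Some v)).
have u0 : u j0 = 0.
  rewrite -[RHS](us None) (bigD1 j0) //= eqxx mulr1 big1 ?addr0 // => j.
  by move/negPf=> ->; rewrite mulr0.
apply: u1; rewrite uc; suff -> : c = 0 by rewrite mul0r.
by have /eqP := uc j0; rewrite u0 eq_sym mulf_eq0 => /orP [/eqP|/eqP].
Qed.

(** Bordering the system by one more column, chosen so that the bordered square
   matrix is invertible at [t0], turns the last row of its adjugate into a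
   polynomial solution. *)
Lemma poly_sys_sol (k : fieldType) (J V : finType) (P : J -> V -> {poly k})
    (t0 : k) (v0 : J -> k) : #|J| = #|V|.+1 -> (exists j, v0 j <> 0) ->
  (forall v, \sum_j v0 j * (P j v).[t0] = 0) ->
  (forall u, (forall v, \sum_j u j * (P j v).[t0] = 0) ->
     exists c, forall j, u j = c * v0 j) ->
  exists (v : J -> {poly k}) (c : k), [/\ c != 0,
    forall j, (v j).[t0] = c * v0 j &
    forall t w, \sum_j (v j).[t] * (P j w).[t] = 0].
Proof.
move=> cJ [j0 nz] v0P ker1.
have e : #|{: option V}| = #|J| by rewrite card_option.
pose n := #|J|.
pose P' j (v : option V) := if v is Some v then P j v else (j == j0)%:R.
pose oc (i : 'I_n) : option V := enum_val (cast_ord (esym e) i).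
pose co (v : option V) : 'I_n := cast_ord e (enum_rank v).
have ocK : cancel co oc by move=> v; rewrite /oc /co cast_ordK enum_rankK.
pose B : 'M[{poly k}]_n := \matrix_(i, j) P' (enum_val i) (oc j).
have BE i j : B i j = P' (enum_val i) (oc j) by rewrite mxE.
pose v j := \adj B (co None) (enum_rank j).
have vB w : \sum_j v j * P' j w = (w == None)%:R * \det B.
  transitivity ((\adj B *m B) (co None) (co w)); last first.
    by rewrite mul_adj_mx mxE (can_eq ocK) eq_sym mulrb -mulrb mulr_natl mulrb.
  rewrite mxE (reindex_onto (@enum_val J J) enum_rank) /=; last first.
    by move=> j _; rewrite enum_rankK.
  rewrite (eq_bigl predT) => [|i]; last by rewrite enum_valK eqxx.
  by apply: eq_bigr => i _; rewrite BE /v enum_valK ocK.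
have vt t w : \sum_j (v j).[t] * (P' j w).[t] = ((w == None)%:R * \det B).[t].
  by rewrite -vB horner_sum; apply: eq_bigr => j _; rewrite hornerM.
have PN j t : (P' j None).[t] = (j == j0)%:R by rewrite /=; case: eqP => _; rewrite ?hornerC.
have dB : (\det B).[t0] != 0.
  have -> : (\det B).[t0] = \det (map_mx (horner_eval t0) B).
    by rewrite det_map_mx.
  rewrite -unitfE -unitmxE -row_free_unit -kermx_eq0.
  apply/eqP/row_matrixP => i; rewrite row0.
  have BtE j l : map_mx (horner_eval t0) B j l = (P' (enum_val j) (oc l)).[t0].
    by rewrite mxE BE.
  move: (row i (kermx (map_mx _ _))) (row_mul i (kermx (map_mx (horner_eval t0) B)) (map_mx (horner_eval t0) B)) => r.
  rewrite mulmx_ker row0 => /esym rB.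
  have rs w : \sum_j r 0 (enum_rank j) * (P' j w).[t0] = 0.
    transitivity ((r *m map_mx (horner_eval t0) B) 0 (co w)); last by rewrite rB mxE.
    rewrite mxE (reindex_onto (@enum_val J J) enum_rank) /=; last first.
      by move=> j _; rewrite enum_rankK.
    rewrite (eq_bigl predT) => [|j]; last by rewrite enum_valK eqxx.
    by apply: eq_bigr => j _; rewrite enum_valK BtE ocK.
  have [|c rc] := ker1 (fun j => r 0 (enum_rank j)); first by move=> w; exact: (rs (Some w)).
  have r0 : r 0 (enum_rank j0) = 0.
    rewrite -[RHS](rs None) (bigD1 j0) // PN eqxx mulr1 big1 /= => [|j]; first by rewrite addr0.
    by move/negPf=> nj; rewrite PN nj mulr0.
  have c0 : c = 0.
    by have /eqP := rc j0; rewrite r0 eq_sym mulf_eq0 => /orP [/eqP|/eqP].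
  apply/rowP => j; rewrite [RHS]mxE -[j]enum_valK rc c0; exact: mul0r.
have vk w : \sum_j (v j).[t0] * (P j w).[t0] = 0.
  by have := vt t0 (Some w); rewrite mul0r horner0.
have [c vc] := ker1 _ vk.
exists v, c; split=> //; last first.
  by move=> t w; have := vt t (Some w); rewrite mul0r horner0.
apply: contra_neq dB => c0; have := vt t0 None; rewrite mul1r => <-.
by rewrite big1 // => j _; rewrite vc c0 !mul0r.
Qed.

(** * Matrix representations *)

Lemma dep_choice (I : Type) (T : I -> Type) (P : forall i, T i -> Prop) :
  (forall i, exists y, P i y) -> exists y : forall i, T i, forall i, P i (y i).
Proof. by move=> h; exists (fun i => projT1 (cid (h i))) => i; case: cid. Qed.

Section Representations.
Variables (k : fieldType) (Q : quiver).

Record rep := Rep {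
  rdim : vert Q -> nat;
  rmap : forall a, 'M[k]_(rdim (src a), rdim (tgt a))
}.

Definition repfam (X Y : rep) := forall i, 'M[k]_(rdim X i, rdim Y i).

Definition is_hom (X Y : rep) (f : repfam X Y) : Prop :=
  forall a, rmap X a *m f (tgt a) = f (src a) *m rmap Y a.

Definition rep_iso (X Y : rep) : Prop :=
  exists (f : repfam X Y) (g : repfam Y X),
    [/\ is_hom f, forall i, f i *m g i = 1%:M & forall i, g i *m f i = 1%:M].

Definition rep_nonzero (X : rep) : Prop := exists i, rdim X i <> 0%N.

Definition rep_indec (X : rep) : Prop :=
  rep_nonzero X /\
  forall e : repfam X X, is_hom e -> (forall i, e i *m e i = e i) ->
    (forall i, e i = 0) \/ (forall i, e i = 1%:M).

Definition brick (X : rep) : Prop :=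
  forall f : repfam X X, is_hom f -> exists c, forall i, f i = c%:M.

Definition total_dim (X : rep) : nat := (\sum_i rdim X i)%N.

Definition total_rank (X Y : rep) (f : repfam X Y) : nat := (\sum_i \rank (f i))%N.

Lemma is_hom_comp X Y Z (f : repfam X Y) (g : repfam Y Z) :
  is_hom f -> is_hom g -> is_hom (fun i => f i *m g i).
Proof. by move=> hf hg a; rewrite mulmxA hf -mulmxA hg mulmxA. Qed.

Lemma is_hom_id X : is_hom (fun i => 1%:M : 'M_(rdim X i, rdim X i)).
Proof. by move=> a; rewrite mulmx1 mul1mx. Qed.

Lemma is_homB X Y (f g : repfam X Y) :
  is_hom f -> is_hom g -> is_hom (fun i => f i - g i).
Proof. by move=> hf hg a; rewrite mulmxBr mulmxBl hf hg. Qed.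

Lemma is_homD X Y (f g : repfam X Y) :
  is_hom f -> is_hom g -> is_hom (fun i => f i + g i).
Proof. by move=> hf hg a; rewrite mulmxDr mulmxDl hf hg. Qed.

Lemma is_hom_scalar X (c : k) : is_hom (fun i => c%:M : 'M_(rdim X i, rdim X i)).
Proof. by move=> a; rewrite scalar_mxC. Qed.

Lemma is_hom_inv X Y (f : repfam X Y) (g : repfam Y X) :
  is_hom f -> (forall i, f i *m g i = 1%:M) -> (forall i, g i *m f i = 1%:M) ->
  is_hom g.
Proof.
move=> hf fg gf a.
by rewrite -[LHS]mul1mx -gf -!mulmxA (mulmxA (f _)) -hf -!mulmxA fg mulmx1.
Qed.

Lemma rep_iso_sym X Y : rep_iso X Y -> rep_iso Y X.
Proof. by move=> [f [g [hf fg gf]]]; exists g, f; split=> //; apply: is_hom_inv hf _ _. Qed.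

Lemma rep_iso_trans X Y Z : rep_iso X Y -> rep_iso Y Z -> rep_iso X Z.
Proof.
move=> [f [g [hf fg gf]]] [f' [g' [hf' fg' gf']]].
exists (fun i => f i *m f' i), (fun i => g' i *m g i); split.
- exact: is_hom_comp.
- by move=> i; rewrite mulmxA -(mulmxA (f i)) fg' mulmx1.
- by move=> i; rewrite mulmxA -(mulmxA (g' i)) gf mulmx1.
Qed.

(** A family of subspaces that is stable under the structure maps, given by
   independent rows, carries a representation. *)
Definition subrep X (n : vert Q -> nat) (U : forall i, 'M[k]_(n i, rdim X i)) : rep :=
  @Rep n (fun a => U (src a) *m rmap X a *m pinvmx (U (tgt a))).

Lemma subrep_hom X n (U : forall i, 'M[k]_(n i, rdim X i)) :
  (forall a, (U (src a) *m rmap X a <= U (tgt a))%MS) ->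
  @is_hom (subrep U) X U.
Proof. by move=> st a; rewrite /= mulmxKpV. Qed.

Lemma hom_lift X Y Z (f : repfam X Y) (u : repfam Z X) :
  (forall i, row_free (f i)) -> is_hom f -> is_hom (fun i => u i *m f i) ->
  is_hom u.
Proof.
move=> rf hf huf a; apply: (row_free_inj (rf (tgt a))).
by rewrite /= -mulmxA huf -!mulmxA hf.
Qed.

(** Kernels, in the form of the universal property. *)
Lemma rep_kernel X Y (f : repfam X Y) : is_hom f ->
  exists (K : rep) (u : repfam K X),
    [/\ is_hom u, forall i, row_free (u i),
        forall i, rdim K i = (rdim X i - \rank (f i))%N &
        forall i m (A : 'M_(m, rdim X i)), A *m f i = 0 <-> (A <= u i)%MS].
Proof.
move=> hf; pose U i := row_base (kermx (f i)).
exists (subrep U), U.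
have kU i m (A : 'M_(m, rdim X i)) : A *m f i = 0 <-> (A <= U i)%MS.
  by rewrite eq_row_base; split=> /sub_kermxP.
split=> [|i|i|//]; last 2 first.
- exact: row_base_free.
- by rewrite /= mxrank_ker.
apply: subrep_hom => a; apply/kU.
by rewrite -mulmxA hf mulmxA (_ : U _ *m f _ = 0) ?mul0mx //; apply/kU.
Qed.

Lemma rep_split X (e : repfam X X) : is_hom e -> (forall i, e i *m e i = e i) ->
  exists (L : rep) (s : repfam L X) (p : repfam X L),
    [/\ is_hom s, is_hom p, forall i, p i *m s i = e i &
        forall i, s i *m p i = 1%:M] /\
    forall i, rdim L i = \rank (e i).
Proof.
move=> he ee; pose S i := row_base (e i).
have Se i : S i *m e i = S i.
  have /submxP [B ->] : (S i <= e i)%MS by rewrite eq_row_base.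
  by rewrite -mulmxA ee.
have sub i : (e i <= S i)%MS by rewrite eq_row_base.
have hS : @is_hom (subrep S) X S.
  apply: subrep_hom => a; apply: submx_trans (sub _).
  by rewrite -(Se (src a)) -mulmxA -he mulmxA submxMl.
exists (subrep S), S, (fun i => e i *m pinvmx (S i)).
have ps i : e i *m pinvmx (S i) *m S i = e i by rewrite mulmxKpV.
split=> //; split=> //.
- apply: (@hom_lift (subrep S) X X S (fun i => e i *m pinvmx (S i))) => // [i|].
    exact: row_base_free.
  by move=> a; rewrite /= !ps.
- by move=> i; rewrite mulmxA Se mulmxVp // row_base_free.
Qed.

Lemma rank_id_eq n (A : 'M[k]_n) : \rank A = n -> A *m A = A -> A = 1%:M.
Proof.
move=> r AA; have Au : A \in unitmx by rewrite -row_full_unit /row_full r.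
by rewrite -[A]mul1mx -(mulVmx Au) -mulmxA AA.
Qed.

(** If the rank of an endomorphism does not drop when it is squared, then it is
   bijective on its image, and the projection onto the image along the kernel is
   an endomorphism. *)
Lemma fitting X (f : repfam X X) : is_hom f -> rep_indec X ->
  (exists i, f i <> 0) ->
  (forall i, \rank (f i *m f i) = \rank (f i)) -> forall i, f i \in unitmx.
Proof.
move=> hf [_ indX] [i0 nf0] rk.
have yP i : exists y, f i = y *m f i *m f i.
  have : (f i <= f i *m f i)%MS by rewrite -(geq_leqif (mxrank_leqif_sup (submxMl _ _))) rk.
  by case/submxP=> y e; exists y; rewrite -mulmxA.
have xP i : exists x, f i = f i *m f i *m x.
  have : ((f i)^T <= (f i *m f i)^T)%MS.
    rewrite trmx_mul -(geq_leqif (mxrank_leqif_sup (submxMl _ _))).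
    by rewrite -trmx_mul !mxrank_tr rk.
  case/submxP=> y /(congr1 trmx); rewrite trmxK trmx_mul trmxK => e.
  by exists y^T.
have [y {}yP] := dep_choice yP; have [x {}xP] := dep_choice xP.
pose e i := y i *m f i.
have eE i : e i = f i *m x i by rewrite /e {1}xP !mulmxA -yP.
have ee i : e i *m e i = e i.
  by rewrite {1}/e eE -mulmxA (mulmxA (f i)) -xP -eE.
have ef i : e i *m f i = f i by rewrite /e -yP.
have fe i : f i *m e i = f i by rewrite eE mulmxA -xP.
have he : is_hom e.
  move=> a; transitivity (e (src a) *m rmap X a *m e (tgt a)).
    by rewrite eE !mulmxA hf -(mulmxA (e _)) hf !mulmxA ef.
  have -> : e (src a) *m rmap X a = y (src a) *m rmap X a *m f (tgt a).
    by rewrite /e -!mulmxA hf.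
  by rewrite -mulmxA fe.
case: (indX e he ee) => e01 i.
  by case: nf0; rewrite -ef e01 mul0mx.
by have := e01 i; rewrite /e => /mulmx1_unit [].
Qed.

End Representations.

Arguments rdim {k Q} _ _.
Arguments rmap {k Q} _ _.

(** * The Tits form and the intertwining equations *)

(** Positivity of the Tits form on nonzero dimension vectors. *)
Definition weakly_positive (Q : quiver) : Prop :=
  forall d : vert Q -> nat, (exists i, d i <> 0%N) ->
    (\sum_(a : arr Q) d (src a) * d (tgt a) < \sum_(i : vert Q) d i * d i)%N.

Section Intertwining.
Variables (Q : quiver) (d : vert Q -> nat).

(** Indices for the entries of a family of endomorphisms of the spaces at the
   vertices, and for the entries of a family of structure maps. *)
Definition end_idx := {i : vert Q & ('I_(d i) * 'I_(d i))%type}.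
HB.instance Definition _ := Finite.on end_idx.
Definition map_idx := {a : arr Q & ('I_(d (src a)) * 'I_(d (tgt a)))%type}.
HB.instance Definition _ := Finite.on map_idx.

Lemma card_end_idx : #|{: end_idx}| = (\sum_(i : vert Q) d i * d i)%N.
Proof.
rewrite card_tagged sumnE big_map big_enum.
by apply: eq_bigr => i _; rewrite card_prod card_ord.
Qed.

Lemma card_map_idx :
  #|{: map_idx}| = (\sum_(a : arr Q) d (src a) * d (tgt a))%N.
Proof.
rewrite card_tagged sumnE big_map big_enum.
by apply: eq_bigr => i _; rewrite card_prod !card_ord.
Qed.

Definition end_of (R : Type) (u : end_idx -> R) i : 'M[R]_(d i, d i) :=
  \matrix_(p, q) u (Tagged (fun i => 'I_(d i) * 'I_(d i))%type (p, q)).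
Definition end_coef (R : Type) (f : forall i, 'M[R]_(d i, d i)) (j : end_idx) : R :=
  f (tag j) (tagged j).1 (tagged j).2.
Definition map_of (R : Type) (u : map_idx -> R) a : 'M[R]_(d (src a), d (tgt a)) :=
  \matrix_(p, q) u (Tagged (fun a => 'I_(d (src a)) * 'I_(d (tgt a)))%type (p, q)).
Definition map_coef (R : Type) (f : forall a, 'M[R]_(d (src a), d (tgt a)))
  (v : map_idx) : R := f (tag v) (tagged v).1 (tagged v).2.

Lemma end_coefK (R : Type) (f : forall i, 'M[R]_(d i, d i)) i : end_of (end_coef f) i = f i.
Proof. by apply/matrixP => p q; rewrite mxE. Qed.

Lemma end_ofK (R : Type) (u : end_idx -> R) j : end_coef (end_of u) j = u j.
Proof. by case: j => i [p q]; rewrite /end_coef mxE. Qed.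

Section System.
Variables (R : comPzRingType).
Variables (F G : forall a : arr Q, 'M[R]_(d (src a), d (tgt a))).

Definition twist (f : forall i, 'M[R]_(d i, d i)) a :
  'M[R]_(d (src a), d (tgt a)) := F a *m f (tgt a) - f (src a) *m G a.

(** The matrix of [twist] on entries; its kernel consists of the homomorphisms, and
   for [F = G] its cokernel of the self-extensions. *)
Definition twist_sys (j : end_idx) (v : map_idx) : R :=
  map_coef (twist (end_of (fun j' => (j' == j)%:R))) v.

Lemma twist_sysE (u : end_idx -> R) v :
  \sum_j u j * twist_sys j v = map_coef (twist (end_of u)) v.
Proof.
have uE i : end_of u i = \sum_j u j *: end_of (fun j' => (j' == j)%:R) i.
  apply/matrixP => p q; rewrite summxE mxE.
  rewrite (bigD1 (Tagged (fun i => 'I_(d i) * 'I_(d i))%type (p, q))) //=.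
  rewrite !mxE eqxx mulr1 big1 ?addr0 // => j nj.
  by rewrite !mxE eq_sym (negPf nj) mulr0.
rewrite /map_coef /twist uE uE mulmx_sumr mulmx_suml -sumrB summxE.
apply: eq_bigr => j _; rewrite /twist_sys /map_coef /twist.
by rewrite -scalemxAr -scalemxAl -scalerBr [RHS]mxE.
Qed.

Lemma twist_eq0P (u : end_idx -> R) :
  (forall v, \sum_j u j * twist_sys j v = 0) <->
  forall a, F a *m end_of u (tgt a) = end_of u (src a) *m G a.
Proof.
split=> [h a|h v].
  apply/eqP; rewrite -subr_eq0; apply/eqP/matrixP => p q.
  have := h (Tagged (fun a => 'I_(d (src a)) * 'I_(d (tgt a)))%type (p, q)).
  by rewrite twist_sysE /map_coef /twist /= => ->; rewrite mxE.
by rewrite twist_sysE /map_coef /twist h subrr mxE.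
Qed.

End System.
End Intertwining.

Section Bricks.
Variables (k : fieldType) (Q : quiver).
Hypothesis wpos : weakly_positive Q.
Implicit Types X Y L K : rep k Q.

Let one_coef X := end_coef (fun i => 1%:M : 'M[k]_(rdim X i)).

Lemma brick_sys X : brick X ->
  forall u, (forall v, \sum_j u j * twist_sys (rmap X) (rmap X) j v = 0) ->
  exists c, forall j, u j = c * @one_coef X j.
Proof.
move=> bX u /twist_eq0P hu; have [c uc] := bX (end_of u) hu.
exists c => j; rewrite -[LHS](@end_ofK Q (rdim X)) /one_coef /end_coef uc.
by rewrite !mxE -mulr_natr.
Qed.

Lemma one_coef_neq0 X : rep_nonzero X -> exists j, @one_coef X j <> 0.
Proof.
move=> [i]; case e : (rdim X i) => [//|n] _.
have lt : (0 < rdim X i)%N by rewrite e.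
exists (Tagged (fun i => 'I_(rdim X i) * 'I_(rdim X i))%type (Ordinal lt, Ordinal lt)).
by rewrite /one_coef /end_coef mxE eqxx => /eqP; rewrite oner_eq0.
Qed.

Lemma wpos_card X : rep_nonzero X ->
  (#|{: map_idx (rdim X)}| < #|{: end_idx (rdim X)}|)%N.
Proof. by move=> nX; rewrite card_end_idx card_map_idx; apply: wpos. Qed.

(** A brick has no self-extension: the cokernel of the intertwining map
   represents the self-extensions, the kernel is one-dimensional, and the
   difference of the dimensions is the value of the Tits form. *)
Lemma brick_rigid X : rep_nonzero X -> brick X ->
  forall psi : forall a, 'M[k]_(rdim X (src a), rdim X (tgt a)),
  exists phi : forall i, 'M[k]_(rdim X i, rdim X i),
    forall a, rmap X a *m phi (tgt a) - phi (src a) *m rmap X a = psi a.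
Proof.
move=> nX bX psi.
have [u us] := lin_sys_onto (wpos_card nX) (brick_sys bX) (map_coef psi).
exists (end_of u) => a; apply/matrixP => p q.
have := us (Tagged (fun a => 'I_(rdim X (src a)) * 'I_(rdim X (tgt a)))%type (p, q)).
by rewrite twist_sysE /map_coef /=.
Qed.

(** A second unknown in excess would give an endomorphism that is not a scalar. So
   the dimension vector of a brick is a root of the Tits form. *)
Lemma brick_card X : rep_nonzero X -> brick X ->
  #|{: end_idx (rdim X)}| = #|{: map_idx (rdim X)}|.+1.
Proof.
move=> nX bX; apply/eqP; rewrite eqn_leq wpos_card // andbT leqNgt.
apply/negP => lt.
have [u [us nu]] := lin_sys_sol2 (twist_sys (rmap X) (rmap X)) lt (one_coef_neq0 nX).
exact: nu (brick_sys bX us).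
Qed.

End Bricks.

Section Ringel.
Variables (k : closedFieldType) (Q : quiver).
Hypothesis wpos : weakly_positive Q.
Implicit Types X Y L K M : rep k Q.

(** Over an algebraically closed field, subtract an eigenvalue of one component. *)
Lemma brickPn X : rep_indec X -> ~ brick X ->
  exists f : repfam X X, [/\ is_hom f, exists i, f i <> 0 & exists i, f i \notin unitmx].
Proof.
move=> [[i0 n0] _] nb.
have [f hf nf] : exists2 f : repfam X X, is_hom f & forall c, exists i, f i <> c%:M.
  apply: contrapT => h; apply: nb => f hf; apply: contrapT => h'; apply: h.
  exists f => // c; apply: contrapT => h; apply: h'; exists c => i.
  by apply: contrapT => h'; apply: h; exists i.
have [c rc] : exists c, root (char_poly (f i0)) c.
  apply/closed_rootP; rewrite size_char_poly.
  by case: (rdim X i0) n0.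
exists (fun i => f i - c%:M); split.
- by apply: is_homB => //; apply: is_hom_scalar.
- by have [i ni] := nf c; exists i => /subr0_eq.
- exists i0; rewrite -row_free_unit -kermx_eq0.
  by move: rc; rewrite -eigenvalue_root_char.
Qed.

Lemma nat_min (P : nat -> Prop) : (exists n, P n) ->
  exists n, P n /\ forall m, P m -> (n <= m)%N.
Proof.
move=> ex; have ex' : exists n, `[< P n >] by have [n /asboolP] := ex; exists n.
by case: (ex_minnP ex') => n /asboolP Pn h; exists n; split=> // m /asboolP; apply: h.
Qed.

(** A summand of [K] on which a given map to [K] does not vanish, chosen minimal,
   is indecomposable. *)
Lemma indec_summand M K (g : repfam M K) : (exists i, g i <> 0) ->
  exists L (s : repfam L K) (p : repfam K L),
    [/\ rep_indec L, is_hom s, is_hom p, forall i, s i *m p i = 1%:M &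
        exists i, g i *m p i <> 0].
Proof.
move=> [i0 ng].
pose P n := exists L (s : repfam L K) (p : repfam K L),
    [/\ total_dim L = n, is_hom s, is_hom p, forall i, s i *m p i = 1%:M &
        exists i, g i *m p i <> 0].
have [|n [[L [s [p [tL hs hp sp [i1 gp]]]]] min]] := @nat_min P.
  exists (total_dim K), K, (fun i => 1%:M), (fun i => 1%:M).
  by split=> //; do ?[exact: is_hom_id]; [move=> i|exists i0]; rewrite mulmx1.
exists L, s, p; split=> //; last by exists i1.
split; first by exists i1 => e; apply: gp; move: (g i1 *m p i1); rewrite e => A; apply/matrixP => ? [].
(* If e is an idempotent of L, then the image of e or that of 1 - e still *)
(* receives a nonzero map; minimality makes the other one vanish.         *)
have key (e : repfam L L) : is_hom e -> (forall i, e i *m e i = e i) ->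
    (exists i, g i *m p i *m e i <> 0) -> forall i, e i = 1%:M.
  move=> he ee [i ne].
  have [L' [s' [p' [[hs' hp' ps' sp'] dL']]]] := rep_split he ee.
  have : (n <= total_dim L')%N.
    apply: min; exists L', (fun i => s' i *m s i), (fun i => p i *m p' i); split=> //.
    - exact: is_hom_comp.
    - exact: is_hom_comp.
    - by move=> j; rewrite mulmxA -(mulmxA (s' j)) sp mulmx1.
    - exists i => h; apply: ne.
      by rewrite -ps' !mulmxA -(mulmxA (g i)) h mul0mx.
  rewrite -tL /total_dim => le j; apply: rank_id_eq => //.
  apply/eqP; rewrite eqn_leq rank_leq_row /= leqNgt; apply/negP => lt.
  move: le; rewrite leqNgt => /negP; apply.
  rewrite (eq_bigr (fun i => \rank (e i))) // (bigD1 j) //= [X in (_ < X)%N](bigD1 j) //=.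
  by rewrite -addSn leq_add //; apply: leq_sum => l _; apply: rank_leq_row.
move=> e he ee.
have [h|h] := pselect (exists i, g i *m p i *m e i <> 0).
  by right; apply: key.
left=> i; pose e' : repfam L L := fun i => 1%:M - e i.
have : e' i = 1%:M.
  apply: key.
  - by apply: is_homB he; apply: is_hom_id.
  - by move=> j; rewrite /e' mulmxBr mulmx1 mulmxBl mul1mx ee subrr subr0.
  - exists i1; rewrite /e' mulmxBr mulmx1 => h'; apply: gp.
    apply/eqP; rewrite -[X in X == _](subrK (g i1 *m p i1 *m e i1)) h' add0r; apply/eqP.
    by apply: contrapT => h2; apply: h; exists i1.
by rewrite /e' => /eqP; rewrite subr_eq addrC -subr_eq subrr eq_sym => /eqP.
Qed.

(** Over a quiver with weakly positive Tits form every indecomposable is a brick.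
   Among the nonzero endomorphisms of a counterexample [M] let [f] have least
   rank; then [f] has square zero. Let [L] be an indecomposable summand of the
   kernel [K] of [f] that receives a nonzero map from the image of [f]. By
   induction [L] is a brick, hence without self-extensions; as the image of [f]
   embeds in [L], the projection of [K] onto [L] extends to [M], and [L] is a
   proper summand of [M]. *)
Theorem indec_brick M : rep_indec M -> brick M.
Proof.
have [n] := ubnP (total_dim M); elim: n M => // n IH M /ltnSE le indM.
apply: contrapT => nb.
have [f0 [hf0 nf0 [i0 nu0]]] := brickPn indM nb.
pose P r := exists f : repfam M M, [/\ total_rank f = r, is_hom f & exists i, f i <> 0].
have [|r [[f [fr hf nf]] min]] := @nat_min P; first by exists (total_rank f0), f0.
have minf (g : repfam M M) : is_hom g -> (exists i, g i <> 0) -> (r <= total_rank g)%N.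
  by move=> hg ng; apply: min; exists g.
have nuf : exists i, f i \notin unitmx.
  apply: contrapT => h.
  have full i : \rank (f i) = rdim M i.
    apply/eqP; rewrite -/(row_free _) row_free_unit.
    by apply: contrapT => /negP nu; apply: h; exists i.
  have := minf f0 hf0 nf0; rewrite -fr /total_rank leqNgt => /negP; apply.
  rewrite (bigD1 i0) //= [X in (_ < X)%N](bigD1 i0) //= -addSn leq_add //.
    rewrite full ltn_neqAle rank_leq_row andbT.
    by move: nu0; rewrite -row_free_unit.
  by apply: leq_sum => i _; rewrite full rank_leq_row.
have ff i : f i *m f i = 0.
  apply: contrapT => nff.
  have eqr : forall j, \rank (f j *m f j) = \rank (f j).
    have le2 j : (\rank (f j *m f j) <= \rank (f j))%N by apply: mxrankM_maxl.
    have tot : (total_rank f <= \sum_j \rank (f j *m f j))%N.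
      by rewrite fr; apply: (minf (fun i => f i *m f i)); [apply: is_hom_comp|exists i].
    move=> j; apply/eqP; rewrite eqn_leq le2 /= leqNgt; apply/negP => lt.
    move: tot; rewrite leqNgt => /negP; apply.
    rewrite /total_rank (bigD1 j) //= [X in (_ < X)%N](bigD1 j) //=.
    by rewrite -addSn leq_add // leq_sum.
  by case: nuf => j /negP; apply; apply: fitting hf indM nf eqr j.
have [K [u [hu ru dK kerf]]] := rep_kernel hf.
have gE i : exists g, f i = g *m u i.
  by apply/submxP/kerf/ff.
have [g {}gE] := dep_choice gE.
have hg : @is_hom k Q M K g.
  apply: (hom_lift ru hu) => a; rewrite -!gE; exact: hf.
have ng : exists i, g i <> 0.
  by have [i ni] := nf; exists i => g0; apply: ni; rewrite gE g0 mul0mx.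
have [L [s [p [indL hs hp sp [i1 ngp]]]]] := indec_summand ng.
pose h i := g i *m p i.
have hh : is_hom h by apply: is_hom_comp.
have rs i : row_free (s i) by apply/row_freeP; exists (p i).
(* By minimality of the rank, h kills nothing but the kernel of f. *)
have rk_h i : \rank (h i) = \rank (f i).
  have le1 j : (\rank (h j) <= \rank (f j))%N.
    by rewrite gE mxrankMfree // mxrankM_maxl.
  have tot : (total_rank f <= \sum_j \rank (h j))%N.
    rewrite fr (eq_bigr (fun j => \rank (h j *m s j *m u j))) => [|j _]; last first.
      by rewrite (mxrankMfree _ (ru j)) (mxrankMfree _ (rs j)).
    apply: (minf (fun j => h j *m s j *m u j)).
      by apply: is_hom_comp hu; apply: is_hom_comp hs.
    exists i1 => h0; apply: ngp; rewrite -/(h i1).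
    apply: (row_free_inj (rs i1)); apply: (row_free_inj (ru i1)).
    by rewrite /= h0 !mul0mx.
  apply/eqP; rewrite eqn_leq le1 /= leqNgt; apply/negP => lt.
  move: tot; rewrite leqNgt => /negP; apply.
  rewrite /total_rank (bigD1 i) //= [X in (_ < X)%N](bigD1 i) //=.
  by rewrite -addSn leq_add // leq_sum.
have uh i : u i *m h i = 0.
  have uf : u i *m f i = 0 by apply/kerf.
  by rewrite mulmxA (_ : u i *m g i = 0) ?mul0mx //; apply: (row_free_inj (ru i));
    rewrite /= mul0mx -mulmxA -gE.
have kerh i m (A : 'M_(rdim M i, m)) : u i *m A = 0 -> exists B, A = h i *m B.
  move=> uA; have /submxP [B e] : (A^T <= (h i)^T)%MS.
    have sub : ((h i)^T <= (kermx (u i)^T))%MS.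
      by apply/sub_kermxP; rewrite -trmx_mul uh trmx0.
    apply: (@submx_trans _ _ _ _ _ _ (kermx (u i)^T)).
      by apply/sub_kermxP; rewrite -trmx_mul uA trmx0.
    rewrite -(geq_leqif (mxrank_leqif_sup sub)) mxrank_ker !mxrank_tr rk_h.
    by rewrite (eqP (ru i)) dK subKn // rank_leq_row.
  by exists B^T; rewrite -[LHS]trmxK e trmx_mul trmxK.
have tL : (total_dim L < n)%N.
  have [i2 nf2] := nf.
  apply: leq_trans le; rewrite /total_dim.
  have leLK j : (rdim L j <= rdim K j)%N.
    by rewrite -(eqP (rs j)) rank_leq_col.
  have leKM j : (rdim K j <= rdim M j)%N by rewrite dK leq_subr.
  rewrite (bigD1 i2) //= [X in (_ < X)%N](bigD1 i2) //= -addSn leq_add //.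
    apply: leq_ltn_trans (leLK _) _; rewrite dK ltn_subrL lt0n mxrank_eq0.
    apply/andP; split; first exact/eqP.
    by apply: leq_trans (rank_leq_row (f i2)); rewrite lt0n mxrank_eq0; apply/eqP.
  by apply: leq_sum => j _; apply: leq_trans (leLK j) (leKM j).
have bL := IH L tL indL.
(* A linear retraction r0 extending p; its failure to be a homomorphism is *)
(* corrected by solving the intertwining equations of L.                   *)
pose r0 i := pinvmx (u i) *m p i.
have ur0 i : u i *m r0 i = p i by rewrite /r0 mulmxA mulmxVp // mul1mx.
have dE a : exists psi, rmap M a *m r0 (tgt a) - r0 (src a) *m rmap L a = h (src a) *m psi.
  apply: kerh; rewrite mulmxBr (mulmxA (u _)) -hu -mulmxA ur0 hp.
  by rewrite (mulmxA (u _)) ur0 subrr.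
have [psi {}dE] := dep_choice dE.
have [phi phiE] := brick_rigid wpos (proj1 indL) bL psi.
pose q i := r0 i - h i *m phi i.
have hr : @is_hom k Q M L q.
  have hE a : rmap M a *m (h (tgt a) *m phi (tgt a)) - h (src a) *m phi (src a) *m rmap L a
      = h (src a) *m psi a.
    by rewrite mulmxA hh -!(mulmxA (h _)) -mulmxBr phiE.
  move=> a; apply/eqP; rewrite -subr_eq0 /q mulmxBr mulmxBl opprD opprK addrACA dE.
  by rewrite -[X in _ + X]opprK opprD opprK hE subrr.
have ur i : u i *m q i = p i by rewrite mulmxBr ur0 mulmxA uh mul0mx subr0.
pose e i := q i *m s i *m u i.
have he : is_hom e by apply: is_hom_comp hu; apply: is_hom_comp hs.
have ee i : e i *m e i = e i.
  by rewrite /e -!mulmxA (mulmxA (u i)) ur (mulmxA (s i)) sp mul1mx.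
case: (proj2 indM e he ee) => e01.
  have [j nj] := proj1 indL; apply: nj.
  have : s j *m u j *m e j *m q j = 1%:M.
    by rewrite /e !mulmxA -!(mulmxA _ (u j)) !ur -!mulmxA !(mulmxA (s j)) sp !mul1mx.
  rewrite e01 mulmx0 mul0mx => /esym /(congr1 mxrank).
  by rewrite mxrank1 mxrank0.
have [i nfi] := nf; apply: nfi.
have : u i *m f i = 0 by apply/kerf.
move/(congr1 (mulmx (q i *m s i))); rewrite mulmx0 mulmxA -/(e i) e01 mul1mx //.
Qed.

End Ringel.

(** * Indecomposables are determined by their dimension vectors *)

Section Interpolation.
Variables (k : closedFieldType) (Q : quiver).
Hypothesis wpos : weakly_positive Q.
Variable d : vert Q -> nat.
Local Notation maps := (forall a : arr Q, 'M[k]_(d (src a), d (tgt a))).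
Local Notation RepD F := (@Rep k Q d F).

Lemma horner_twist_sys (F D : maps) t j v :
  (twist_sys (fun a => map_mx polyC (F a))
     (fun a => map_mx polyC (F a) + 'X *: map_mx polyC (D a)) j v).[t] =
  twist_sys F (fun a => F a + t *: D a) j v.
Proof.
rewrite /twist_sys /map_coef /twist -[LHS]/(horner_eval t _).
set a := tag v.
have e1 i : map_mx (horner_eval t) (end_of (fun j' => (j' == j)%:R) i)
    = end_of (fun j' => (j' == j)%:R) i :> 'M[k]_(d i, d i).
  apply/matrixP => p q; rewrite !mxE rmorph_nat; by [].
have e2 m n (A : 'M[k]_(m, n)) : map_mx (horner_eval t) (map_mx polyC A) = A.
  by apply/matrixP => p q; rewrite !mxE /horner_eval hornerC.
have -> (m n : nat) (A : 'M[{poly k}]_(m, n)) p q :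
    horner_eval t (A p q) = map_mx (horner_eval t) A p q by rewrite mxE.
have eX : horner_eval t 'X = t by rewrite /horner_eval hornerX.
rewrite map_mxB !map_mxM !e1 map_mxD map_mxZ !e2.
by move: eX; rewrite /= => ->.
Qed.

(** The bricks isomorphic to a given one form a dense subset of every line
   through it. The homomorphisms from [Rep F] to the point with parameter [t]
   solve a linear system depending on [t], with one more unknown than equations;
   a polynomial solution that starts at the identity stays invertible for all
   but finitely many [t]. *)
Lemma brick_line (F D : maps) : rep_nonzero (RepD F) -> brick (RepD F) ->
  exists2 delta : {poly k}, delta != 0 &
    forall t, delta.[t] != 0 -> rep_iso (RepD F) (RepD (fun a => F a + t *: D a)).
Proof.
move=> nX bX.
pose P := twist_sys (fun a => map_mx polyC (F a))
  (fun a => map_mx polyC (F a) + 'X *: map_mx polyC (D a)).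
have P0 j v : (P j v).[0] = twist_sys F F j v.
  rewrite horner_twist_sys; congr twist_sys.
  by apply: functional_extensionality_dep => a; rewrite scale0r addr0.
pose v0 := end_coef (fun i => 1%:M : 'M[k]_(d i)).
have [|v|u us|w [c [c0 wc wP]]] :=
    @poly_sys_sol k _ _ P 0 v0 (brick_card wpos nX bX).
- exact: (@one_coef_neq0 k Q (RepD F)).
- under eq_bigr do rewrite P0.
  move: v; apply/twist_eq0P => a.
  by rewrite /v0 !end_coefK mulmx1 mul1mx.
- apply: (@brick_sys k Q (RepD F) bX) => v.
  by rewrite -[RHS](us v); apply: eq_bigr => j _; rewrite P0.
have dE t : (\prod_i \det (end_of w i)).[t] = \prod_i \det (end_of (fun j => (w j).[t]) i).
  rewrite horner_prod; apply: eq_bigr => i _.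
  rewrite -[LHS]/(horner_eval t _) -det_map_mx; congr (\det _).
  by apply/matrixP => p q; rewrite !mxE.
exists (\prod_i \det (end_of w i)) => [|t].
  apply/eqP => e; have := dE 0; rewrite e horner0 => /esym/eqP.
  apply/negP/prodf_neq0 => i _.
  have -> : end_of (fun j => (w j).[0]) i = c%:M.
    apply/matrixP => p q; rewrite mxE wc /v0 /end_coef /= !mxE.
    by case: eqP => _; rewrite ?mulr1 ?mulr0.
  by rewrite det_scalar expf_neq0.
rewrite dE => /prodf_neq0 nz.
pose f i := end_of (fun j => (w j).[t]) i.
have fu i : f i \in unitmx by rewrite unitmxE unitfE nz.
exists f, (fun i => invmx (f i)); split=> [a|i|i].
- rewrite /=; move: a; apply/twist_eq0P => v.
  by rewrite -[RHS](wP t v); apply: eq_bigr => j _; rewrite horner_twist_sys.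
- by rewrite mulmxV.
- by rewrite mulVmx.
Qed.

(** Each of two bricks is isomorphic to almost all points of the line that joins
   them. *)
Lemma brick_iso (F G : maps) : rep_nonzero (RepD F) ->
  brick (RepD F) -> brick (RepD G) -> rep_iso (RepD F) (RepD G).
Proof.
move=> nX bF bG.
have [p p0 pP] := brick_line (fun a => G a - F a) nX bF.
have [q q0 qP] := @brick_line G (fun a => F a - G a) nX bG.
have /closed_nonrootP [t] : p * (q \Po (1 - 'X)) != 0.
  rewrite mulf_neq0 // comp_poly_eq0 // -opprB size_polyN -polyC1 size_XsubC //.
rewrite rootE hornerM mulf_eq0 negb_or horner_comp !hornerE => /andP [pt qt].
apply: rep_iso_trans (pP _ pt) _; apply: rep_iso_sym.
suff -> : (fun a => F a + t *: (G a - F a)) = (fun a => G a + (1 - t) *: (F a - G a)).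
  exact: qP.
apply: functional_extensionality_dep => a.
by rewrite scalerBl scale1r [RHS]addrA (addrC (G a)) subrK -scalerN opprB.
Qed.

End Interpolation.

Lemma indec_dim_iso (k : closedFieldType) (Q : quiver) (X Y : rep k Q) :
  weakly_positive Q -> rep_indec X -> rep_indec Y ->
  (forall i, rdim X i = rdim Y i) -> rep_iso X Y.
Proof.
move=> wpos iX iY /funext e.
case: X Y iX iY e => [dX F] [dY G] iX iY /= e; subst dY.
by apply: (brick_iso wpos) => //; [case: iX|apply: indec_brick..].
Qed.

(** * Finitely many dimension vectors *)

Section Roots.
Variable Q : quiver.
Hypothesis wpos : weakly_positive Q.

Implicit Types x y : vert Q -> int.

Definition tits x : int := \sum_i x i * x i - \sum_a x (src a) * x (tgt a).
Definition polar x y : int :=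
  \sum_i (x i * y i + y i * x i) - \sum_a (x (src a) * y (tgt a) + y (src a) * x (tgt a)).

Lemma tits_gt0 x : (exists i, x i <> 0) -> 0 < tits x.
Proof.
move=> [i0 n0]; rewrite subr_gt0.
have /wpos lt : exists i, absz (x i) <> 0%N.
  by exists i0 => /eqP; rewrite absz_eq0 => /eqP.
have -> : \sum_i x i * x i = (\sum_i absz (x i) * absz (x i))%N%:R.
  rewrite natr_sum; apply: eq_bigr => i _.
  by rewrite natz PoszM !abszE -normrM ger0_norm // -expr2 sqr_ge0.
have le : \sum_a x (src a) * x (tgt a) <=
    (\sum_a absz (x (src a)) * absz (x (tgt a)))%N%:R.
  rewrite natr_sum; apply: ler_sum => a _.
  by rewrite natz PoszM !abszE -normrM ler_norm.
by apply: (le_lt_trans le); rewrite ltr_nat.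
Qed.

Lemma titsD x y : tits (fun i => x i + y i) = tits x + tits y + polar x y.
Proof.
have reord (a b c e f g : int) : a - b + (c - e) + (f - g) = a + c + f - (b + e + g).
  by ring.
rewrite /tits /polar reord -!big_split /=.
by congr (_ - _); apply: eq_bigr => i _; ring.
Qed.

Lemma polarBl x x' y : polar (fun i => x i - x' i) y = polar x y - polar x' y.
Proof.
have reord (a b c e : int) : a - b - (c - e) = a - c - (b - e) by ring.
rewrite /polar reord -!sumrB.
by congr (_ - _); apply: eq_bigr => i _; ring.
Qed.

Lemma polar_diag x : polar x x = tits x *+ 2.
Proof.
rewrite /polar /tits mulrnBl -!sumrMnl.
by congr (_ - _); apply: eq_bigr => i _; ring.
Qed.

Definition unit_vec (i j : vert Q) : int := (j == i)%:R.

Lemma polar_comb x y : polar x y = \sum_i y i * polar x (unit_vec i).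
Proof.
have yE j : y j = \sum_i y i * unit_vec i j.
  by rewrite (bigD1 j) //= /unit_vec eqxx mulr1 big1 ?addr0 // => i;
    rewrite eq_sym => /negPf ->; rewrite mulr0.
under [RHS]eq_bigr do rewrite /polar mulrBr !mulr_sumr.
rewrite sumrB; congr (_ - _); rewrite exchange_big; apply: eq_bigr => j _ /=.
  by rewrite {1 2}(yE j) mulr_sumr mulr_suml -big_split; apply: eq_bigr => i _ /=; ring.
rewrite {1}(yE (src j)) {1}(yE (tgt j)) mulr_sumr mulr_suml -big_split.
by apply: eq_bigr => i _ /=; ring.
Qed.

(** The difference of two vectors with the same gradient would be isotropic. *)
Lemma gradient_inj x x' :
  (forall i, polar x (unit_vec i) = polar x' (unit_vec i)) -> forall i, x i = x' i.
Proof.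
move=> e i; apply/eqP; rewrite -subr_eq0; apply/eqP; apply: contrapT => n0.
have := @tits_gt0 (fun i => x i - x' i) (ex_intro _ i n0).
have : tits (fun i => x i - x' i) *+ 2 = 0.
  rewrite -polar_diag polar_comb big1 // => j _.
  by rewrite polarBl e subrr mulr0.
by move/eqP; rewrite mulrn_eq0 /= => /eqP ->.
Qed.

Lemma tits_ge0 x : 0 <= tits x.
Proof.
have [/tits_gt0/ltW //|h] := pselect (exists i, x i <> 0).
have x0 i : x i = 0 by apply: contrapT => n; apply: h; exists i.
by rewrite /tits !big1 // => i _; rewrite x0 mul0r.
Qed.

Lemma tits_unit i : tits (unit_vec i) <= 1.
Proof.
rewrite /tits (bigD1 i) //= {1 2}/unit_vec eqxx mulr1 big1 ?addr0.
  by rewrite lerBlDr lerDl sumr_ge0 // => a _; rewrite mulr_ge0 // /unit_vec ler0n.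
by move=> j /negPf nj; rewrite /unit_vec nj mul0r.
Qed.

(** A root differs from a unit vector by a vector with nonnegative value. *)
Lemma gradient_bound x i : tits x = 1 -> -2 <= polar x (unit_vec i) <= 2.
Proof.
move=> x1; have u1 := tits_unit i.
have p1 := tits_ge0 (fun j => x j + unit_vec i j).
have p2 := tits_ge0 (fun j => x j + - unit_vec i j).
have e : polar x (fun j => - unit_vec i j) = - polar x (unit_vec i).
  rewrite polar_comb [in RHS]polar_comb -sumrN.
  by apply: eq_bigr => j _; rewrite mulNr.
have e' : tits (fun j => - unit_vec i j) = tits (unit_vec i).
  by rewrite /tits; congr (_ - _); apply: eq_bigr => j _; rewrite mulrNN.
move: p1 p2; rewrite !titsD x1 e e'; lia.
Qed.

End Roots.

(** Roots are classified by their gradients, which have small entries. *)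
Definition root_idx (Q : quiver) := {ffun vert Q -> 'I_5}.

Lemma dim_class (Q : quiver) : weakly_positive Q ->
  exists c : (vert Q -> nat) -> root_idx Q, forall d d',
    ((\sum_i d i * d i)%N = (\sum_a d (src a) * d (tgt a)).+1)%N ->
    ((\sum_i d' i * d' i)%N = (\sum_a d' (src a) * d' (tgt a)).+1)%N ->
    c d = c d' -> forall i, d i = d' i.
Proof.
move=> wpos; pose z (d : vert Q -> nat) i : int := (d i)%:Z.
pose c d : root_idx Q := [ffun i => inord (absz (polar (z d) (unit_vec i) + 2))].
have z1 d : ((\sum_i d i * d i)%N = (\sum_a d (src a) * d (tgt a)).+1)%N -> tits (z d) = 1.
  move=> e; rewrite /tits.
  have -> : \sum_i z d i * z d i = (\sum_i d i * d i)%N%:R.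
    by rewrite natr_sum; apply: eq_bigr => i _; rewrite natz PoszM.
  have -> : \sum_a z d (src a) * z d (tgt a) = (\sum_a d (src a) * d (tgt a))%N%:R.
    by rewrite natr_sum; apply: eq_bigr => i _; rewrite natz PoszM.
  by rewrite e -natrB ?leqnSn // subSnn.
exists c => d d' /z1 ed /z1 ed' /ffunP cc i.
have /(_ i) : forall i, z d i = z d' i.
  apply: (gradient_inj wpos) => j; have := cc j; rewrite !ffunE => /(congr1 val).
  have := gradient_bound wpos j ed; have := gradient_bound wpos j ed'.
  move=> b b'; rewrite /= !inordK; lia.
by rewrite /z => -[].
Qed.

(** * The module of a representation *)

Lemma mul_linl (k : fieldType) (A : algType k) (c : k) (x y z : A) :
  (c *: x + y) * z = c *: (x * z) + y * z.
Proof. by rewrite mulrDl scalerAl. Qed.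

Lemma mul_linr (k : fieldType) (A : algType k) (c : k) (x y z : A) :
  z * (c *: x + y) = c *: (z * x) + z * y.
Proof. by rewrite mulrDr scalerAr. Qed.

Lemma mul_orth (R : nzRingType) (x e e' y : R) :
  x * e = x -> e' * y = y -> e * e' = 0 -> x * y = 0.
Proof. by move=> <- <- ee; rewrite -mulrA (mulrA e) ee mul0r mulr0. Qed.

Section VertexElements.
Variables (k : fieldType) (Q : quiver).

Definition vert_elt (i : vert Q) : path_alg k Q := path_elt k (path_id i).

Definition arr_path (a : arr Q) : qpath Q :=
  exist _ (src a, [:: a]) (introT andP (conj (eqxx _) isT)).

Definition arr_elt (a : arr Q) : path_alg k Q := path_elt k (arr_path a).

Lemma path_eltM (p q : qpath Q) : path_elt k p * path_elt k q =
  if path_end p == path_start q then path_elt k (path_cat p q) else 0.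
Proof. exact: cbasisM. Qed.

Lemma path_elt_cons v a s (h : is_walk v (a :: s)) (h' : is_walk (tgt a) s) :
  path_elt k (exist _ (v, a :: s) h) = arr_elt a * path_elt k (exist _ (tgt a, s) h').
Proof.
rewrite /arr_elt path_eltM /path_end /path_start /= eqxx; congr path_elt.
apply: val_inj; rewrite val_path_cat //=.
by case/andP: h => /eqP ->.
Qed.

Lemma sum_vert_elt : \sum_i vert_elt i = 1.
Proof. by []. Qed.

Lemma vert_eltM i j : vert_elt i * vert_elt j = if i == j then vert_elt i else 0.
Proof.
rewrite /vert_elt path_eltM -[path_end _ == _]/(i == j); case: (i =P j) => [->|//].
by congr path_elt; apply: val_inj; rewrite val_path_cat.
Qed.

Lemma vert_arrM a : vert_elt (src a) * arr_elt a = arr_elt a.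
Proof.
rewrite /vert_elt /arr_elt path_eltM /path_end /path_start /= eqxx.
by congr path_elt; apply: val_inj; rewrite val_path_cat.
Qed.

Lemma arr_vertM a : arr_elt a * vert_elt (tgt a) = arr_elt a.
Proof.
rewrite /vert_elt /arr_elt path_eltM /path_end /path_start /= eqxx.
by congr path_elt; apply: val_inj; rewrite val_path_cat.
Qed.

Lemma path_lin_ind (P : path_alg k Q -> Prop) : P 0 ->
  (forall c p x, P x -> P (c *: path_elt k p + x)) -> forall x, P x.
Proof. by move=> h0 h1 x; apply: (@cbasis_ind k (path_category Q) P h0 h1 x). Qed.

Lemma path_alg_ind (P : path_alg k Q -> Prop) :
  P 0 -> (forall x y, P x -> P y -> P (x + y)) -> (forall c x, P x -> P (c *: x)) ->
  (forall x y, P x -> P y -> P (x * y)) ->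
  (forall i, P (vert_elt i)) -> (forall a, P (arr_elt a)) -> forall x, P x.
Proof.
move=> P0 PD PZ PM Pv Pa x; elim/path_lin_ind: x => // c p x Px.
apply: PD => //; apply: PZ; case: p => -[v s] h {x Px}.
elim: s v h => [|a s IH] v h.
  have -> : exist _ (v, [::]) h = path_id v :> qpath Q by apply: val_inj.
  exact: Pv.
have /andP [_ h'] : (src a == v) && is_walk (tgt a) s := h.
by move: (PM _ _ (Pa a) (IH _ h')); rewrite -(path_elt_cons h h').
Qed.

End VertexElements.

Lemma vert_orth (k : fieldType) (Q : quiver) (i j : vert Q) : i <> j -> vert_elt k i * vert_elt k j = 0.
Proof. by move=> ij; rewrite vert_eltM; case: eqP. Qed.

Lemma vert_idem (k : fieldType) (Q : quiver) (i : vert Q) : vert_elt k i * vert_elt k i = vert_elt k i.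
Proof. by rewrite vert_eltM eqxx. Qed.

Lemma arr_arr0 (k : fieldType) (Q : quiver) (a b : arr Q) : tgt a <> src b -> arr_elt k a * arr_elt k b = 0.
Proof.
move=> ab; apply: (mul_orth (arr_vertM k a) (vert_arrM k b)); exact: vert_orth.
Qed.


Section RepModule.
Variables (k : fieldType) (Q : quiver) (X : rep k Q).
Local Notation R := (path_alg k Q).

(** Paths are composed from left to right and act on the left, so an arrow maps the
   space at its target to the space at its source; with matrices acting on rows in
   representations, the elements of the module are columns. *)
Definition rspace := forall i, 'cV[k]_(rdim X i).
HB.instance Definition _ := Choice.on rspace.

Lemma rspaceP (m n : rspace) : (forall i, m i = n i) -> m = n.
Proof. exact: functional_extensionality_dep. Qed.

Definition radd (m n : rspace) : rspace := fun i => m i + n i.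
Fact raddA : associative radd.
Proof. by move=> m n p; apply: rspaceP => i; apply: addrA. Qed.
Fact raddC : commutative radd.
Proof. by move=> m n; apply: rspaceP => i; apply: addrC. Qed.
Fact radd0 : left_id (fun=> 0) radd.
Proof. by move=> m; apply: rspaceP => i; apply: add0r. Qed.
Fact raddN : left_inverse (fun=> 0) (fun m i => - m i) radd.
Proof. by move=> m; apply: rspaceP => i; apply: addNr. Qed.
HB.instance Definition _ := GRing.isZmodule.Build rspace raddA raddC radd0 raddN.

Definition rscale (c : k) (m : rspace) : rspace := fun i => c *: m i.
Fact rscaleA a b m : rscale a (rscale b m) = rscale (a * b) m.
Proof. by apply: rspaceP => i; apply: scalerA. Qed.
Fact rscale1 : left_id 1 rscale.
Proof. by move=> m; apply: rspaceP => i; apply: scale1r. Qed.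
Fact rscaleDr : right_distributive rscale +%R.
Proof. by move=> c m n; apply: rspaceP => i; apply: scalerDr. Qed.
Fact rscaleDl m : {morph rscale^~ m : a b / a + b}.
Proof. by move=> a b; apply: rspaceP => i; apply: scalerDl. Qed.
HB.instance Definition _ := GRing.Zmodule_isLmodule.Build k rspace
  rscaleA rscale1 rscaleDr rscaleDl.

Lemma raddE (m n : rspace) i : (m + n) i = m i + n i. Proof. by []. Qed.
Lemma rscaleE c (m : rspace) i : (c *: m) i = c *: m i. Proof. by []. Qed.
Lemma rsumE (T : Type) (r : seq T) (P : pred T) (F : T -> rspace) i :
  (\sum_(t <- r | P t) F t) i = \sum_(t <- r | P t) F t i.
Proof. by elim/big_rec2: _ => // t y1 y2 _ <-. Qed.

Definition put i (c : 'cV[k]_(rdim X i)) : rspace := dfwith (fun=> 0) c.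
Lemma put_in i c : @put i c i = c. Proof. exact: dfwith_in. Qed.
Lemma put_out i c j : i != j -> @put i c j = 0. Proof. exact: dfwith_out. Qed.
Lemma put_is_linear i : linear (@put i).
Proof.
move=> c u v; apply: rspaceP => j; rewrite raddE rscaleE.
by case: (eqVneq i j) => [e|ne]; [subst j; rewrite !put_in|rewrite !put_out // scaler0 addr0].
Qed.
HB.instance Definition _ i := GRing.isLinear.Build k _ _ _ (@put i) (@put_is_linear i).

Lemma put_scale i c u : @put i (c *: u) = rscale c (put u).
Proof. exact: (linearZ_LR (@put i)). Qed.

Lemma put_sum (m : rspace) : m = \sum_i put (m i).
Proof.
apply: rspaceP => j; rewrite rsumE (bigD1 j) //= put_in big1 ?addr0 // => i.
exact: put_out.
Qed.

Definition act_arr (a : arr Q) (m : rspace) : rspace :=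
  put (rmap X a *m m (tgt a)).
Definition act_seq (s : seq (arr Q)) (m : rspace) : rspace := foldr act_arr m s.
Definition act_path (p : qpath Q) (m : rspace) : rspace :=
  put (act_seq (val p).2 m (path_start p)).

Lemma act_seq_linear s : linear (act_seq s).
Proof.
elim: s => [|a s IH] // c m n; rewrite /= IH /act_arr.
by rewrite raddE rscaleE mulmxDr -scalemxAr linearP.
Qed.

Lemma act_path_linear p : linear (act_path p).
Proof. by move=> c m n; rewrite /act_path act_seq_linear raddE rscaleE linearP. Qed.

Lemma act_seq_end s v (m n : rspace) : is_walk v s ->
  m (walk_end v s) = n (walk_end v s) -> act_seq s m v = act_seq s n v.
Proof.
elim: s v => [|a s IH] v //= /andP [/eqP av hs] e; subst v.
rewrite /act_arr !put_in; congr (_ *m _); exact: IH.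
Qed.

Lemma act_path_cat p q m : path_end p = path_start q ->
  act_path (path_cat p q) m = act_path p (act_path q m).
Proof.
move=> pq; rewrite {1}/act_path path_start_cat // val_path_cat //=; congr put.
rewrite /act_seq foldr_cat; apply: act_seq_end; first exact: valP p.
by rewrite -[walk_end _ _]/(path_end p) pq /act_path put_in.
Qed.

Lemma act_path_neq p q m : path_end p != path_start q ->
  act_path p (act_path q m) = 0.
Proof.
move=> pq; rewrite -(_ : act_path p 0 = 0); last first.
  by have := act_path_linear p (-1) 0 0; rewrite scaler0 addr0 scaleN1r addNr.
congr put; apply: act_seq_end; first exact: valP p.
rewrite -[walk_end _ _]/(path_end p) /act_path put_out //.
by rewrite eq_sym.
Qed.

Definition act (x : R) (m : rspace) : rspace :=
  lin_ext (fun p : qpath Q => act_path p m) (x : {malg k[qpath Q]}).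

Lemma act_linear_l m c x y : act (c *: x + y) m = c *: act x m + act y m.
Proof. exact: linearP. Qed.

Lemma act_linear_r x c m n : act x (c *: m + n) = c *: act x m + act x n.
Proof. by apply: lin_ext_hD => p; apply: act_path_linear. Qed.

Lemma act0l m : act 0 m = 0.
Proof. exact: raddf0. Qed.
Lemma act0r x : act x 0 = 0.
Proof. by have := act_linear_r x (-1) 0 0; rewrite scaler0 addr0 scaleN1r addNr. Qed.

Lemma act_pathE p m : act (path_elt k p) m = act_path p m.
Proof. exact: lin_extU. Qed.

Fact actA x y m : act x (act y m) = act (x * y) m.
Proof.
elim/path_lin_ind: x => [|c p x IH]; first by rewrite mul0r !act0l.
rewrite (mul_linl c) !act_linear_l IH; congr (_ *: _ + _) => {x IH}.
elim/path_lin_ind: y => [|e q y IH]; first by rewrite mulr0 !act0l act0r.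
rewrite (mul_linr e) (act_linear_l m e (path_elt k q) y).
rewrite (act_linear_l m e (path_elt k p * path_elt k q) (path_elt k p * y)).
rewrite (act_linear_r (path_elt k p) e (act (path_elt k q) m) (act y m)).
apply: (congr2 +%R); last exact: IH.
congr (_ *: _) => {y IH}.
rewrite !act_pathE path_eltM.
case: eqP => [pq|/eqP pq]; first by rewrite act_pathE act_path_cat.
by rewrite act0l act_path_neq.
Qed.

Fact act1 m : act 1 m = m.
Proof.
rewrite -[1]/(\sum_(i : vert Q) path_elt k (path_id i)) [RHS]put_sum.
rewrite (big_morph (act^~ m) (id1 := 0) (op1 := +%R)) ?act0l //.
  by apply: eq_bigr => i _; rewrite act_pathE.
by move=> x y; rewrite -[x]scale1r act_linear_l !scale1r.
Qed.

Definition rmod := rspace.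
HB.instance Definition _ := GRing.Zmodule.on rmod.
Fact act_Dr : right_distributive (act : R -> rmod -> rmod) +%R.
Proof. by move=> x m n; rewrite -[m]scale1r act_linear_r !scale1r. Qed.
Fact act_Dl (m : rmod) : {morph (act : R -> rmod -> rmod)^~ m : x y / x + y}.
Proof. by move=> x y; rewrite -[x]scale1r act_linear_l !scale1r. Qed.
HB.instance Definition _ := GRing.Zmodule_isLmodule.Build R rmod
  actA act1 act_Dr act_Dl.

Lemma vert_act i (m : rmod) : vert_elt k i *: m = put (m i).
Proof. by rewrite -[LHS]/(act _ _) act_pathE. Qed.

Lemma arr_act a (m : rmod) : arr_elt k a *: m = put (rmap X a *m m (tgt a)).
Proof. by rewrite -[LHS]/(act _ _) act_pathE /act_path /= /act_arr put_in. Qed.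

Lemma scal_act c (m : rmod) : (c%:A : R) *: m = rscale c m.
Proof.
rewrite -[LHS]/(act (c *: 1) m) -[c *: 1]addr0 act_linear_l act0l addr0.
by rewrite act1.
Qed.

End RepModule.

(** * Modules and their endomorphisms *)

Section ModuleGeneralities.
Variable R : nzRingType.
Implicit Types M N P : lmodType R.

Lemma linear_pack M N (f : M -> N) : linear f ->
  exists g : {linear M -> N}, forall x, g x = f x.
Proof.
move=> fl; pose g : {linear M -> N} := HB.pack f (GRing.isLinear.Build R M N *:%R f fl).
by exists g.
Qed.

Lemma linear_of_additive M N (f : M -> N) :
  (forall x y, f (x + y) = f x + f y) -> (forall a x, f (a *: x) = a *: f x) -> linear f.
Proof. by move=> fD fZ a x y; rewrite fD fZ. Qed.

Lemma mod_iso_sym M N : mod_iso M N -> mod_iso N M.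
Proof.
move=> [f [g fK gK]].
have gl : linear g.
  by move=> a x y; apply: (can_inj fK); rewrite linearP !gK.
have [g' g'E] := linear_pack gl.
by exists g'; exists f => x; rewrite g'E.
Qed.

Lemma mod_iso_trans M N P : mod_iso M N -> mod_iso N P -> mod_iso M P.
Proof.
by move=> [f fb] [g gb]; exists (g \o f); apply: bij_comp.
Qed.

Lemma fin_generated_fin M (T : finType) (g : T -> M) :
  (forall x, exists c : T -> R, x = \sum_t c t *: g t) -> fin_generated M.
Proof.
move=> h; exists #|T|, (fun i => g (enum_val i)) => x; have [c ->] := h x.
exists (fun i => c (enum_val i)).
rewrite (reindex_onto (@enum_val T T) enum_rank) /=; last first.
  by move=> j _; rewrite enum_rankK.
by apply: eq_bigl => i; rewrite enum_valK eqxx.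
Qed.

(** A decomposition into two submodules is the same as an idempotent
   endomorphism. *)
Lemma mod_indecP M : mod_indecomposable M <->
  (exists x : M, x <> 0) /\
  forall e : {linear M -> M}, (forall x, e (e x) = e x) ->
    (forall x, e x = 0) \/ (forall x, e x = x).
Proof.
split=> [[nz ind]|[nz ind]]; (split; first exact: nz).
  move=> e ee; pose U : {pred M} := fun x => e x == x; pose V : {pred M} := fun x => e x == 0.
  have [|||x Ux Vx|h|h] := ind U V.
  - split; first by rewrite unfold_in raddf0.
    by move=> a x y; rewrite !unfold_in linearP => /eqP -> /eqP ->.
  - split; first by rewrite unfold_in raddf0.
    by move=> a x y; rewrite !unfold_in linearP => /eqP -> /eqP ->; rewrite scaler0 addr0.
  - move=> x; exists (e x), (x - e x); split; last by rewrite addrC subrK.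
      by rewrite unfold_in ee.
    by rewrite unfold_in raddfB /= ee subrr.
  - by move: Ux Vx; rewrite !unfold_in => /eqP ex /eqP e0; rewrite -ex e0.
  - by left=> x; apply: h; rewrite unfold_in ee.
  - right=> x; apply/esym/eqP; rewrite -subr_eq0; apply/eqP/h.
    by rewrite unfold_in raddfB /= ee subrr.
move=> U V Us Vs UV UV0; have /choice [u uP] : forall x, exists u, u \in U /\ x - u \in V.
  move=> x; have [u [v [Uu Vv ->]]] := UV x.
  by exists u; split=> //; rewrite addrC addKr.
have uniq x y : y \in U -> x - y \in V -> u x = y.
  move=> Uy Vy; have [Uu Vu] := uP x; apply/eqP; rewrite -subr_eq0; apply/eqP/UV0.
    by rewrite -[u x]scale1r addrC -scaleN1r; apply: (proj2 Us (-1)); rewrite ?scale1r.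
  have -> : u x - y = -1 *: (x - u x) + (x - y).
    by rewrite scaleN1r opprB addrA subrK.
  exact: (proj2 Vs).
have ul : linear u.
  move=> a x y; have [Ux Vx] := uP x; have [Uy Vy] := uP y.
  apply: uniq; first exact: (proj2 Us).
  have -> : a *: x + y - (a *: u x + u y) = a *: (x - u x) + (y - u y).
    by rewrite scalerBr opprD addrACA.
  exact: (proj2 Vs).
have [e eE] := linear_pack ul.
have fixU x : x \in U -> u x = x.
  by move=> Ux; apply: uniq => //; rewrite subrr; apply: (proj1 Vs).
have [x|h|h] := ind e.
- by rewrite !eE; apply: fixU; case: (uP x).
- by left=> x Ux; rewrite -(fixU x Ux) -eE.
- by right=> x Vx; rewrite -[x]h eE; apply: uniq; [apply: (proj1 Us)|rewrite subr0].
Qed.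

Lemma mod_iso_indec M N : mod_iso M N -> mod_indecomposable M -> mod_indecomposable N.
Proof.
move=> /mod_iso_sym [g gb]; have [f fK gK] := gb.
have [f' f'K f'K'] : exists2 f' : {linear M -> N}, cancel g f' & cancel f' g.
  have fl : linear f by move=> a x y; apply: (can_inj fK); rewrite linearP !gK.
  by have [f' f'E] := linear_pack fl; exists f' => x; rewrite f'E.
move=> /mod_indecP [[x nx] ind]; apply/mod_indecP; split.
  by exists (f' x) => e; apply: nx; rewrite -[x]f'K' e raddf0.
move=> e ee; have [y|h|h] := ind (g \o e \o f').
- by rewrite /= f'K ee.
- by left=> y; apply: (can_inj f'K); rewrite raddf0 -[y]f'K; apply: h.
- by right=> y; apply: (can_inj f'K); rewrite -{1}[y]f'K; apply: h.
Qed.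

End ModuleGeneralities.

Section Functor.
Variables (k : fieldType) (Q : quiver).
Local Notation R := (path_alg k Q).
Implicit Types X Y : rep k Q.

Lemma mulmx_col_inj m n (A B : 'M[k]_(m, n)) :
  (forall c : 'cV_n, A *m c = B *m c) -> A = B.
Proof.
move=> h; apply/matrixP => i j.
by have /matrixP /(_ i 0) := h (delta_mx j 0); rewrite -!colE !mxE.
Qed.

(** Linearity over the path algebra can be tested on scalars, vertices and
   arrows. *)
Lemma path_linear (M N : lmodType R) (f : M -> N) :
  (forall x y, f (x + y) = f x + f y) ->
  (forall c x, f ((c%:A : R) *: x) = (c%:A : R) *: f x) ->
  (forall i x, f (vert_elt k i *: x) = vert_elt k i *: f x) ->
  (forall a x, f (arr_elt k a *: x) = arr_elt k a *: f x) -> linear f.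
Proof.
move=> fD fS fv fa; apply: linear_of_additive => // x.
have f0 : f 0 = 0 by apply: (addrI (f 0)); rewrite -fD !addr0.
elim/path_alg_ind: x => [m|x y hx hy m|c x hx m|x y hx hy m|//|//].
- by rewrite !scale0r.
- by rewrite scalerDl fD hx hy scalerDl.
- by rewrite -(mulr_algl c x) -scalerA fS hx scalerA.
- by rewrite -scalerA hx hy scalerA.
Qed.

Lemma rmod_linear X Y (phi : repfam Y X) : is_hom phi ->
  exists f : {linear rmod X -> rmod Y}, forall m i, f m i = phi i *m m i.
Proof.
move=> hphi; pose f (m : rmod X) : rmod Y := fun i => phi i *m m i.
have fput i c : f (put c) = @put _ _ Y i (phi i *m c).
  apply: rspaceP => j; rewrite /f.
  by case: (eqVneq i j) => [e|ne]; [subst j; rewrite !put_in|rewrite !put_out // mulmx0].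
have fl : linear f.
  apply: path_linear => [m n|c m|i m|a m].
  - by apply: rspaceP => i; rewrite /f mulmxDr.
  - by rewrite !scal_act; apply: rspaceP => i; rewrite /f /rscale scalemxAr.
  - by rewrite !vert_act fput.
  - by rewrite !arr_act fput mulmxA -hphi -mulmxA.
by have [g gE] := linear_pack fl; exists g => m i; rewrite gE.
Qed.

(** A linear map commutes with the idempotents at the vertices, hence is given by its
   components, and it commutes with the arrows. *)
Lemma linear_rmod X Y (f : {linear rmod X -> rmod Y}) :
  exists2 phi : repfam Y X, is_hom phi & forall m i, f m i = phi i *m m i.
Proof.
pose phi i : 'M[k]_(rdim Y i, rdim X i) :=
  \matrix_(p, q) f (put (delta_mx q 0)) i p 0.
have fput i (c : 'cV[k]_(rdim X i)) : f (put c) = put (phi i *m c).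
  have -> : f (put c) = vert_elt k i *: f (put c).
    by rewrite -linearZ vert_act put_in.
  rewrite vert_act; congr put; apply/matrixP => p z; rewrite ord1 mxE.
  have -> : put c = \sum_q ((c q 0)%:A : R) *: (put (delta_mx q 0) : rmod X).
    under eq_bigr do rewrite scal_act.
    rewrite [in LHS](matrix_sum_delta c) (raddf_sum (@put k Q X i)).
    apply: eq_bigr => q _; rewrite big_ord1.
    exact: put_scale.
  rewrite linear_sum rsumE summxE; apply: eq_bigr => q _.
  by rewrite linearZ /= scal_act /rscale !mxE mulrC.
have fE m i : f m i = phi i *m m i.
  by rewrite {1}(put_sum m) linear_sum rsumE (bigD1 i) //= fput put_in big1 ?addr0 // => j nj;
    rewrite fput put_out.
exists phi => // a; apply: mulmx_col_inj => c.
have := congr1 (fun m : rmod Y => m (src a)) (linearZ_LR f (arr_elt k a) (put c : rmod X)).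
by rewrite !arr_act put_in !fput put_in !put_in !mulmxA => ->.
Qed.

Lemma rep_iso_mod X Y : rep_iso X Y <-> mod_iso (rmod X) (rmod Y).
Proof.
split=> [/rep_iso_sym [phi [psi [hphi pq qp]]]|[f [g fK gK]]].
  have [f fE] := rmod_linear hphi.
  exists f; exists (fun m i => psi i *m m i) => m; apply: rspaceP => i.
    by rewrite fE mulmxA qp mul1mx.
  by rewrite fE mulmxA pq mul1mx.
have gl : linear g by move=> a x y; apply: (can_inj fK); rewrite linearP !gK.
have [g' g'E] := linear_pack gl.
have [phi hphi fE] := linear_rmod f; have [psi hpsi gE] := linear_rmod g'.
exists psi, phi; split=> // i; apply: mulmx_col_inj => c; rewrite mul1mx -mulmxA.
  by rewrite -{1}(put_in c) -fE -gE g'E fK put_in.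
by rewrite -{1}(put_in c) -gE -fE g'E gK put_in.
Qed.

Lemma rep_indec_mod X : rep_indec X <-> mod_indecomposable (rmod X).
Proof.
split=> [[[i n0] ind]|/mod_indecP [[m nm] ind]].
  apply/mod_indecP; split.
    exists (put (const_mx 1 : 'cV_(rdim X i))) => /(congr1 (fun m : rmod X => m i)).
    rewrite put_in => /matrixP e; case d0 : (rdim X i) => [|n] //.
    have p : 'I_(rdim X i) by rewrite d0; apply: ord0.
    by have /eqP := e p 0; rewrite !mxE oner_eq0.
  move=> e ee; have [phi hphi eE] := linear_rmod e.
  have [j|h|h] := ind phi hphi.
  - apply: mulmx_col_inj => c; have := ee (put c).
    move=> /(congr1 (fun m : rmod X => m j)).
    by rewrite !eE put_in mulmxA.
  - by left=> m; apply: rspaceP => j; rewrite eE h mul0mx.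
  - by right=> m; apply: rspaceP => j; rewrite eE h mul1mx.
split.
  apply: contrapT => h; apply: nm; apply: rspaceP => i; apply/matrixP => p.
  have d0 : rdim X i = 0%N by apply: contrapT => n; apply: h; exists i.
  by move=> ?; have := ltn_ord p; rewrite [X in (_ < X)%N]d0.
move=> phi hphi pp; have [e eE] := rmod_linear hphi.
have [m'|h|h] := ind e.
- by apply: rspaceP => i; rewrite !eE mulmxA pp.
- left=> i; apply: mulmx_col_inj => c.
  by rewrite -{1}(put_in c) -eE h mul0mx.
- right=> i; apply: mulmx_col_inj => c.
  by rewrite -{1}(put_in c) -eE h put_in mul1mx.
Qed.

Lemma rmod_fin_generated X : fin_generated (rmod X).
Proof.
apply: (@fin_generated_fin R (rmod X) {i : vert Q & 'I_(rdim X i)}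
  (fun t => (put (delta_mx (tagged t) 0 : 'cV_(rdim X (tag t))) : rmod X))) => m.
exists (fun t => ((m (tag t) (tagged t) 0)%:A : R)).
apply: rspaceP => i; rewrite rsumE.
rewrite (eq_bigr (fun t => put (m (tag t) (tagged t) 0 *: delta_mx (tagged t) 0 :
    'cV_(rdim X (tag t))) i)) => [|t _]; last by rewrite put_scale -scal_act.
rewrite -(sig_big_dep xpredT (fun _ => xpredT)
  (fun j p => put (m j p 0 *: delta_mx p 0 : 'cV_(rdim X j)) i)) /=.
rewrite (bigD1 i) //= [X in _ + X]big1 ?addr0 => [|j nj]; last first.
  by apply: big1 => p _; rewrite put_out.
under eq_bigr do rewrite put_in.
by rewrite [LHS]matrix_sum_delta; apply: eq_bigr => p _; rewrite big_ord1.
Qed.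
End Functor.

(** * Finitely generated modules are modules of representations *)

Lemma scale_sum_delta (k : fieldType) (V : lmodType k) (T : finType) (v : T -> V)
    (c : k) (b : T -> k) (t0 : T) :
  c *: v t0 + \sum_t b t *: v t = \sum_t (c * (t == t0)%:R + b t) *: v t.
Proof.
under [RHS]eq_bigr do rewrite scalerDl.
rewrite big_split /= [in RHS](bigD1 t0) //= eqxx mulr1 [X in _ = _ + X + _]big1 ?addr0 // => t.
by move/negPf=> ->; rewrite mulr0 scale0r.
Qed.

Section ScalarAction.
Variables (k : fieldType) (A : algType k) (M : lmodType A).

Definition ksc (c : k) (m : M) : M := (c%:A : A) *: m.

Lemma kscA a b m : ksc a (ksc b m) = ksc (a * b) m.
Proof. by rewrite /ksc scalerA; congr (_ *: _); rewrite mulr_algl scalerA. Qed.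
Lemma ksc0l m : ksc 0 m = 0.
Proof. by rewrite /ksc scale0r scale0r. Qed.
Lemma ksc0r c : ksc c 0 = 0.
Proof. exact: scaler0. Qed.
Lemma kscDl a b m : ksc (a + b) m = ksc a m + ksc b m.
Proof. by rewrite /ksc scalerDl scalerDl. Qed.
Lemma kscZ c (x : A) m : x *: ksc c m = ksc c (x *: m).
Proof. by rewrite /ksc !scalerA; congr (_ *: _); rewrite mulr_algl mulr_algr. Qed.
Lemma ksc_sumr c (T : Type) (r : seq T) (P : pred T) (F : T -> M) :
  ksc c (\sum_(t <- r | P t) F t) = \sum_(t <- r | P t) ksc c (F t).
Proof. exact: scaler_sumr. Qed.
Lemma ksc_suml (T : Type) (r : seq T) (P : pred T) (F : T -> k) m :
  ksc (\sum_(t <- r | P t) F t) m = \sum_(t <- r | P t) ksc (F t) m.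
Proof.
by apply: (big_morph (ksc^~ m)) => [a b|]; rewrite ?kscDl ?ksc0l.
Qed.
Lemma kscE (c : k) (x : A) m : (c *: x) *: m = ksc c (x *: m).
Proof. by rewrite /ksc scalerA mulr_algl. Qed.

Lemma scale_absorb (x y : A) (m : M) : x * y = x -> x *: m = x *: (y *: m).
Proof. by move=> e; rewrite scalerA e. Qed.

Lemma scale_sum_ext (T : finType) (x : A) (F G : T -> M) :
  (forall t, x *: F t = G t) -> x *: \sum_t F t = \sum_t G t.
Proof. by move=> e; rewrite scaler_sumr; apply: eq_bigr => t _. Qed.

Lemma ksc_lin_comb (T : finType) (b : T -> k) (x : A) (y : T -> A) m :
  x *: ((\sum_t b t *: y t) *: m) = \sum_t ksc (b t) (x *: (y t *: m)).
Proof.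
by rewrite scaler_suml scaler_sumr; apply: eq_bigr => t _; rewrite kscE kscZ.
Qed.

End ScalarAction.

Section FromModules.
Variables (k : fieldType) (Q : quiver).
Local Notation R := (path_alg k Q).
Variable M : lmodType R.

(** A finite spanning set of a vertex space contains a basis: take a spanning
   family of least size. *)
Lemma vertex_basis (e : R) (T : finType) (w : T -> M) : e * e = e ->
  (forall m, exists c : T -> k, e *: m = \sum_t ksc (c t) (w t)) ->
  exists n (g : 'I_n -> M), [/\ forall j, e *: g j = g j,
    forall m, exists c : 'I_n -> k, e *: m = \sum_j ksc (c j) (g j) &
    forall c : 'I_n -> k, \sum_j ksc (c j) (g j) = 0 -> forall j, c j = 0].
Proof.
move=> ee sp.
pose P n := exists g : 'I_n -> M, (forall j, e *: g j = g j) /\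
  forall m, exists c : 'I_n -> k, e *: m = \sum_j ksc (c j) (g j).
have [|n [[g [eg gs]] min]] := @nat_min P.
  exists #|T|, (fun j => e *: w (enum_val j)); split=> [j|m]; first by rewrite scalerA ee.
  have [c cE] := sp m; exists (fun j => c (enum_val j)).
  rewrite -{1}ee -scalerA cE scaler_sumr.
  rewrite (reindex_onto (@enum_val T T) enum_rank) /=; last first.
    by move=> j _; rewrite enum_rankK.
  by apply: eq_big => [i|i _]; rewrite ?enum_valK ?eqxx // kscZ.
exists n, g; split=> // c c0 j0; apply: contrapT => /eqP nz.
case: n g eg gs min c c0 j0 nz => [|n] g eg gs min c c0 j0 nz; first by case: j0 nz.
suff /min : P n by rewrite ltnn.
exists (fun j => g (lift j0 j)); split=> // m; have [b bE] := gs m.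
exists (fun j => b (lift j0 j) - b j0 / c j0 * c (lift j0 j)).
have -> : e *: m = \sum_j ksc (b j - b j0 / c j0 * c j) (g j).
  have e0 : \sum_j ksc (- (b j0 / c j0 * c j)) (g j) = 0.
    transitivity (ksc (- (b j0 / c j0)) (0 : M)); last exact: ksc0r.
    rewrite -[in RHS]c0 ksc_sumr.
    by apply: eq_bigr => j _; rewrite kscA mulNr.
  rewrite bE -[LHS]addr0 -[X in _ + X]e0 -big_split.
  by apply: eq_bigr => j _ /=; rewrite -kscDl.
by rewrite (bigD1_ord j0) //= divfK // subrr ksc0l add0r.
Qed.

Hypothesis finp : exists (T : finType) (p : T -> qpath Q), forall q, exists t, p t = q.

Lemma path_span (x : R) (T : finType) (p : T -> qpath Q) :
  (forall q, exists t, p t = q) -> exists c : T -> k, x = \sum_t c t *: path_elt k (p t).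
Proof.
move=> sp; elim/path_lin_ind: x => [|c q x [b ->]].
  by exists (fun=> 0); rewrite big1 // => t _; rewrite scale0r.
have [t0 <-] := sp q; exists (fun t => c * (t == t0)%:R + b t).
exact: (scale_sum_delta (fun t => path_elt k (p t))).
Qed.

(** As there are finitely many paths, the spaces at the vertices are finite
   dimensional, and bases of them turn the arrows into matrices. *)
Lemma fg_rmod : fin_generated M -> exists X : rep k Q, mod_iso (rmod X) M.
Proof.
move=> [r [w wE]]; have [T [p sp]] := finp.
have /dep_choice [d] i : exists n (g : 'I_n -> M),
   [/\ forall j, vert_elt k i *: g j = g j,
    forall m, exists c : 'I_n -> k, vert_elt k i *: m = \sum_j ksc (c j) (g j) &
    forall c : 'I_n -> k, \sum_j ksc (c j) (g j) = 0 -> forall j, c j = 0].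
  apply: (@vertex_basis _ (T * 'I_r)%type
    (fun tj => vert_elt k i *: (path_elt k (p tj.1) *: w tj.2))).
    by rewrite vert_eltM eqxx.
  move=> m; have [c cE] := wE m.
  have /choice [b bE] j : exists b : T -> k, c j = \sum_t b t *: path_elt k (p t).
    exact: path_span.
  exists (fun tj => b tj.2 tj.1).
  have e1 j : vert_elt k i *: (c j *: w j) =
      \sum_t ksc (b j t) (vert_elt k i *: (path_elt k (p t) *: w j)).
    rewrite bE; exact: ksc_lin_comb.
  transitivity (\sum_j \sum_t ksc (b j t) (vert_elt k i *: (path_elt k (p t) *: w j))).
    move: (scale_sum_ext e1) => e2.
    pose Sm := \sum_j c j *: w j.
    have cE' : m = Sm by exact: cE.
    rewrite cE'.
    exact: e2.
  by rewrite exchange_big pair_big.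
move=> /dep_choice [g gP].
have eg i j : vert_elt k i *: g i j = g i j by case: (gP i).
have gs i m : exists c : 'I_(d i) -> k, vert_elt k i *: m = \sum_j ksc (c j) (g i j).
  by case: (gP i).
have gfree i (c : 'I_(d i) -> k) : \sum_j ksc (c j) (g i j) = 0 -> forall j, c j = 0.
  by case: (gP i) => _ _; apply.
have eg0 i i' j : i' != i -> vert_elt k i' *: g i j = 0.
  by move=> ne; rewrite -eg scalerA vert_eltM (negPf ne) scale0r.
have /dep_choice [A AE] a : exists A : 'M[k]_(d (src a), d (tgt a)),
    forall j, arr_elt k a *: g (tgt a) j = \sum_l ksc (A l j) (g (src a) l).
  have /choice [c cE] j : exists c : 'I_(d (src a)) -> k,
      arr_elt k a *: g (tgt a) j = \sum_l ksc (c l) (g (src a) l).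
    by rewrite -(vert_arrM k a) -scalerA.
  by exists (\matrix_(l, j) c j l) => j; rewrite cE; apply: eq_bigr => l _; rewrite mxE.
pose X := @Rep k Q d A; exists X.
pose f (m : rmod X) : M := \sum_i \sum_j ksc (m i j 0) (g i j).
have fput i c : f (@put _ _ X i c) = \sum_j ksc (c j 0) (g i j).
  rewrite /f (bigD1 i) //= put_in [X in _ + X]big1 ?addr0 // => i' ni.
  by apply: big1 => j _; rewrite put_out 1?eq_sym // mxE ksc0l.
have ef i m : vert_elt k i *: f m = f (@put _ _ X i (m i)).
  rewrite fput /f scaler_sumr (bigD1 i) //= [X in _ + X]big1 ?addr0 => [|i' ni].
    by rewrite scaler_sumr; apply: eq_bigr => j _; rewrite kscZ eg.
  by rewrite scaler_sumr big1 // => j _; rewrite kscZ eg0 1?eq_sym // ksc0r.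
have fl : linear f.
  apply: path_linear => [m n|c m|i m|a m].
  - rewrite -big_split; apply: eq_bigr => i _; rewrite -big_split; apply: eq_bigr => j _.
    by rewrite raddE mxE kscDl.
  - rewrite scal_act -/(ksc c (f m)) ksc_sumr; apply: eq_bigr => i _.
    by rewrite ksc_sumr; apply: eq_bigr => j _; rewrite /rscale mxE kscA.
  - by rewrite vert_act ef.
  - have e1 j : arr_elt k a *: ksc (m (tgt a) j 0) (g (tgt a) j) =
        \sum_l ksc (A a l j * m (tgt a) j 0) (g (src a) l).
      rewrite kscZ AE ksc_sumr; apply: eq_bigr => l _.
      by rewrite kscA mulrC.
    have e2 : arr_elt k a *: f m = \sum_j \sum_l ksc (A a l j * m (tgt a) j 0) (g (src a) l).
      apply: etrans (scale_sum_ext e1); rewrite -fput -ef.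
      exact: scale_absorb (arr_vertM k a).
    apply: etrans (esym e2); rewrite arr_act fput exchange_big; apply: eq_bigr => l _ /=.
    by rewrite mxE ksc_suml.
have [h hE] := linear_pack fl.
have hinj m : h m = 0 -> m = 0.
  rewrite hE => f0; apply: rspaceP => i; apply/matrixP => j z; rewrite ord1 [RHS]mxE.
  move: j; apply: (gfree i (fun j => m i j 0)).
  by rewrite -(fput i (m i)) -ef f0 scaler0.
have /choice [h' h'K] m : exists m', h m' = m.
  have /dep_choice [c cE] i : exists c : 'cV[k]_(d i),
      vert_elt k i *: m = \sum_j ksc (c j 0) (g i j).
    by have [c ->] := gs i m; exists (\col_j c j); apply: eq_bigr => j _; rewrite mxE.
  exists (c : rmod X); rewrite hE /f -[RHS]scale1r -(sum_vert_elt k Q) scaler_suml.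
  by apply: eq_bigr => i _; rewrite cE.
exists h; exists h' => [m|//]; apply/eqP; rewrite -subr_eq0; apply/eqP/hinj.
by rewrite raddfB /= h'K subrr.
Qed.

End FromModules.

(** Indecomposable representations are classified by their dimension vectors,
   and these by their gradients. *)
Theorem wpos_rep_finite (k : closedFieldType) (Q : quiver) :
  (exists (T : finType) (p : T -> qpath Q), forall q, exists t, p t = q) ->
  weakly_positive Q -> rep_finite (path_alg k Q).
Proof.
move=> finp wpos; have [cl clP] := dim_class wpos.
pose has i (X : rep k Q) := rep_indec X /\ enum_rank (cl (rdim X)) = i.
have /choice [F FE] (i : 'I_#|root_idx Q|) : exists X, (exists Y, has i Y) -> has i X.
  have [[Y hY]|no] := pselect (exists Y, has i Y); first by exists Y.
  by exists (@Rep k Q (fun=> 0%N) (fun=> 0)).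
exists #|root_idx Q|, (fun i => rmod (F i)) => M fgM indM.
have [X XM] := fg_rmod finp fgM.
have indX : rep_indec X.
  by apply/rep_indec_mod; apply: mod_iso_indec indM; apply: mod_iso_sym.
exists (enum_rank (cl (rdim X))); apply: mod_iso_trans (mod_iso_sym XM) _.
have [|indF eF] := FE (enum_rank (cl (rdim X))); first by exists X.
have root (Y : rep k Q) : rep_indec Y -> (\sum_i rdim Y i * rdim Y i =
    (\sum_a rdim Y (src a) * rdim Y (tgt a)).+1)%N.
  move=> iY; have := brick_card wpos (proj1 iY) (indec_brick wpos iY).
  by rewrite card_end_idx card_map_idx.
apply/rep_iso_mod/indec_dim_iso => //.
by apply: clP; [apply: root..|apply: enum_rank_inj].
Qed.

(** * Counting orbits *)

Lemma distinct_points (k : closedFieldType) (n : nat) :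
  exists t : 'I_n -> k, injective t.
Proof.
suff [s us ss] : exists2 s : seq k, uniq s & size s = n.
  exists (fun i => nth 0 s i) => i j /eqP.
  by rewrite nth_uniq ?ss // => /eqP /val_inj.
elim: n => [|n [s us ss]]; first by exists [::].
have /closed_nonrootP [x] : \prod_(a <- s) ('X - a%:P) != 0.
  by rewrite monic_neq0 // monic_prod_XsubC.
by rewrite root_prod_XsubC => xs; exists (x :: s); rewrite /= ?xs ?ss.
Qed.

(** A polynomial function with exponents below [D] vanishes only if its
   coefficients do: on a grid of [D] distinct values the coefficients are
   recovered by the tensor power of the inverse Vandermonde matrix. *)
Lemma grid_coef (k : closedFieldType) (V : finType) (D : nat)
    (z : {ffun V -> 'I_D} -> k) :
  (forall x : V -> k, \sum_e z e * \prod_v x v ^+ e v = 0) -> forall e, z e = 0.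
Proof.
move=> h e0; have [t tinj] := distinct_points k D.
pose W : 'M[k]_D := Vandermonde D (\row_j t j).
have Wu : W \in unitmx.
  rewrite unitmxE unitfE det_Vandermonde; apply/prodf_neq0 => i _.
  apply/prodf_neq0 => j ij; rewrite !mxE subr_eq0 (inj_eq tinj).
  by apply: contraTneq ij => ->; rewrite ltnn.
have WE (a e : 'I_D) : \sum_j t j ^+ a * invmx W j e = (a == e :> nat)%:R.
  have := mulmxV Wu => /matrixP /(_ a e); rewrite !mxE => <-.
  by apply: eq_bigr => j _; rewrite !mxE.
transitivity (\sum_(e : {ffun V -> 'I_D}) z e * \prod_v (e v == e0 v :> nat)%:R).
  rewrite (bigD1 e0) //= big1 ?mulr1 => [|v _]; last by rewrite eqxx.
  rewrite big1 ?addr0 // => e ne.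
  have [v nv] : exists v, e v != e0 v.
    apply/existsP; apply: contraNT ne; rewrite negb_exists => /forallP e1.
    by apply/eqP/ffunP => v; apply/eqP; have := e1 v; rewrite negbK.
  by rewrite (bigD1 v) //= val_eqE (negPf nv) mul0r mulr0.
transitivity (\sum_(g : {ffun V -> 'I_D}) (\prod_v invmx W (g v) (e0 v)) *
    \sum_(e : {ffun V -> 'I_D}) z e * \prod_v t (g v) ^+ e v); last first.
  by rewrite big1 // => g _; rewrite (h (fun v => t (g v))) mulr0.
under [RHS]eq_bigr do rewrite mulr_sumr.
rewrite exchange_big; apply: eq_bigr => e _ /=.
under eq_bigr do rewrite -WE.
rewrite bigA_distr_bigA mulr_sumr; apply: eq_bigr => g _ /=.
by rewrite big_split /= mulrA mulrC.
Qed.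

Section HomogeneousFunctions.
Variables (k : fieldType) (J : finType).

Definition monom (e : J -> nat) (u : J -> k) : k := \prod_j u j ^+ e j.

(** Homogeneous polynomial functions of degree [r], as lists of terms. *)
Definition hpoly (r : nat) (f : (J -> k) -> k) : Prop :=
  exists2 l : seq (k * {ffun J -> nat}),
    all (fun t : k * {ffun J -> nat} => (\sum_j t.2 j)%N == r) l &
    forall u, f u = \sum_(t <- l) t.1 * monom t.2 u.

Lemma hpoly_ext r f g : hpoly r f -> (forall u, f u = g u) -> hpoly r g.
Proof. by move=> [l hl fE] e; exists l => // u; rewrite -e. Qed.

Lemma hpoly0 r : hpoly r (fun=> 0).
Proof. by exists [::] => // u; rewrite big_nil. Qed.

Lemma hpoly_const c : hpoly 0 (fun=> c).
Proof.
exists [:: (c, [ffun=> 0%N])] => [|u].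
  by rewrite /= andbT big1 // => j _; rewrite ffunE.
rewrite big_cons big_nil addr0 /monom big1 ?mulr1 // => j _.
by rewrite ffunE expr0.
Qed.

Lemma hpoly_var j : hpoly 1 (fun u => u j).
Proof.
exists [:: (1, [ffun i => (i == j : nat)])] => [|u].
  rewrite /= andbT (bigD1 j) //= ffunE eqxx big1 ?addn0 // => i ni.
  by rewrite ffunE (negPf ni).
rewrite big_cons big_nil addr0 mul1r /monom (bigD1 j) //= ffunE eqxx expr1.
by rewrite big1 ?mulr1 // => i ni; rewrite ffunE (negPf ni) expr0.
Qed.

Lemma hpolyD r f g : hpoly r f -> hpoly r g -> hpoly r (fun u => f u + g u).
Proof.
move=> [l hl fE] [l' hl' gE]; exists (l ++ l') => [|u].
  by rewrite all_cat hl hl'.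
by rewrite big_cat fE gE.
Qed.

Lemma hpolyM r s f g : hpoly r f -> hpoly s g -> hpoly (r + s) (fun u => f u * g u).
Proof.
move=> [l hl fE] [l' hl' gE].
pose term := (k * {ffun J -> nat})%type.
pose mulT (t t' : term) : term := (t.1 * t'.1, [ffun j => (t.2 j + t'.2 j)%N]).
exists [seq mulT t t' | t <- l, t' <- l'] => [|u].
  apply/allP => _ /allpairsP [[t t'] [/= tl tl' ->]] /=.
  under eq_bigr do rewrite ffunE.
  by rewrite big_split /= (eqP (allP hl _ tl)) (eqP (allP hl' _ tl')).
rewrite fE gE big_allpairs_dep mulr_suml; apply: eq_bigr => t _.
rewrite mulr_sumr; apply: eq_bigr => t' _ /=.
rewrite mulrACA; congr (_ * _); rewrite -big_split; apply: eq_bigr => j _ /=.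
by rewrite ffunE exprD.
Qed.

Lemma hpolyZ r c f : hpoly r f -> hpoly r (fun u => c * f u).
Proof. by rewrite -{2}[r]add0n; apply: hpolyM; apply: hpoly_const. Qed.

Lemma hpolyX r n f : hpoly r f -> hpoly (n * r) (fun u => f u ^+ n).
Proof.
move=> hf; elim: n => [|n IH]; first by apply: hpoly_ext (hpoly_const 1) _.
rewrite mulSn; apply: hpoly_ext (hpolyM hf IH) _ => u.
by rewrite exprS.
Qed.

Lemma hpoly_sum r (T : Type) (s : seq T) (P : pred T) (F : T -> (J -> k) -> k) :
  (forall t, hpoly r (F t)) -> hpoly r (fun u => \sum_(t <- s | P t) F t u).
Proof.
move=> h; elim: s => [|t s IH].
  by apply: hpoly_ext (hpoly0 r) _ => u; rewrite big_nil.
case Pt : (P t); last by apply: hpoly_ext IH _ => u; rewrite big_cons Pt.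
by apply: hpoly_ext (hpolyD (h t) IH) _ => u; rewrite big_cons Pt.
Qed.

Lemma hpoly_prod (T : Type) (s : seq T) (r : T -> nat) (F : T -> (J -> k) -> k) :
  (forall t, hpoly (r t) (F t)) ->
  hpoly (\sum_(t <- s) r t)%N (fun u => \prod_(t <- s) F t u).
Proof.
move=> h; elim: s => [|t s IH].
  by rewrite big_nil; apply: hpoly_ext (hpoly_const 1) _ => u; rewrite big_nil.
rewrite big_cons; apply: hpoly_ext (hpolyM (h t) IH) _ => u.
by rewrite big_cons.
Qed.

Lemma hpoly_det n (A : (J -> k) -> 'M[k]_n) :
  (forall i j, hpoly 1 (fun u => A u i j)) -> hpoly n (fun u => \det (A u)).
Proof.
move=> h; rewrite /determinant; apply: hpoly_sum => s; apply: hpolyZ.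
rewrite -{1}[n]card_ord -sum1_card; exact: hpoly_prod.
Qed.

Definition exps (r : nat) := {e : {ffun J -> 'I_r.+1} | (\sum_j e j)%N == r}.
HB.instance Definition _ r := Finite.on (exps r).

(** All but one of the exponents determine the remaining one. *)
Lemma card_exps r : (0 < #|J|)%N -> (#|{: exps r}| <= r.+1 ^ #|J|.-1)%N.
Proof.
move=> /card_gt0P [j0 _].
pose f (e : exps r) : {ffun {j | j != j0} -> 'I_r.+1} := [ffun j => val e (val j)].
have finj : injective f.
  move=> e e' /ffunP h.
  have eq_out j : j != j0 -> val e j = val e' j.
    by move=> nj; have := h (exist _ j nj); rewrite !ffunE.
  apply: val_inj; apply/ffunP => j; case: (eqVneq j j0) => [->|/eq_out //].
  have /eqP : (\sum_j val e j = \sum_j val e' j)%N by rewrite (eqP (valP e)) (eqP (valP e')).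
  rewrite (bigD1 j0) //= [X in _ == X](bigD1 j0) //=.
  rewrite (eq_bigr (fun i => val e' i : nat)) => [|i /eq_out -> //].
  by rewrite eqn_add2r => /eqP /val_inj.
have := leq_card f finj; rewrite card_ffun card_ord.
suff -> : #|{: {j | j != j0}}| = #|J|.-1 by [].
by rewrite card_sig -(cardC1 j0); apply: eq_card.
Qed.

Lemma hpoly_coef r f : hpoly r f ->
  exists a : exps r -> k, forall u, f u = \sum_e a e * monom (fun j => val e j) u.
Proof.
move=> [l hl fE].
exists (fun e : exps r => \sum_(t <- l | [forall j, t.2 j == val e j :> nat]) t.1) => u.
under eq_bigr do rewrite mulr_suml.
rewrite (exchange_big_dep xpredT) //= fE big_seq [RHS]big_seq.
apply: eq_bigr => t tl.
have st := eqP (allP hl _ tl).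
have lt j : (t.2 j < r.+1)%N by rewrite ltnS -st (bigD1 j) //= leq_addr.
pose g : {ffun J -> 'I_r.+1} := [ffun j => Ordinal (lt j)].
have se : (\sum_j g j)%N == r.
  by apply/eqP; rewrite -[RHS]st; apply: eq_bigr => j _; rewrite ffunE.
pose e : exps r := exist (fun e : {ffun J -> 'I_r.+1} => is_true ((\sum_j e j)%N == r)) g se.
rewrite (big_pred1 e) => [|e'].
  by congr (_ * _); apply: eq_bigr => j _; rewrite /= ffunE.
apply/forallP/eqP => [h|-> j]; last by rewrite /= ffunE.
apply: val_inj; apply/ffunP => j; apply: val_inj; rewrite /= ffunE /=.
by rewrite (eqP (h j)).
Qed.

End HomogeneousFunctions.

Section Orbits.
Variables (k : closedFieldType) (Q : quiver) (d : vert Q -> nat).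
Local Notation maps := (forall a : arr Q, 'M[k]_(d (src a), d (tgt a))).
Local Notation RepD F := (@Rep k Q d F).
Local Notation J := (end_idx d).
Local Notation V := (map_idx d).

Definition start_dim (v : V) : nat := d (src (tag v)).

(** On the orbit of [F] the entries of the structure maps, multiplied by the
   determinants that occur in their denominators, are homogeneous polynomials in
   the entries of the base change. *)
Lemma orbit_hpoly (D : nat) (F : maps) (e : V -> 'I_D) :
  exists2 h : (J -> k) -> k,
    hpoly (D * \sum_v start_dim v)%N h &
    forall G (u : J -> k), (forall i, end_of u i \in unitmx) ->
      (forall a, F a *m end_of u (tgt a) = end_of u (src a) *m G a) ->
      h u = (\prod_(v : V) \det (end_of u (src (tag v))) ^+ D) * \prod_v map_coef G v ^+ e v.
Proof.
have hu i p q : hpoly 1 (fun u : J -> k => end_of u i p q).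
  by apply: hpoly_ext (hpoly_var k (Tagged _ (p, q))) _ => u; rewrite mxE.
pose N (v : V) (u : J -> k) : k := (\adj (end_of u (src (tag v))) *m F (tag v) *m end_of u (tgt (tag v)))
  (tagged v).1 (tagged v).2.
have hN v : hpoly (start_dim v) (N v).
  rewrite /N /start_dim; move: (tagged v); set a := tag v => -[p q].
  have dp : (0 < d (src a))%N by apply: leq_ltn_trans (ltn_ord p).
  rewrite -[X in hpoly X _](prednK dp).
  apply: (@hpoly_ext _ _ _ (fun u : J -> k => \sum_l (\sum_i
    \adj (end_of u (src a)) p i * F a i l) * end_of u (tgt a) l q)); last first.
    by move=> u; rewrite mxE; apply: eq_bigr => l _; rewrite [in RHS]mxE.
  apply: hpoly_sum => l; rewrite -[X in hpoly X _]addn1; apply: hpolyM => //.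
  apply: hpoly_sum => i; rewrite -[X in hpoly X _]addn0; apply: hpolyM; last exact: hpoly_const.
  apply: (@hpoly_ext _ _ _ (fun u : J -> k => cofactor (end_of u (src a)) i p)).
    by apply: hpolyZ; apply: hpoly_det => i' j'; apply: hpoly_ext (hu _ _ _) _ => u; rewrite !mxE.
  by move=> u; rewrite mxE.
have hdet i : hpoly (d i) (fun u : J -> k => \det (end_of u i)) by apply: hpoly_det.
exists (fun u => \prod_(v : V) (\det (end_of u (src (tag v))) ^+ (D - e v) * N v u ^+ e v)).
  rewrite big_distrr /=; apply: hpoly_prod => v.
  rewrite -{1}(subnK (ltnW (ltn_ord (e v)))) mulnDl.
  by apply: hpolyM; apply: hpolyX; [apply: hdet|apply: hN].
move=> G u uu uG; rewrite -big_split; apply: eq_bigr => v _ /=.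
have -> : N v u = \det (end_of u (src (tag v))) * map_coef G v.
  by rewrite /N -mulmxA uG mulmxA mul_adj_mx mul_scalar_mx mxE.
by rewrite exprMn mulrA -exprD subnK // ltnW.
Qed.

(** Suppose that there are at least as many entries of structure maps as parameters
   of base changes. There are [D ^ #|V|] monomials in the entries with exponents
   below [D]; on one orbit they become, up to a common factor, homogeneous
   polynomials of degree [D * rho] in the parameters, and these form a space whose
   dimension grows only like [D ^ (#|J| - 1)]. For large [D] some nontrivial
   combination of the monomials vanishes on all the orbits, that is, everywhere. *)
Lemma finite_orbits (C : finType) (F : C -> maps) :
  (exists i, d i <> 0%N) -> (forall G, exists c, rep_iso (RepD (F c)) (RepD G)) ->
  (#|{: V}| < #|{: J}|)%N.
Proof.
move=> [i0 n0] orb; rewrite ltnNge; apply/negP => le.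
have J0 : (0 < #|{: J}|)%N.
  by rewrite card_end_idx (bigD1 i0) //= ltn_addr // muln_gt0 lt0n; move/eqP: n0 => ->.
pose rho := (\sum_v start_dim v)%N; pose B := (#|C| * rho.+1 ^ #|{: J}|.-1)%N.
pose D := B.+1; pose r := (D * rho)%N.
have lt : (#|{: C * exps J r}| < #|{: {ffun V -> 'I_D}}|)%N.
  rewrite card_prod card_ffun card_ord.
  apply: leq_ltn_trans (_ : #|C| * r.+1 ^ #|{: J}|.-1 < _)%N.
    by rewrite leq_mul2l card_exps ?orbT.
  apply: leq_trans (leq_pexp2l _ le) => //.
  rewrite -[#|{: J}|]prednK // expnS.
  apply: leq_ltn_trans (_ : B * D ^ #|{: J}|.-1 < _)%N; last first.
    by rewrite ltn_pmul2r // expn_gt0.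
  have leE : (r.+1 <= rho.+1 * D)%N by rewrite /r; nia.
  rewrite /B -mulnA leq_mul2l -expnMn; apply/orP; right.
  have pw m : (r.+1 ^ m <= (rho.+1 * D) ^ m)%N by case: m => // m; rewrite leq_exp2r.
  exact: pw.
have /dep_choice [a aE] (ce : C * {ffun V -> 'I_D}) : exists a : exps J r -> k,
    forall G (u : J -> k), (forall i, end_of u i \in unitmx) ->
      (forall a, F ce.1 a *m end_of u (tgt a) = end_of u (src a) *m G a) ->
      (\prod_(v : V) \det (end_of u (src (tag v))) ^+ D) * \prod_v map_coef G v ^+ ce.2 v =
      \sum_e a e * monom (fun j => val e j) u.
  have [h hh hE] := @orbit_hpoly D (F ce.1) ce.2.
  have [a aE] := hpoly_coef hh; exists a => G u uu uG.
  by rewrite -aE (hE G).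
have [z [[e nz] zE]] := @lin_sys_sol k _ _ (fun e (cm : C * exps J r) => a (cm.1, e) cm.2) lt.
apply: nz; apply: grid_coef e => x.
have [c [f [g [hf fg gf]]]] := orb (map_of x).
pose u := end_coef f.
have uE i : end_of u i = f i by apply: end_coefK.
have uu i : end_of u i \in unitmx by rewrite uE; case: (mulmx1_unit (fg i)).
have uG b : F c b *m end_of u (tgt b) = end_of u (src b) *m map_of x b.
  by rewrite !uE; apply: hf.
have T0 : \prod_(v : V) \det (end_of u (src (tag v))) ^+ D != 0.
  by apply/prodf_neq0 => v _; rewrite expf_neq0 // -unitfE -unitmxE.
apply: (mulfI T0); rewrite mulr0 mulr_sumr.
rewrite (eq_bigr (fun e => \sum_m (z e * a (c, e) m) * monom (fun j => val m j) u)).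
  rewrite exchange_big big1 // => m _ /=.
  by rewrite -mulr_suml (zE (c, m)) mul0r.
move=> e _; rewrite mulrCA.
have := aE (c, e) _ _ uu uG; rewrite /= => aE1.
transitivity (z e * \sum_m a (c, e) m * monom (fun j => val m j) u).
  rewrite -aE1; congr (_ * (_ * _)); apply: eq_bigr => v _.
  by rewrite /map_coef mxE; case: v => ? [].
by rewrite mulr_sumr; apply: eq_bigr => m _; rewrite mulrA.
Qed.
End Orbits.

Section Coloring.
Variables (k : closedFieldType) (Q : quiver) (n : nat) (F : 'I_n -> lmodType (path_alg k Q)).
Hypothesis Fall : forall M : lmodType (path_alg k Q),
  fin_generated M -> mod_indecomposable M -> exists i, mod_iso M (F i).
Implicit Types X Y L : rep k Q.

(** The indecomposable summands of a representation, listed by their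
   isomorphism classes. *)
Inductive summands : rep k Q -> seq 'I_n -> Prop :=
| summands_nil X : (forall i, rdim X i = 0%N) -> summands X [::]
| summands_cons X L L' c s (u : repfam L X) (p : repfam X L)
    (u' : repfam L' X) (p' : repfam X L') :
    mod_iso (rmod L) (F c) -> summands L' s ->
    is_hom u -> is_hom p -> is_hom u' -> is_hom p' ->
    (forall i, u i *m p i = 1%:M) -> (forall i, u' i *m p' i = 1%:M) ->
    (forall i, p i *m u i + p' i *m u' i = 1%:M) ->
    summands X (c :: s).

Lemma summands_orth (m l l' : nat) (u : 'M[k]_(l, m)) (p : 'M[k]_(m, l))
    (u' : 'M[k]_(l', m)) (p' : 'M[k]_(m, l')) :
  u *m p = 1%:M -> u' *m p' = 1%:M -> p *m u + p' *m u' = 1%:M ->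
  u *m p' = 0 /\ u' *m p = 0.
Proof.
move=> up u'p' e; split.
  have : u *m (p *m u + p' *m u') *m p' = u *m p' by rewrite e mulmx1.
  rewrite mulmxDr mulmxDl !mulmxA up mul1mx -!mulmxA u'p' mulmx1 => h.
  by apply: (addrI (u *m p')); rewrite addr0 h.
have : u' *m (p *m u + p' *m u') *m p = u' *m p by rewrite e mulmx1.
rewrite mulmxDr mulmxDl !mulmxA u'p' mul1mx -!mulmxA up mulmx1 => h.
by apply: (addrI (u' *m p)); rewrite addr0 h.
Qed.

(** Isomorphisms of the summands add up. *)
Lemma summands_iso X Y s : summands X s -> summands Y s -> rep_iso X Y.
Proof.
move=> h; elim: h Y => {X s}
  [X X0 Y hY|X L L' c s u p u' p' LF _ IH hu hp hu' hp' up up' pu Y hY].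
  have Y0 i : rdim Y i = 0%N by inversion hY.
  exists (fun i => 0), (fun i => 0); split=> [a|i|i].
  - by rewrite mulmx0 mul0mx.
  - by apply/matrixP => r; have := ltn_ord r; rewrite [X in (_ < X)%N]X0.
  - by apply/matrixP => r; have := ltn_ord r; rewrite [X in (_ < X)%N]Y0.
inversion hY as [|Y' K K' c' s' v q v' q' KF hK' hv hq hv' hq' vq vq' qv]; subst.
have [f [g [hf fg gf]]] : rep_iso L K.
  by apply/rep_iso_mod; apply: mod_iso_trans LF _; apply: mod_iso_sym.
have [f' [g' [hf' fg' gf']]] := IH _ hK'.
exists (fun i => p i *m f i *m v i + p' i *m f' i *m v' i).
exists (fun i => q i *m g i *m u i + q' i *m g' i *m u' i).
have [o1 o2] := all_and2 (fun i => summands_orth (up i) (up' i) (pu i)).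
have [o3 o4] := all_and2 (fun i => summands_orth (vq i) (vq' i) (qv i)).
split=> [|i|i].
- by apply: is_homD; do ?apply: is_hom_comp.
- rewrite mulmxDl !mulmxDr -!mulmxA.
  rewrite !(mulmxA (v i)) !(mulmxA (v' i)) vq vq' o3 o4 !mul0mx !mul1mx !mulmx0.
  by rewrite addr0 add0r !(mulmxA (f i)) !(mulmxA (f' i)) fg fg' !mul1mx pu.
- rewrite mulmxDl !mulmxDr -!mulmxA.
  rewrite !(mulmxA (u i)) !(mulmxA (u' i)) up up' o1 o2 !mul0mx !mul1mx !mulmx0.
  by rewrite addr0 add0r !(mulmxA (g i)) !(mulmxA (g' i)) gf gf' !mul1mx qv.
Qed.

(** Split off an indecomposable summand; the dimension of the complement drops. *)
Lemma summands_exist X : exists2 s, summands X s & (size s <= total_dim X)%N.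
Proof.
have [m] := ubnP (total_dim X); elim: m X => // m IH X /ltnSE le.
have [z|/existsNP [i0 ni]] := pselect (forall i, rdim X i = 0%N).
  by exists [::] => //; apply: summands_nil.
have nz : exists i, (1%:M : 'M[k]_(rdim X i)) <> 0.
  exists i0.
  by move/(congr1 mxrank); rewrite mxrank1 mxrank0.
have [L [u [p [iL hu hp up _]]]] := @indec_summand k Q X X (fun i => 1%:M) nz.
have [c Lc] : exists c, mod_iso (rmod L) (F c).
  by apply: Fall; [apply: rmod_fin_generated|apply/rep_indec_mod].
pose e i := 1%:M - p i *m u i.
have he : @is_hom k Q X X e.
  by apply: is_homB; [apply: is_hom_id|apply: is_hom_comp].
have ee i' : e i' *m e i' = e i'.
  rewrite /e mulmxBr mulmx1 mulmxBl mul1mx mulmxA -(mulmxA (p i')) up mulmx1.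
  by rewrite subrr subr0.
have [L' [u' [p' [[hu' hp' pu' up'] dL']]]] := rep_split he ee.
have lt : (total_dim L' < total_dim X)%N.
  have [[j nj] _] := iL.
  have ue j' : u j' *m e j' = 0 by rewrite /e mulmxBr mulmx1 mulmxA up mul1mx subrr.
  have rk j' : (\rank (e j') + rdim L j' <= rdim X j')%N.
    have := mulmx0_rank_max (ue j'); rewrite addnC.
    by rewrite (eqP (_ : row_free (u j'))) //; apply/row_freeP; exists (p j').
  rewrite /total_dim (bigD1 j) //= [X in (_ < X)%N](bigD1 j) //= -addSn leq_add //.
    by rewrite dL'; apply: leq_trans (rk j); rewrite -addn1 leq_add2l lt0n; apply/eqP.
  by apply: leq_sum => j' _; rewrite dL'; apply: leq_trans (rk j'); apply: leq_addr.
have [s hs ss] := IH L' (leq_trans lt le).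
exists (c :: s); last by rewrite /= (leq_ltn_trans ss).
apply: (summands_cons Lc hs hu hp hu' hp' up up') => j.
by rewrite pu' /e addrC subrK.
Qed.
End Coloring.

(** If there are only finitely many indecomposable modules, then there are only
   finitely many representations of each dimension vector [d]; the base changes,
   up to scalars, then form a family of at least as many parameters as the
   representations of dimension vector [d]. *)
Theorem rep_finite_wpos (k : closedFieldType) (Q : quiver) :
  rep_finite (path_alg k Q) -> weakly_positive Q.
Proof.
move=> [n [F Fall]] d nd; rewrite -card_map_idx -card_end_idx.
pose m := (\sum_i d i)%N; pose C := m.-bseq 'I_n.
have /choice [G GE] (c : C) : exists G : forall a, 'M[k]_(d (src a), d (tgt a)),
    (exists G', summands F (@Rep k Q d G') c) -> summands F (@Rep k Q d G) c.
  have [[G hG]|no] := pselect (exists G', summands F (@Rep k Q d G') c).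
    by exists G.
  by exists (fun=> 0).
apply: (@finite_orbits k Q d C G nd) => G'.
have [s hs ss] := summands_exist Fall (@Rep k Q d G').
exists (Bseq ss); apply: (summands_iso (GE (Bseq ss) _) hs).
by exists G'.
Qed.

(** * Quotients of representation-finite rings *)

Section Restriction.
Variables (R S : nzRingType) (rho : {rmorphism R -> S}).

Section Module.
Variable M : lmodType S.

Definition restrict : Type := M.
HB.instance Definition _ := GRing.Zmodule.on restrict.
Definition restrict_scale (x : R) (m : restrict) : restrict := rho x *: (m : M).
Fact restrict_scaleA a b m :
  restrict_scale a (restrict_scale b m) = restrict_scale (a * b) m.
Proof. by rewrite /restrict_scale scalerA rmorphM. Qed.
Fact restrict_scale1 : left_id 1 restrict_scale.
Proof. by move=> m; rewrite /restrict_scale rmorph1 scale1r. Qed.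
Fact restrict_scaleDr : right_distributive restrict_scale +%R.
Proof. by move=> c m n; apply: scalerDr. Qed.
Fact restrict_scaleDl m : {morph restrict_scale^~ m : a b / a + b}.
Proof. by move=> a b; rewrite /restrict_scale rmorphD scalerDl. Qed.
HB.instance Definition _ := GRing.Zmodule_isLmodule.Build R restrict
  restrict_scaleA restrict_scale1 restrict_scaleDr restrict_scaleDl.

Lemma restrictE (x : R) (m : restrict) : x *: m = rho x *: (m : M). Proof. by []. Qed.
End Module.

Hypothesis rho_onto : forall y, exists x, rho x = y.

Lemma linear_restrict (M N : lmodType S) (f : {linear restrict M -> restrict N}) :
  linear (f : M -> N).
Proof.
move=> a x y; have [b <-] := rho_onto a.
exact: (linearP f b x y).
Qed.

Lemma mod_iso_restrict (M N : lmodType S) :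
  mod_iso (restrict M) (restrict N) -> mod_iso M N.
Proof.
move=> [f [g fK gK]]; have [h hE] := linear_pack (linear_restrict f).
by exists h, g => x; rewrite hE.
Qed.

(** A module over the quotient is a module over the ring, with the same linear
   maps. *)
Theorem rep_finite_quotient : rep_finite R -> rep_finite S.
Proof.
move=> [n [F FE]].
have /choice [G GE] i : exists N : lmodType S,
    (exists M : lmodType S, mod_iso (restrict M) (F i)) -> mod_iso (restrict N) (F i).
  have [[M hM]|no] := pselect (exists M : lmodType S, mod_iso (restrict M) (F i)).
    by exists M.
  by exists S^o.
exists n, G => M [r [g gE]] /mod_indecP [[x0 nx0] ind].
have [|| i Mi] := FE (restrict M).
- exists r, g => x; have [c cE] := gE x.
  have /choice [b bE] j := rho_onto (c j).
  by exists b; rewrite cE; apply: eq_bigr => j _; rewrite restrictE bE.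
- apply/mod_indecP; split; first by exists x0.
  move=> e ee; have [h hE] := linear_pack (linear_restrict e).
  have [x|h0|h1] := ind h; first by rewrite !hE ee.
    by left=> x; rewrite -hE h0.
  by right=> x; rewrite -hE h1.
exists i; apply: mod_iso_restrict; apply: (mod_iso_trans Mi).
by apply: mod_iso_sym; apply: GE; exists M.
Qed.
End Restriction.

(** * Algebra homomorphisms *)

Section AlgHom.
Variable k : fieldType.
Implicit Types A B C : algType k.

(** Algebra homomorphisms are predicates on plain functions here, so that they can be
   built from choices; [alg_hom_pack] bundles them. *)
Definition multiplicative_map A B (f : A -> B) : Prop :=
  linear f /\ forall x y, f (x * y) = f x * f y.

Definition alg_hom A B (f : A -> B) : Prop := multiplicative_map f /\ f 1 = 1.

Lemma linD A B (f : A -> B) x y : linear f -> f (x + y) = f x + f y.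
Proof. by move=> fl; rewrite -[x]scale1r fl !scale1r. Qed.
Lemma lin0 A B (f : A -> B) : linear f -> f 0 = 0.
Proof. by move=> fl; apply: (addrI (f 0)); rewrite -linD // !addr0. Qed.
Lemma linZ A B (f : A -> B) c x : linear f -> f (c *: x) = c *: f x.
Proof. by move=> fl; rewrite -[c *: x]addr0 fl lin0 // !addr0. Qed.
Lemma linB A B (f : A -> B) x y : linear f -> f (x - y) = f x - f y.
Proof. by move=> fl; rewrite -scaleN1r linD // linZ // scaleN1r. Qed.
Lemma lin_sum A B (f : A -> B) (T : Type) (s : seq T) (P : pred T) (F : T -> A) :
  linear f -> f (\sum_(t <- s | P t) F t) = \sum_(t <- s | P t) f (F t).
Proof.
by move=> fl; apply: (big_morph f) => [x y|]; [apply: linD|apply: lin0].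
Qed.

Lemma alg_hom_pack A B (f : A -> B) : alg_hom f ->
  exists g : {lrmorphism A -> B}, forall x, g x = f x.
Proof.
move=> [[fl fM] f1].
pose g : {lrmorphism A -> B} := HB.pack f
  (GRing.isLinear.Build k A B *:%R f fl)
  (GRing.isMonoidMorphism.Build A B f (conj f1 fM)).
by exists g.
Qed.

Lemma lrmorphism_hom A B (f : {lrmorphism A -> B}) : alg_hom f.
Proof. by split; [split; [exact: linearP|exact: rmorphM]|exact: rmorph1]. Qed.

Lemma alg_hom_comp A B C (f : A -> B) (g : B -> C) :
  alg_hom f -> alg_hom g -> alg_hom (g \o f).
Proof.
move=> [[fl fM] f1] [[gl gM] g1]; split; last by rewrite /= f1.
by split=> [c x y|x y] /=; rewrite ?fl ?gl ?fM ?gM.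
Qed.

Lemma alg_hom_inv A B (f : A -> B) (g : B -> A) :
  alg_hom f -> cancel f g -> cancel g f -> alg_hom g.
Proof.
move=> [[fl fM] f1] fK gK; split; last by rewrite -f1 fK.
by split=> [c x y|x y]; apply: (can_inj fK); rewrite ?fl ?fM !gK.
Qed.

Lemma alg_iso_hom A B : alg_iso A B <-> exists f : A -> B, alg_hom f /\ bijective f.
Proof.
split=> [[f fb]|[f [fh fb]]].
  by exists f; split=> //; apply: lrmorphism_hom.
have [g gE] := alg_hom_pack fh; exists g.
by apply: (eq_bij fb) => x; rewrite gE.
Qed.

Lemma alg_iso_sym A B : alg_iso A B -> alg_iso B A.
Proof.
move=> /alg_iso_hom [f [fh [g fK gK]]]; apply/alg_iso_hom.
by exists g; split; [apply: alg_hom_inv fK gK|exists f].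
Qed.

Lemma alg_iso_trans A B C : alg_iso A B -> alg_iso B C -> alg_iso A C.
Proof.
move=> /alg_iso_hom [f [fh fb]] /alg_iso_hom [g [gh gb]]; apply/alg_iso_hom.
by exists (g \o f); split; [apply: alg_hom_comp|apply: bij_comp].
Qed.

End AlgHom.

Section QuotientMap.
Variables (k : fieldType) (A : algType k) (I : ideal A).

Lemma quot_pi_hom : alg_hom (quot_pi I : A -> alg_quot I).
Proof.
split; last by [].
split; last exact: quot_piM.
by move=> c x y; rewrite quot_piD quot_piZ.
Qed.

Lemma quot_lift (B : algType k) (f : A -> B) : linear f -> (forall x, I x -> f x = 0) ->
  exists g : alg_quot I -> B, forall x, g (quot_pi I x) = f x.
Proof.
move=> fl fI; exists (fun x => f (quot_repr x)) => x.
apply/eqP; rewrite -subr_eq0 -linB //; apply/eqP/fI.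
exact: quot_pi_repr.
Qed.

Lemma quot_lift_mul (B : algType k) (f : A -> B) (g : alg_quot I -> B) :
  multiplicative_map f -> (forall x, g (quot_pi I x) = f x) -> multiplicative_map g.
Proof.
move=> [fl fM] gE; have [[pl pM] _] := quot_pi_hom.
split=> [c x y|x y]; rewrite -(quot_reprK x) -(quot_reprK y).
  by rewrite -pl !gE fl.
by rewrite -pM !gE fM.
Qed.

End QuotientMap.

(** Linear extension of a multiplicative system indexed by the morphisms of a
   category. *)
Section CategoryMap.
Variables (k : fieldType) (C : smallcat) (B : algType k) (h : mor C -> B).
Hypothesis hM : forall f g, cod f = dom g -> h (Defs.comp f g) = h f * h g.
Hypothesis h0 : forall f g, cod f <> dom g -> h f * h g = 0.

Lemma cat_alg_map_mul : multiplicative_map (lin_ext h : cat_alg k C -> B).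
Proof.
pose H : cat_alg k C -> B := lin_ext h.
have Hl : linear H by move=> c x y; apply: linearP.
have HU f : H (cbasis k f) = h f by apply: lin_extU.
split=> // x y; rewrite -/H.
have H0 := lin0 Hl.
elim/cbasis_ind: x => [|c f x IH]; first by rewrite mul0r H0 mul0r.
rewrite (mul_linl c) !Hl IH (mul_linl c); congr (_ *: _ + _) => {x IH}.
rewrite HU; elim/cbasis_ind: y => [|c' g y IH]; first by rewrite mulr0 H0 mulr0.
rewrite (mul_linr c') !Hl IH (mul_linr c'); congr (_ *: _ + _) => {y IH}.
rewrite HU cbasisM /cmul1; case: eqP => [e|ne]; first by rewrite HU hM.
by rewrite H0 h0.
Qed.

Lemma cat_alg_map1 : \sum_v h (idm v) = 1 -> (lin_ext h : cat_alg k C -> B) 1 = 1.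
Proof.
move=> h1; have [Hl _] := cat_alg_map_mul.
rewrite -[1 in LHS]/(cone k C) /cone.
rewrite (lin_sum _ _ _ Hl) -[RHS]h1; apply: eq_bigr => v _.
exact: lin_extU.
Qed.
End CategoryMap.

(** The universal property of path algebras. *)
Section PathAlgebraMap.
Variables (k : fieldType) (Q : quiver) (B : algType k).
Variables (E : vert Q -> B) (X : arr Q -> B).
Hypothesis EE : forall i, E i * E i = E i.
Hypothesis E0 : forall i j, i <> j -> E i * E j = 0.
Hypothesis EX : forall a, E (src a) * X a = X a.
Hypothesis XE : forall a, X a * E (tgt a) = X a.

Definition path_value (p : qpath Q) : B :=
  E (path_start p) * foldr (fun a y => X a * y) 1 (val p).2.

Lemma walk_value v s : is_walk v s ->
  E v * foldr (fun a y => X a * y) 1 s = E v * foldr (fun a y => X a * y) 1 s * E (walk_end v s).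
Proof.
elim: s v => [|a s IH] v /=; first by rewrite mulr1 /walk_end /= EE.
move=> /andP [/eqP <- hs]; rewrite mulrA EX -[in LHS]XE -[in RHS]XE -!mulrA.
by rewrite {1}(IH _ hs) !mulrA.
Qed.

Lemma foldr_mul_cat (s t : seq (arr Q)) :
  foldr (fun a y => X a * y) 1 (s ++ t) =
  foldr (fun a y => X a * y) 1 s * foldr (fun a y => X a * y) 1 t.
Proof. by elim: s => [|a s IH] /=; rewrite ?mul1r // IH mulrA. Qed.

Lemma path_alg_map : exists f : path_alg k Q -> B,
  [/\ multiplicative_map f, forall i, f (vert_elt k i) = E i,
      forall a, f (arr_elt k a) = X a, forall p, f (path_elt k p) = path_value p &
      \sum_i E i = 1 -> f 1 = 1].
Proof.
pose f : path_alg k Q -> B :=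
  lin_ext (path_value : mor (path_category Q) -> B).
have fU p : f (path_elt k p) = path_value p by apply: lin_extU.
have val_end p : path_value p = path_value p * E (path_end p).
  exact: walk_value (valP p).
exists f; split=> //.
- apply: cat_alg_map_mul => [p q pq|p q pq] /=.
    have pq' : path_end p = path_start q := pq.
    rewrite {1}/path_value path_start_cat // val_path_cat //= foldr_mul_cat mulrA.
    by rewrite -/(path_value p) {1}val_end pq' -mulrA.
  rewrite val_end -mulrA [path_value q]/path_value (mulrA (E _) (E _)) E0 //.
  by rewrite mul0r mulr0.
- by move=> i; rewrite fU /path_value /= mulr1.
- by move=> a; rewrite fU /path_value /= mulr1 EX.
move=> E1; apply: (cat_alg_map1 (C := path_category Q)) => //.
- move=> p q pq.
  have pq' : path_end p = path_start q := pq.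
  rewrite {1}/path_value path_start_cat // val_path_cat //= foldr_mul_cat mulrA.
  by rewrite -/(path_value p) {1}val_end pq' -mulrA.
- move=> p q pq.
  rewrite val_end -mulrA [path_value q]/path_value (mulrA (E _) (E _)) E0 //.
  by rewrite mul0r mulr0.
by rewrite -[RHS]E1; apply: eq_bigr => i _; rewrite /path_value /= mulr1.
Qed.

End PathAlgebraMap.

(** * Generators and relations of generalized path algebras *)

Section GenPathAlgebra.
Variables (k : fieldType) (G : quiver) (A : vert G -> falgType k).
Local Notation L := (gen_path_alg A).
Local Notation tagA := (Tagged (fun i => A i)).
Local Notation raw := (raw_expr A).

Definition expr_class (w : raw) : L := quot_pi (mlin_ideal A) (expr_elt w).

Lemma expr_classM (u w : raw) : is_expr u.1 u.2 -> is_expr w.1 w.2 ->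
  expr_class u * expr_class w =
  if tag (last_letter u) == tag w.1 then expr_class (raw_mul u.1 u.2 w) else 0.
Proof.
move=> hu hw; have [[pl pM] _] := quot_pi_hom (mlin_ideal A).
rewrite /expr_class -pM expr_eltM //; case: eqP => // _.
exact: lin0.
Qed.

Definition letter_elt i (a : A i) : L := expr_class (tagA a, [::]).
Definition arrow_elt (al : arr G) : L :=
  expr_class (tagA (1 : A (src al)), [:: (al, tagA (1 : A (tgt al)))]).

Lemma letter_elt_linear i : linear (@letter_elt i).
Proof.
move=> c a b; have [[pl _] _] := quot_pi_hom (mlin_ideal A).
rewrite /letter_elt /expr_class -pl; apply/quot_piP.
rewrite opprD addrA; apply: lin_spanG.
exact: (MlinRel c a b (slot_head [::])).

Qed.

Lemma letter_eltM i (a b : A i) : letter_elt a * letter_elt b = letter_elt (a * b).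
Proof.
rewrite /letter_elt expr_classM //= eqxx; congr (expr_class (_, _)).
exact: letter_mulE.
Qed.

Lemma letter_elt_neq i j (a : A i) (b : A j) : i <> j -> letter_elt a * letter_elt b = 0.
Proof.
move=> ij; rewrite /letter_elt expr_classM //=.
by have /eqP/negPf := ij; rewrite /last_letter /= => ->.
Qed.

Lemma arrow_eltl al : letter_elt (1 : A (src al)) * arrow_elt al = arrow_elt al.
Proof.
rewrite /letter_elt /arrow_elt expr_classM //= ?eqxx //.
by rewrite letter_mulE mul1r.
Qed.

Lemma arrow_eltr al : arrow_elt al * letter_elt (1 : A (tgt al)) = arrow_elt al.
Proof.
rewrite /letter_elt /arrow_elt expr_classM //= ?eqxx //.
by rewrite letter_mulE mul1r.
Qed.

Lemma expr_class_cons (x : letter A) al y s :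
  is_expr x ((al, y) :: s) ->
  expr_class (x, (al, y) :: s) =
  letter_elt (tagged x) * arrow_elt al * expr_class (y, s).
Proof.
case: x y => [i a] [j b] /and3P [/= /eqP si /eqP tj hs].
subst i j; rewrite /letter_elt /arrow_elt expr_classM //= ?eqxx //.
rewrite letter_mulE mulr1 expr_classM //= ?eqxx //.
by rewrite -[existT _ (tgt al) b]/(tagA b) letter_mulE mul1r.
Qed.

Lemma gen_path_ind (P : L -> Prop) :
  P 0 -> (forall x y, P x -> P y -> P (x + y)) -> (forall c x, P x -> P (c *: x)) ->
  (forall x y, P x -> P y -> P (x * y)) ->
  (forall i (a : A i), P (letter_elt a)) -> (forall al, P (arrow_elt al)) -> forall x, P x.
Proof.
move=> P0 PD PZ PM Pl Pa x; rewrite -(quot_reprK x); move: (quot_repr x) => {}x.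
have [[pl _] _] := quot_pi_hom (mlin_ideal A).
elim/cbasis_ind: x => [|c u x IH]; first by rewrite (lin0 pl).
rewrite pl; apply: PD => //; apply: PZ => {x IH}.
rewrite -expr_val -/(expr_class (val u)); have := valP u.
case: (val u) => x s /= {u}; elim: s x => [|[al y] s IH] x hx.
  by case: x hx => i a _; apply: Pl.
rewrite expr_class_cons //; apply: (PM _ _ (PM _ _ (Pl _ _) (Pa _))).
by apply: IH; case/and3P: hx.
Qed.

Section Universal.
Variable B : algType k.
Variables (phi : forall i, A i -> B) (X : arr G -> B).
Hypothesis phi_mul : forall i, multiplicative_map (@phi i).
Hypothesis phi0 : forall i j (a : A i) (b : A j), i <> j -> phi a * phi b = 0.
Hypothesis phi1 : \sum_i phi (1 : A i) = 1.
Hypothesis phiX : forall al, phi (1 : A (src al)) * X al = X al.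
Hypothesis Xphi : forall al, X al * phi (1 : A (tgt al)) = X al.

Fixpoint tail_value (s : seq (arr G * letter A)) : B :=
  if s is ay :: s' then X ay.1 * (phi (tagged ay.2) * tail_value s') else 1.
Definition expr_value (w : raw) : B := phi (tagged w.1) * tail_value w.2.

Lemma expr_value_mul x s w : tag (last_letter (x, s)) = tag w.1 ->
  expr_value (raw_mul x s w) = expr_value (x, s) * expr_value w.
Proof.
elim: s x => [|[al z] s IH] x /=.
  case: x w => [i a] [[j b] t] /= ij; rewrite /last_letter /= in ij; subst j.
  rewrite /expr_value letter_mulE /= mulr1; have [_ ->] := phi_mul i.
  by rewrite mulrA.
move=> e; rewrite /expr_value /= -!mulrA; congr (_ * (_ * _)).
by have := IH z e; rewrite /expr_value /= => ->; rewrite !mulrA.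
Qed.

Lemma expr_value_end x s : expr_value (x, s) =
  expr_value (x, s) * phi (1 : A (tag (last_letter (x, s)))).
Proof.
elim: s x => [|[al z] s IH] [i a].
  by rewrite /expr_value /= mulr1; have [_ <-] := phi_mul i; rewrite mulr1.
have := IH z; rewrite /expr_value /= => e.
by rewrite -!mulrA (mulrA (phi (tagged z))) -e.
Qed.

(** These are the relations that the quotient imposes. *)
Lemma expr_value_slot C i (c : k) (a b : A i) : slot C ->
  expr_value (C (tagA (c *: a + b))) = c *: expr_value (C (tagA a)) + expr_value (C (tagA b)).
Proof.
have [pl _] := phi_mul i.
case=> [s|x0 s1 al s2]; rewrite /expr_value /=.
  by rewrite pl mulrDl scalerAl.
rewrite scalerAr -mulrDr; congr (_ * _).
elim: s1 => [|ay s1 IH] /=; last by rewrite IH mulrDr -scalerAr mulrDr -scalerAr.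
by rewrite pl mulrDl mulrDr -scalerAl -scalerAr.
Qed.

(** The universal property of generalized path algebras. *)
Lemma gen_path_map : exists f : L -> B,
  [/\ alg_hom f, forall i (a : A i), f (letter_elt a) = phi a &
      forall al, f (arrow_elt al) = X al].
Proof.
pose h (u : mor (expr_category A)) : B := expr_value (val (u : expr A)).
pose f0 : expr_alg A -> B := lin_ext h.
have f0U (u : expr A) : f0 (cbasis k (C := expr_category A) u) = expr_value (val u).
  exact: lin_extU.
have hM (u w : mor (expr_category A)) : cod u = dom w -> h (Defs.comp u w) = h u * h w.
  move=> e; rewrite /h [Defs.comp u w]/(expr_mul u w) val_expr_mul // expr_value_mul.
    by case: (val (u : expr A)).
  have e' : expr_end u = expr_start w := e.
  by move: e'; rewrite /expr_end /expr_start; case: (val (u : expr A)).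
have h0 (u w : mor (expr_category A)) : cod u <> dom w -> h u * h w = 0.
  move=> e; have : expr_end u <> expr_start w := e.
  rewrite /h /expr_end /expr_start.
  case: (val (u : expr A)) (val (w : expr A)) => [x s] [y t] ne.
  rewrite expr_value_end [expr_value (y, t)]/expr_value -mulrA (mulrA (phi (1 : A _))).
  by rewrite phi0 // mul0r mulr0.
have mul0 := cat_alg_map_mul hM h0.
have one0 : f0 1 = 1.
  apply: (cat_alg_map1 hM h0); rewrite -[RHS]phi1; apply: eq_bigr => i _.
  by rewrite /h /expr_value /= mulr1.
have f0E (w : raw) : is_expr w.1 w.2 -> f0 (expr_elt w) = expr_value w.
  by move=> hw; rewrite (expr_eltE hw) f0U.
have [f0l f0M] : multiplicative_map f0 := mul0.
have kill x : mlin_ideal A x -> f0 x = 0.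
  elim=> [|c _ y [C i d a b sC] _ IH]; first exact: lin0.
  rewrite f0l IH addr0 !(linB _ _ f0l) (linZ _ _ f0l).
  have [h1|h1] := boolP (is_expr (C (tagA (0 : A i))).1 (C (tagA (0 : A i))).2).
    have hE x' : is_expr (C (tagA (x' : A i))).1 (C (tagA x')).2.
      by rewrite (@slot_valid _ _ A C _ (tagA (0 : A i)) sC).
    by rewrite !f0E // expr_value_slot // [X in X - _ - _]addrC addrK subrr scaler0.
  have hE x' : expr_elt (C (tagA (x' : A i))) = 0.
    by apply: expr_elt0; rewrite (@slot_valid _ _ A C _ (tagA (0 : A i)) sC).
  by rewrite !hE (lin0 f0l) scaler0 !subr0 scaler0.
have [f fE] := quot_lift f0l kill.
exists f; split.
- split; first exact: quot_lift_mul mul0 fE.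
  have [_ <-] := quot_pi_hom (mlin_ideal A).
  by rewrite fE.
- by move=> i a; rewrite /letter_elt /expr_class fE f0E // /expr_value /= mulr1.
- move=> al; rewrite /arrow_elt /expr_class fE f0E /= ?eqxx //.
  by rewrite /expr_value /= mulr1 Xphi phiX.
Qed.
End Universal.

Lemma letter_elt1_neq0 i : letter_elt (1 : A i) <> 0.
Proof.
have [[pl _] _] := quot_pi_hom (mlin_ideal A).
rewrite -(lin0 pl) /letter_elt /expr_class => /quot_piP.
rewrite subr0 => /(deg0_mlin i).
rewrite (@expr_eltE k G A (tagA (1 : A i), [::]) isT) lin_extU /deg0_letter /= tagged_asE.
by move/eqP; rewrite oner_eq0.
Qed.

End GenPathAlgebra.

(** * Maps from a generalized path algebra to path algebras *)

Section BlowUp.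
Variables (k : fieldType) (G : quiver) (A : vert G -> falgType k).
Variables (S : vert G -> quiver) (I : forall i, ideal (path_alg k (S i))).
Hypothesis adm : forall i, admissible (I i).
Variables (f : forall i, A i -> alg_quot (I i)) (g : forall i, alg_quot (I i) -> A i).
Hypothesis fh : forall i, alg_hom (@f i : A i -> alg_quot (I i)).
Hypothesis fK : forall i, cancel (@f i) (@g i).
Hypothesis gK : forall i, cancel (@g i) (@f i).
Local Notation L := (gen_path_alg A).
Local Notation tagV := (Tagged (fun i => vert (S i))).

Definition local_elt i (x : path_alg k (S i)) : L :=
  letter_elt (g (quot_pi (I i) x)).

Lemma local_elt_mul i : multiplicative_map (@local_elt i).
Proof.
have [[pl pM] _] := quot_pi_hom (I i).
have [[gl gM] _] := alg_hom_inv (fh i) (@fK i) (@gK i).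
split=> [c x y|x y]; rewrite /local_elt; last by rewrite pM gM letter_eltM.
by rewrite pl gl letter_elt_linear.
Qed.

Lemma letter_local i (a : A i) : exists x : path_alg k (S i), letter_elt a = local_elt x.
Proof.
exists (quot_repr (f a)); rewrite /local_elt quot_reprK fK //.
Qed.

Lemma local_elt1 i : local_elt (1 : path_alg k (S i)) = letter_elt (1 : A i).
Proof.
have [_ p1] := quot_pi_hom (I i); have [_ g1] := alg_hom_inv (fh i) (@fK i) (@gK i).
by rewrite /local_elt p1 g1.
Qed.

Lemma local_elt_sum i :
  \sum_(v : vert (S i)) local_elt (vert_elt k v) = letter_elt (1 : A i).
Proof.
have [ll _] := local_elt_mul i.
by rewrite -(lin_sum _ _ _ ll) -local_elt1 sum_vert_elt.
Qed.

Lemma pick_term (B : algType k) (V W : finType) (e : V -> B) (e' : W -> B)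
    (x : V -> W -> B) :
  (forall v w, v <> w -> e v * e w = 0) -> (forall v w, v <> w -> e' v * e' w = 0) ->
  (forall v w, e v * x v w = x v w) -> (forall v w, x v w * e' w = x v w) ->
  forall v w, e v * (\sum_a \sum_b x a b) * e' w = x v w.
Proof.
move=> oe oe' ex xe' v w; rewrite mulr_sumr (bigD1 v) //= [X in _ + X]big1 ?addr0.
  rewrite mulr_sumr mulr_suml (bigD1 w) //= ex xe' big1 ?addr0 // => b /eqP bw.
  by rewrite ex -xe' -mulrA oe' ?mulr0.
move=> a /eqP av; rewrite mulr_sumr big1 // => b _.
by rewrite -ex mulrA oe ?mul0r //; apply/nesym.
Qed.

Section Target.
Variables (B : algType k) (T : finType) (tau : T -> {i : vert G & arr (S i)}).
Variables (e : real_vert S -> B) (xT : T -> B).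
Variable xG : forall al, vert (S (src al)) -> vert (S (tgt al)) -> B.
Hypothesis ee : forall p, e p * e p = e p.
Hypothesis e0 : forall p q, p <> q -> e p * e q = 0.
Hypothesis e1 : \sum_p e p = 1.
Hypothesis exT : forall t, e (tagV (src (tagged (tau t)))) * xT t = xT t.
Hypothesis xTe : forall t, xT t * e (tagV (tgt (tagged (tau t)))) = xT t.
Hypothesis xTT : forall t t', xT t * xT t' = 0.
Hypothesis exG : forall al a b, e (tagV a) * @xG al a b = @xG al a b.
Hypothesis xGe : forall al a b, @xG al a b * e (tagV b) = @xG al a b.

Let theta i (a : arr (S i)) : B :=
  \sum_(t | tau t == Tagged (fun i => arr (S i)) a) xT t.

Lemma theta_vert i : exists h : path_alg k (S i) -> B,
  [/\ multiplicative_map h, forall v, h (vert_elt k v) = e (tagV v),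
      forall a, h (arr_elt k a) = theta a & forall x, I i x -> h x = 0].
Proof.
have [||a|a|h [hm hv ha hp _]] :=
    @path_alg_map k (S i) B (fun v : vert (S i) => e (tagV v)) (@theta i).
- by move=> v; apply: ee.
- by move=> v w vw; apply: e0 => /eqP; rewrite eq_Tagged /= => /eqP.
- rewrite /theta mulr_sumr; apply: eq_bigr => t /eqP te.
  by have := exT t; rewrite te.
- rewrite /theta mulr_suml; apply: eq_bigr => t /eqP te.
  by have := xTe t; rewrite te.
have hl := proj1 hm; have hM := proj2 hm.
exists h; split=> // x Ix.
have [[Gs Glong Igen] _] := adm i.
have {Ix} : ideal_gen Gs x by apply/Igen.
elim=> [y Gy||y z _ hy _ hz|a y _ hy|a y _ hy].
- elim: (Glong y Gy) => {y Gy} [|c _ y [p long ->] _ IH]; first exact: lin0.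
  rewrite hl IH addr0 hp /path_value.
  case: p long => -[v [|a [|b s]]] hw //= _.
  rewrite (mulrA (theta a)) (_ : theta a * theta b = 0) ?mul0r ?mulr0 ?scaler0 //.
  by rewrite /theta mulr_suml big1 // => t _; rewrite mulr_sumr big1.
- exact: lin0.
- by rewrite linD // hy hz addr0.
- by rewrite hM hy mulr0.
- by rewrite hM hy mul0r.
Qed.

(** Vertices go to the idempotents [e], the arrows in [tau] to [xT], all other arrows
   of the quivers [S i] to [0]. Products of two arrows of one [S i] are sent to [0],
   which kills the admissible ideals. An arrow of [G] goes to the sum of its copies. *)
Lemma gen_path_target : exists h : L -> B,
  [/\ alg_hom h, forall i v, h (local_elt (vert_elt k (v : vert (S i)))) = e (tagV v),
      forall i (a : arr (S i)), h (local_elt (arr_elt k a)) = theta a &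
      forall al, h (arrow_elt A al) = \sum_a \sum_b @xG al a b].
Proof.
have /dep_choice [h hP] := theta_vert.
have /dep_choice [h' h'E] i : exists h' : alg_quot (I i) -> B,
    forall x, h' (quot_pi (I i) x) = h i x.
  by have [[hl _] _ _ hI] := hP i; apply: quot_lift.
pose phi i (a : A i) := h' i (f a).
have phi_mul i : multiplicative_map (@phi i).
  have [hm _ _ _] := hP i; have [[fl fM] _] := fh i.
  have [h'l h'M] := quot_lift_mul hm (h'E i).
  by split=> [c x y|x y]; rewrite /phi ?fl ?fM ?h'l ?h'M.
have phiE i x : phi i (g (quot_pi (I i) x)) = h i x by rewrite /phi gK h'E.
have phi1 i : phi i 1 = \sum_(v : vert (S i)) e (tagV v).
  have [[hl _] hv _ _] := hP i; have [_ f1] := fh i.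
  rewrite /phi f1; have [_ <-] := quot_pi_hom (I i); rewrite h'E.
  rewrite -(sum_vert_elt k (S i)) (lin_sum _ _ _ hl).
  by apply: eq_bigr => v _.
have [||al|al|H [Hh HA HX]] :=
    @gen_path_map k G A B phi (fun al => \sum_a \sum_b @xG al a b) phi_mul.
- move=> i j a b ij.
  have -> : phi i a = phi i a * phi i 1 by rewrite -(proj2 (phi_mul i)) mulr1.
  have -> : phi j b = phi j 1 * phi j b by rewrite -(proj2 (phi_mul j)) mul1r.
  rewrite -mulrA (mulrA (phi i 1)) (_ : phi i 1 * phi j 1 = 0) ?mul0r ?mulr0 //.
  rewrite !phi1 mulr_suml big1 // => v _; rewrite mulr_sumr big1 // => w _.
  by apply: e0 => /(congr1 tag).
- rewrite -e1; under eq_bigr do rewrite phi1.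
  by rewrite (sig_big_dep xpredT (fun=> xpredT) (fun i v => e (Tagged (fun i => vert (S i)) v)));
    apply: eq_bigr => -[].
- rewrite phi1 mulr_sumr; apply: eq_bigr => a _; rewrite mulr_sumr.
  apply: eq_bigr => b _; rewrite mulr_suml (bigD1 a) //= exG big1 ?addr0 // => v va.
  rewrite -exG mulrA e0 ?mul0r // => /eqP; rewrite eq_Tagged /=; exact/negP.
- rewrite phi1 mulr_suml; apply: eq_bigr => a _; rewrite mulr_suml.
  apply: eq_bigr => b _; rewrite mulr_sumr (bigD1 b) //= xGe big1 ?addr0 // => v va.
  rewrite -xGe -mulrA e0 ?mulr0 // => /eqP; rewrite eq_Tagged /= eq_sym; exact/negP.
exists H; split=> // [i v|i a].
  apply: etrans (HA _ _) _; apply: etrans (phiE _ _) _.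
  by have [_ hv _ _] := hP i; apply: hv.
apply: etrans (HA _ _) _; apply: etrans (phiE _ _) _.
by have [_ _ ha _] := hP i; apply: ha.
Qed.

End Target.

(** The quiver that keeps all arrows coming from the arrows of [G], and one arrow
   for each element of [T] among the arrows of the quivers [S i]. *)
Section Quotient.
Variables (T : finType) (tau : T -> {i : vert G & arr (S i)}).

Definition blow_arr :=
  (T + {al : arr G & (vert (S (src al)) * vert (S (tgt al)))%type})%type.
Definition blow_src (x : blow_arr) : real_vert S :=
  match x with
  | inl t => tagV (src (tagged (tau t)))
  | inr y => tagV (tagged y).1
  end.
Definition blow_tgt (x : blow_arr) : real_vert S :=
  match x with
  | inl t => tagV (tgt (tagged (tau t)))
  | inr y => tagV (tagged y).2
  end.
Definition blow : quiver := @Quiver (real_vert S) blow_arr blow_src blow_tgt (real_vert_gt0 S).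

Hypothesis tau_inj : injective tau.
Hypothesis tau_sep : forall t t',
  tagV (tgt (tagged (tau t))) <> tagV (src (tagged (tau t'))).

Definition blow_arrow al (a : vert (S (src al))) (b : vert (S (tgt al))) : arr blow :=
  inr (Tagged (fun al => (vert (S (src al)) * vert (S (tgt al)))%type) (a, b) :
    {al : arr G & (vert (S (src al)) * vert (S (tgt al)))%type}).

(** The copies of an arrow of [G] are separated by the idempotents at their ends, so
   each of them lies in the image. *)
Lemma blow_map : exists h : L -> path_alg k blow,
  [/\ alg_hom h,
      forall i v, h (local_elt (vert_elt k (v : vert (S i)))) = vert_elt k (tagV v : vert blow),
      forall al, h (arrow_elt A al) = \sum_a \sum_b arr_elt k (@blow_arrow al a b) &
      forall y, exists x, h x = y].
Proof.
have [||||||||h [hh hv ha hX]] := @gen_path_target (path_alg k blow) T tau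
  (fun p => vert_elt k (p : vert blow)) (fun t => arr_elt k (inl t : arr blow))
  (fun al a b => arr_elt k (@blow_arrow al a b)).
- by move=> p; apply: vert_idem.
- by move=> p q pq; apply: vert_orth.
- exact: (sum_vert_elt k blow).
- by move=> t; apply: (vert_arrM k (inl t : arr blow)).
- by move=> t; apply: (arr_vertM k (inl t : arr blow)).
- by move=> t t'; apply: arr_arr0; apply: tau_sep.
- by move=> al a b; apply: (vert_arrM k (@blow_arrow al a b)).
- by move=> al a b; apply: (arr_vertM k (@blow_arrow al a b)).
exists h; split=> // y.
have [[hl hM] h1] := hh.
elim/path_alg_ind: y => [|y y' [x <-] [x' <-]|c y [x <-]|y y' [x <-] [x' <-]|[i v]|[t|y]].
- by exists 0; apply: lin0.
- by exists (x + x'); apply: linD.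
- by exists (c *: x); apply: linZ.
- by exists (x * x'); apply: hM.
- by exists (local_elt (vert_elt k v)); apply: hv.
- exists (local_elt (arr_elt k (tagged (tau t)))); rewrite ha.
  rewrite (big_pred1 t) // => t'; rewrite /= -(inj_eq tau_inj).
  by case: (tau t).
- case: y => al [a b].
  exists (local_elt (vert_elt k a) * arrow_elt A al * local_elt (vert_elt k b)).
  rewrite !hM !hv hX.
  apply: (@pick_term (path_alg k blow) _ _ (fun a => vert_elt k (tagV a : vert blow))
    (fun b => vert_elt k (tagV b : vert blow)) (fun a b => arr_elt k (@blow_arrow al a b))).
  + by move=> v w vw; apply: vert_orth => /eqP; rewrite eq_Tagged /= => /eqP.
  + by move=> v w vw; apply: vert_orth => /eqP; rewrite eq_Tagged /= => /eqP.
  + by move=> v w; apply: (vert_arrM k (@blow_arrow al v w)).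
  + by move=> v w; apply: (arr_vertM k (@blow_arrow al v w)).
Qed.
End Quotient.
End BlowUp.

Lemma path_elt_neq0 (k : fieldType) (Q : quiver) (p : qpath Q) : path_elt k p <> 0.
Proof.
move/(congr1 (fun x : {malg k[qpath Q]} => x@_p)); rewrite mcoeff0.
rewrite [LHS]mcoeffUU => /eqP; by rewrite oner_eq0.
Qed.

(** * Quivers without arrows *)

(** The generators are combinations of paths of length at least two. *)
Lemma admissible_no_arrow (k : fieldType) (Q : quiver) (I : ideal (path_alg k Q)) :
  admissible I -> (arr Q -> False) -> forall x, I x -> x = 0.
Proof.
move=> [[Gs Glong Igen] _] noarr x /Igen.
elim=> [y Gy||y z _ -> _ ->|a y _ ->|a y _ ->].
- elim: (Glong y Gy) => // c _ z [[[v [|a s]] hw] long ->] //.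
- by [].
- exact: addr0.
- exact: mulr0.
- exact: mul0r.
Qed.

Lemma absorb_l (R : nzRingType) (e x y : R) : e * e = e -> e * (e * x * y) = e * x * y.
Proof. by move=> ee; rewrite !mulrA ee. Qed.

Lemma absorb_r (R : nzRingType) (e x y : R) : e * e = e -> x * y * e * e = x * y * e.
Proof. by move=> ee; rewrite -mulrA ee. Qed.

Lemma commute_mul (R : nzRingType) (x y e : R) :
  x * e = e * x -> y * e = e * y -> x * y * e = e * (x * y).
Proof. by move=> ex ey; rewrite -mulrA ey mulrA ex mulrA. Qed.

Lemma mul_through_l (R : nzRingType) (e x y : R) : e * x = x -> y * x = y * e * x.
Proof. by move=> ex; rewrite -mulrA ex. Qed.

Lemma mul_through_r (R : nzRingType) (e x y : R) : x * e = x -> x * y = x * (e * y).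
Proof. by move=> xe; rewrite mulrA xe. Qed.

Section NoArrows.
Variables (k : fieldType) (G : quiver) (A : vert G -> falgType k).
Variables (S : vert G -> quiver) (I : forall i, ideal (path_alg k (S i))).
Hypothesis adm : forall i, admissible (I i).
Hypothesis pres : forall i, alg_iso (A i) (alg_quot (I i)).
Hypothesis noarr : forall i, arr (S i) -> False.

(** If the quivers [S i] have no arrows, then [blow_map] loses nothing: the vertices
   and arrows of the realization have counterparts in the generalized path algebra,
   and the universal property of the path algebra yields the inverse. *)
Lemma no_arrow_iso : alg_iso (gen_path_alg A) (path_alg k (real_quiver S)).
Proof.
have /dep_choice [f fP] i : exists f : A i -> alg_quot (I i), alg_hom f /\ bijective f.
  by apply/alg_iso_hom.
have /dep_choice [g gP] i : exists g, cancel (f i) g /\ cancel g (f i).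
  by have [_ [g fK gK]] := fP i; exists g.
have fh i := proj1 (fP i); have fK i := proj1 (gP i); have gK i := proj2 (gP i).
pose T := {i : vert G & arr (S i)}.
have [||h [hh hv ha hs]] := @blow_map k G A S I adm f g fh gK T id.
- by [].
- by move=> [i a]; case: (noarr a).
pose le i (x : path_alg k (S i)) : gen_path_alg A := local_elt g x.
have lm i : multiplicative_map (@le i) by apply: local_elt_mul.
have ll i := proj1 (lm i); have lM i := proj2 (lm i).
pose E (p : vert (real_quiver S)) : gen_path_alg A := le (tag p) (vert_elt k (tagged p)).
pose X (x : arr (real_quiver S)) : gen_path_alg A :=
  match x with
  | inl _ => 0
  | inr y => le _ (vert_elt k (tagged y).1) * arrow_elt A (tag y) * le _ (vert_elt k (tagged y).2)
  end.
have EE p : E p * E p = E p.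
  by rewrite /E -lM; congr (le _ _); apply: vert_idem.
have E0 p q : p <> q -> E p * E q = 0.
  case: p q => i v [j w] ne; rewrite /E /=.
  have [ij|/eqP ij] := eqVneq i j; last exact: letter_elt_neq.
  subst j; rewrite -lM (_ : vert_elt k v * vert_elt k w = 0); first exact: lin0.
  by apply: vert_orth => vw; apply: ne; rewrite vw.
have [||psi [[psl psM] psv psa _ _]] := @path_alg_map k (real_quiver S) _ E X EE E0.
- case=> [[i a]|[al [v w]]]; first by case: (noarr a).
  exact: absorb_l (EE (Tagged (fun i => vert (S i)) v)).
- case=> [[i a]|[al [v w]]]; first by case: (noarr a).
  exact: absorb_r (EE (Tagged (fun i => vert (S i)) w)).
have [[hl hM] _] := hh.
have hK : cancel h psi.
  elim/gen_path_ind => [|x y ex ey|c x ex|x y ex ey|i a|al].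
  - by rewrite (lin0 hl) (lin0 psl).
  - by rewrite (linD _ _ hl) (linD _ _ psl) ex ey.
  - by rewrite (linZ _ _ hl) (linZ _ _ psl) ex.
  - by rewrite hM psM ex ey.
  - have [x ->] := letter_local fK a; rewrite -/(le i x).
    elim/path_alg_ind: x => [|x y ex ey|c x ex|x y ex ey|v|b].
    + by rewrite (lin0 (ll i)) (lin0 hl) (lin0 psl).
    + by rewrite (linD _ _ (ll i)) (linD _ _ hl) (linD _ _ psl) ex ey.
    + by rewrite (linZ _ _ (ll i)) (linZ _ _ hl) (linZ _ _ psl) ex.
    + by rewrite lM hM psM ex ey.
    + apply: etrans (congr1 psi (hv i v)) _; exact: psv.
    + by case: (noarr b).
  - rewrite ha (lin_sum _ _ _ psl) -[RHS]arrow_eltl -[X in _ * X]arrow_eltr.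
    rewrite -!(local_elt_sum fh fK gK) mulr_suml; apply: eq_bigr => v _.
    rewrite (lin_sum _ _ _ psl) mulr_sumr mulr_sumr; apply: eq_bigr => w _.
    by rewrite mulrA; apply: psa.
apply/alg_iso_hom; exists h; split=> //; exists psi => // y.
by have [x <-] := hs y; rewrite hK.
Qed.

Lemma no_arrow_ideal x : real_ideal I x -> x = 0.
Proof.
elim=> [y [i [z [Iz ->]]]||y z _ -> _ ->|a y _ ->|a y _ ->].
- rewrite (admissible_no_arrow (adm i) (@noarr i) Iz).
  exact: raddf0.
- by [].
- exact: addr0.
- exact: mulr0.
- exact: mul0r.
Qed.

End NoArrows.

(** * Indecomposable generalized path algebras have connected quivers *)

Section CentralIdempotent.
Variables (k : fieldType) (A : algType k) (e : A).
Hypothesis ee : e * e = e.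
Hypothesis central : forall x, x * e = e * x.
Hypothesis e_neq0 : e <> 0.

Lemma annihilator_D x y : x * e = 0 -> y * e = 0 -> (x + y) * e = 0.
Proof. by rewrite mulrDl => -> ->; rewrite addr0. Qed.
Lemma annihilator_Ml a x : x * e = 0 -> a * x * e = 0.
Proof. by rewrite -mulrA => ->; rewrite mulr0. Qed.
Lemma annihilator_Mr a x : x * e = 0 -> x * a * e = 0.
Proof. by move=> xe; rewrite -mulrA central mulrA xe mul0r. Qed.
Lemma annihilator_1 : ~ 1 * e = 0.
Proof. by rewrite mul1r. Qed.

Definition annihilator : ideal A :=
  @Ideal k A (fun x => x * e = 0) (mul0r e) annihilator_D annihilator_Ml annihilator_Mr
    annihilator_1.
End CentralIdempotent.

(** The factors are the quotients by the annihilators of [e] and of [1 - e]. *)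
Lemma central_idem_decomposable (k : fieldType) (A : algType k) (e : A) :
  e * e = e -> (forall x, x * e = e * x) -> e <> 0 -> e <> 1 -> ~ alg_indecomposable A.
Proof.
move=> ee ce e0 e1 ind.
have ce' x : x * (1 - e) = (1 - e) * x by rewrite mulrBr mulrBl mulr1 mul1r ce.
have e0' : 1 - e <> 0 by move/eqP; rewrite subr_eq0 eq_sym => /eqP.
pose I := annihilator ce e0; pose J := annihilator ce' e0'.
apply: (ind (alg_quot I) (alg_quot J)).
have [[pl pM] p1] := quot_pi_hom I; have [[ql qM] q1] := quot_pi_hom J.
apply/alg_iso_hom; exists (fun x => (quot_pi I x, quot_pi J x)); split.
  split; last by rewrite p1 q1.
  by split=> [c x y|x y]; rewrite ?pl ?ql ?pM ?qM.
exists (fun z => quot_repr z.1 * e + quot_repr z.2 * (1 - e)) => [x|[y z]] /=.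
  have h1 : quot_repr (quot_pi I x) * e = x * e.
    by apply/eqP; rewrite -subr_eq0 -mulrBl; apply/eqP; apply: (@quot_pi_repr k A I).
  have h2 : quot_repr (quot_pi J x) * (1 - e) = x * (1 - e).
    by apply/eqP; rewrite -subr_eq0 -mulrBl; apply/eqP; apply: (@quot_pi_repr k A J).
  by rewrite h1 h2 -mulrDr addrC subrK mulr1.
have ef : e * (1 - e) = 0 by rewrite mulrBr mulr1 ee subrr.
have fe : (1 - e) * e = 0 by rewrite mulrBl mul1r ee subrr.
have ff : (1 - e) * (1 - e) = 1 - e by rewrite mulrBr mulr1 fe subr0.
congr pair.
  rewrite -[RHS](quot_reprK y); apply/quot_piP.
  rewrite /= mulrBl mulrDl -!mulrA fe ee mulr0 addr0 subrr //.
rewrite -[RHS](quot_reprK z); apply/quot_piP.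
by rewrite /= mulrBl mulrDl -!mulrA ef ff mulr0 add0r subrr.
Qed.

Definition cut_connected (Q : quiver) : Prop :=
  forall U : {set vert Q}, (exists i, i \in U) -> (exists j, j \notin U) ->
    exists a : arr Q, (src a \in U) != (tgt a \in U).

(** A cut without arrows gives a central idempotent. *)
Lemma indecomposable_connected (k : fieldType) (G : quiver) (A : vert G -> falgType k) :
  alg_indecomposable (gen_path_alg A) -> cut_connected G.
Proof.
move=> ind U [i0 i0U] [j0 j0U]; apply: contrapT => nocut.
have same (a : arr G) : (src a \in U) = (tgt a \in U).
  by apply/eqP; apply: contrapT => /negP h; apply: nocut; exists a.
pose e : gen_path_alg A := \sum_(i in U) letter_elt (1 : A i).
have el i (a : A i) : e * letter_elt a = if i \in U then letter_elt a else 0.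
  rewrite /e mulr_suml; case: ifP => iU.
    rewrite (bigD1 i) //= letter_eltM mul1r big1 ?addr0 // => j /andP [_ /eqP ji].
    exact: letter_elt_neq.
  by rewrite big1 // => j jU; apply: letter_elt_neq => ji; subst j; rewrite jU in iU.
have le i (a : A i) : letter_elt a * e = if i \in U then letter_elt a else 0.
  rewrite /e mulr_sumr; case: ifP => iU.
    rewrite (bigD1 i) //= letter_eltM mulr1 big1 ?addr0 // => j /andP [_ /eqP ji].
    by apply: letter_elt_neq => ij; apply: ji.
  by rewrite big1 // => j jU; apply: letter_elt_neq => ji; subst j; rewrite jU in iU.
have ce x : x * e = e * x.
  elim/gen_path_ind: x => [|x y ex ey|c x ex|x y ex ey|i a|al].
  - by rewrite mul0r mulr0.
  - by rewrite mulrDl mulrDr ex ey.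
  - by rewrite -scalerAl -scalerAr ex.
  - exact: commute_mul ex ey.
  - by rewrite el le.
  - have := le _ (1 : A (tgt al)); have := el _ (1 : A (src al)); rewrite same.
    case: ifP => _ e1 e2.
      by rewrite (mul_through_r _ (arrow_eltr A al)) e2 (mul_through_l _ (arrow_eltl A al)) e1
        arrow_eltl arrow_eltr.
    by rewrite (mul_through_r _ (arrow_eltr A al)) e2 (mul_through_l _ (arrow_eltl A al)) e1
      mul0r mulr0.
apply: (@central_idem_decomposable k _ e) => //.
- rewrite {2}/e mulr_sumr; apply: eq_bigr => i iU; by rewrite el iU.
- move=> e0; apply: (@letter_elt1_neq0 k G A i0).
  by have := el i0 1; rewrite i0U e0 mul0r => <-.
- move=> e1; apply: (@letter_elt1_neq0 k G A j0).
  by have := el j0 1; rewrite (negPf j0U) e1 mul1r.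
Qed.

(** * Powers of the ground field *)

Section Powers.
Variable k : fieldType.

(** The powers are nested products; coordinates treat all of them alike. *)
Lemma kpow_coord l : exists c : kpow k l.+1 -> nat -> k,
  [/\ forall a x y j, c (a *: x + y) j = a * c x j + c y j,
      forall x y j, c (x * y) j = c x j * c y j, forall j, c 1 j = 1,
      forall x y, (forall j, (j < l.+1)%N -> c x j = c y j) -> x = y &
      forall u : nat -> k, exists x, forall j, (j < l.+1)%N -> c x j = u j].
Proof.
elim: l => [|l [c [cl cM c1 cinj csurj]]].
  exists (fun x _ => x); split=> // [x y e|u]; first exact: (e 0%N).
  by exists (u 0%N); case.
exists (fun x j => if j is j'.+1 then c x.2 j' else x.1); split.
- by move=> a x y [|j] //=; apply: cl.
- by move=> x y [|j] //=; apply: cM.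
- by case=> [|j] //=; apply: c1.
- move=> [x x'] [y y'] e; congr pair; first exact: (e 0%N).
  by apply: cinj => j jl; apply: (e j.+1).
- move=> u; have [x xE] := csurj (fun j => u j.+1).
  by exists (u 0%N, x) => -[|j] //= jl; apply: xE.
Qed.

Lemma kpow_comm l (x y : kpow k l.+1) : x * y = y * x.
Proof.
have [c [_ cM _ cinj _]] := kpow_coord l.
by apply: cinj => j _; rewrite !cM mulrC.
Qed.

Lemma comm_of_inj (R S : nzRingType) (f : R -> S) :
  (forall x y, f (x * y) = f x * f y) -> injective f ->
  (forall u v : S, u * v = v * u) -> forall x y : R, x * y = y * x.
Proof. by move=> fM fi c x y; apply: fi; rewrite !fM c. Qed.

Lemma corner_comm0 (R : nzRingType) (x e e' : R) : (forall x y : R, x * y = y * x) ->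
  e * x = x -> x * e' = x -> e * e' = 0 -> x = 0.
Proof. by move=> c ex xe ee; rewrite -ex -xe [x * e']c mulrA ee mul0r. Qed.

Lemma kpow_inj m l : alg_iso (kpow k m.+1) (kpow k l.+1) -> (m <= l)%N.
Proof.
move=> /alg_iso_hom [f [[[fl _] _] fb]].
have [c [cl _ _ cinj csurj]] := kpow_coord m.
have [c' [cl' _ _ cinj' _]] := kpow_coord l.
have c0 j : c 0 j = 0.
  by have := cl (-1) 0 0 j; rewrite scaler0 addr0 mulN1r addNr.
have c'0 j : c' 0 j = 0.
  by have := cl' (-1) 0 0 j; rewrite scaler0 addr0 mulN1r addNr.
have csum (T : finType) (u : T -> k) (x : T -> kpow k m.+1) j :
    c (\sum_t u t *: x t) j = \sum_t u t * c (x t) j.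
  apply: (big_rec2 (fun y z => c y j = z)) => // t y z _ <-.
  exact: cl.
have c'sum (T : finType) (u : T -> k) (x : T -> kpow k l.+1) j :
    c' (\sum_t u t *: x t) j = \sum_t u t * c' (x t) j.
  apply: (big_rec2 (fun y z => c' y j = z)) => // t y z _ <-.
  exact: cl'.
have /choice [x xE] i : exists x, forall j, (j < m.+1)%N -> c x j = (j == i)%:R.
  exact: csurj.
rewrite leqNgt; apply/negP => lt.
have [|u [[i ni] us]] := @lin_sys_sol k 'I_m.+1 'I_l.+1 (fun i j => c' (f (x i)) j).
  by rewrite !card_ord.
apply: ni; have f0 : f (\sum_i u i *: x i) = 0.
  rewrite (lin_sum _ _ _ fl); apply: cinj' => j jl; rewrite c'0.
  rewrite (eq_bigr (fun i => u i *: f (x i))) => [|t _]; last exact: linZ.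
  by rewrite c'sum; apply: (us (Ordinal jl)).
have : \sum_i u i *: x i = 0.
  by apply: (bij_inj fb); rewrite f0 (lin0 fl).
move/(congr1 (fun y => c y i)); rewrite c0 csum (bigD1 i) //= xE // eqxx mulr1.
rewrite big1 ?addr0 // => t ti; rewrite xE // (_ : _ == _ = false) ?mulr0 //.
by apply/negbTE; rewrite eq_sym.
Qed.

Lemma kpow_of_idem (D : algType k) (V : finType) (l : nat) (e : V -> D) :
  #|V| = l.+1 -> (forall v, e v * e v = e v) -> (forall v w, v <> w -> e v * e w = 0) ->
  \sum_v e v = 1 -> (forall x, exists c : V -> k, x = \sum_v c v *: e v) ->
  (forall c : V -> k, \sum_v c v *: e v = 0 -> forall v, c v = 0) ->
  alg_iso (kpow k l.+1) D.
Proof.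
move=> cV ee e0 e1 sp fr; have [c [cl cM c1 cinj csurj]] := kpow_coord l.
have lt (v : V) : (enum_rank v < l.+1)%N by rewrite -cV.
apply/alg_iso_hom; exists (fun x => \sum_v c x (enum_rank v) *: e v); split.
  split; [split=> [a x y|x y]|].
  - rewrite scaler_sumr -big_split; apply: eq_bigr => v _ /=.
    by rewrite cl scalerDl scalerA.
  - rewrite mulr_suml; apply: eq_bigr => v _; rewrite mulr_sumr (bigD1 v) //= big1.
      by rewrite addr0 cM -scalerAl -scalerAr scalerA ee.
    by move=> w /eqP wv; rewrite -scalerAl -scalerAr e0 ?scaler0 //; apply/nesym.
  - by rewrite -[RHS]e1; apply: eq_bigr => v _; rewrite c1 scale1r.
pose u (a : V -> k) (j : nat) := if insub j is Some i then a (enum_val (cast_ord (esym cV) i)) else 0.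
have uE a v : u a (enum_rank v) = a v.
  rewrite /u; case: insubP => [i _ iv|]; last by rewrite lt.
  by congr (a _); apply: enum_rank_inj; rewrite enum_valK; apply: val_inj.
have /choice [g gE] y : exists x, \sum_v c x (enum_rank v) *: e v = y.
  have [a ->] := sp y; have [x xE] := csurj (u a).
  by exists x; apply: eq_bigr => v _; rewrite xE // uE.
exists g => // x; apply: cinj => j jl.
have jl' : (j < #|V|)%N by rewrite cV.
have -> : j = enum_rank (enum_val (Ordinal jl')) by rewrite enum_valK.
apply/eqP; rewrite -subr_eq0; apply/eqP.
apply: (fr (fun v => c (g (\sum_v c x (enum_rank v) *: e v)) (enum_rank v) - c x (enum_rank v))).
under eq_bigr do rewrite scalerBl.
by rewrite sumrB gE subrr.
Qed.

End Powers.

Section LocalAlgebras.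
Variables (k : fieldType) (Q : quiver) (I : ideal (path_alg k Q)).
Hypothesis adm : admissible I.

Lemma no_arrow_kpow l : (arr Q -> False) -> #|vert Q| = l.+1 ->
  alg_iso (kpow k l.+1) (alg_quot I).
Proof.
move=> noarr cV; have [[pl pM] p1] := quot_pi_hom I.
have I0 := admissible_no_arrow adm noarr.
apply: (@kpow_of_idem k (alg_quot I) (vert Q) l (fun v => quot_pi I (vert_elt k v))) => //.
- by move=> v; rewrite -pM; congr (quot_pi I _); apply: vert_idem.
- move=> v w vw; rewrite -pM (_ : vert_elt k v * vert_elt k w = 0).
    exact: lin0.
  exact: vert_orth.
- by rewrite -(lin_sum _ _ _ pl) -p1; congr (quot_pi I _); apply: sum_vert_elt.
- move=> x; rewrite -(quot_reprK x); move: (quot_repr x) => {}x.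
  elim/path_lin_ind: x => [|c [[v [|a s]] hw] x [b bE]].
  + by exists (fun=> 0); rewrite (lin0 pl) big1 // => v _; rewrite scale0r.
  + exists (fun w => c * (w == v)%:R + b w).
    have -> : exist _ (v, [::]) hw = path_id v :> qpath Q by apply: val_inj.
    rewrite pl bE.
    exact: (scale_sum_delta (fun v => quot_pi I (vert_elt k v)) c b v).
  + by case: (noarr a).
move=> c c0 v.
have : \sum_v c v *: vert_elt k v = 0.
  apply: I0; rewrite -[X in I X]subr0; apply/quot_piP; rewrite (lin0 pl) -[RHS]c0.
  by rewrite (lin_sum _ _ _ pl); apply: eq_bigr => w _; apply: linZ.
have [||a|a|h [[hl _] hv _ _ _]] := @path_alg_map k Q (k^o : algType k)
    (fun w => (w == v)%:R : k^o) (fun=> 0).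
- by move=> w; case: eqP => _; rewrite ?mulr1 ?mulr0.
- move=> w w' ww; case: (w =P v) => [wv|]; last by rewrite mul0r.
  by case: (w' =P v) => [wv'|]; [case: ww; rewrite wv wv'|rewrite mulr0].
- exact: mulr0.
- exact: mul0r.
move/(congr1 h); rewrite (lin0 hl) (lin_sum _ _ _ hl) (bigD1 v) //= big1 => [|w wv].
  by rewrite addr0 linZ // hv eqxx => <-; rewrite [RHS]mulr1.
by rewrite linZ // hv (negPf wv) [LHS]mulr0.
Qed.

Hypothesis noloop : forall a : arr Q, src a <> tgt a.

(** In a commutative quotient an arrow [a] of the quiver, being the product of
   its two distinct end vertices and itself in any order, vanishes; but no
   arrow lies in an admissible ideal. *)
Lemma kpow_no_arrow l : alg_iso (alg_quot I) (kpow k l.+1) -> arr Q -> False.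
Proof.
move=> /alg_iso_hom [f [[[fl fM] f1] fb]] a.
have comm := comm_of_inj fM (bij_inj fb) (@kpow_comm k l).
have [[pl pM] p1] := quot_pi_hom I.
have pa : quot_pi I (arr_elt k a) = 0.
  have e1 : quot_pi I (vert_elt k (src a)) * quot_pi I (arr_elt k a) = quot_pi I (arr_elt k a).
    by rewrite -pM; congr (quot_pi I _); apply: vert_arrM.
  have e2 : quot_pi I (arr_elt k a) * quot_pi I (vert_elt k (tgt a)) = quot_pi I (arr_elt k a).
    by rewrite -pM; congr (quot_pi I _); apply: arr_vertM.
  have e3 : quot_pi I (vert_elt k (src a)) * quot_pi I (vert_elt k (tgt a)) = 0.
    rewrite -pM (_ : vert_elt k (src a) * vert_elt k (tgt a) = 0); first exact: lin0.
    exact: vert_orth (@noloop a).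
  exact: corner_comm0 comm e1 e2 e3.
have {pa} : I (arr_elt k a).
  by rewrite -[X in I X]subr0; apply/quot_piP; rewrite pa (lin0 pl).
pose Q1 := @Quiver (vert Q) unit (fun=> src a) (fun=> tgt a) (vert_gt0 Q).
have [||b|b|h [[hl hM] _ ha hp _]] := @path_alg_map k Q (path_alg k Q1)
    (fun v => vert_elt k (v : vert Q1))
    (fun b => if b == a then arr_elt k (tt : arr Q1) else 0).
- by move=> v; apply: vert_idem.
- by move=> v w vw; apply: vert_orth.
- by case: eqP => [->|_]; [apply: (vert_arrM k (tt : arr Q1))|apply: mulr0].
- by case: eqP => [->|_]; [apply: (arr_vertM k (tt : arr Q1))|apply: mul0r].
have X0 b c : (if b == a then arr_elt k (tt : arr Q1) else 0) *
    (if c == a then arr_elt k (tt : arr Q1) else 0) = 0.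
  case: eqP => _; last exact: mul0r.
  case: eqP => _; last exact: mulr0.
  by apply: (arr_arr0 k (a := tt : arr Q1) (b := tt : arr Q1)); apply/nesym/noloop.
have [[Gs Glong Igen] _] := adm.
move/Igen => Ia; have : h (arr_elt k a) = 0.
  elim: Ia => [y Gy||y z _ hy _ hz|b y _ hy|b y _ hy].
  - elim: (Glong y Gy) => {y Gy} [|c _ y [p long ->] _ IH]; first exact: lin0.
    rewrite hl IH addr0 hp /path_value.
    case: p long => -[v [|b [|b' s]]] hw //= _.
    by rewrite (mulrA (if b == a then _ else _)) X0 mul0r mulr0 scaler0.
  - exact: lin0.
  - by rewrite linD // hy hz addr0.
  - by rewrite hM hy mulr0.
  - by rewrite hM hy mul0r.
by rewrite ha eqxx; apply: path_elt_neq0.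
Qed.

Lemma kpow_card l : alg_iso (alg_quot I) (kpow k l.+1) -> #|vert Q| = l.+1.
Proof.
move=> h; have noarr := kpow_no_arrow h.
case cV : #|vert Q| => [|m]; first by have := vert_gt0 Q; rewrite cV.
have h' := no_arrow_kpow noarr cV.
congr S; apply/eqP; rewrite eqn_leq.
by rewrite (kpow_inj (alg_iso_trans h' h)) (kpow_inj (alg_iso_sym (alg_iso_trans h' h))).
Qed.

End LocalAlgebras.

Local Close Scope ring_scope.

(** * Tests for positivity of the Tits form *)

Section NeighbourSums.
Variable Q : quiver.
Implicit Types (x y : vert Q -> nat) (i j : vert Q).

(** The derivative of the Tits form at [y] in the direction [i] is
   [2 * y i - nbr_sum y i]. *)
Definition nbr_sum y i : nat :=
  \sum_(a : arr Q) ((src a == i) * y (tgt a) + (tgt a == i) * y (src a)).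

Lemma nbr_sum_pair x y :
  \sum_i x i * nbr_sum y i = \sum_(a : arr Q) (x (src a) * y (tgt a) + x (tgt a) * y (src a)).
Proof.
rewrite /nbr_sum; under eq_bigr do rewrite big_distrr /=.
rewrite exchange_big; apply: eq_bigr => a _ /=.
under eq_bigr do rewrite mulnDr.
rewrite big_split /=; congr (_ + _).
  rewrite (bigD1 (src a)) //= eqxx mul1n big1 ?addn0 // => i.
  by rewrite eq_sym => /negPf ->; rewrite mul0n muln0.
rewrite (bigD1 (tgt a)) //= eqxx mul1n big1 ?addn0 // => i.
by rewrite eq_sym => /negPf ->; rewrite mul0n muln0.
Qed.

Lemma num_edges_sum i j : num_edges i j =
  \sum_(a : arr Q) ((src a == i) && (tgt a == j) || (src a == j) && (tgt a == i)).
Proof. by rewrite /num_edges -sum1_card big_mkcond; apply: eq_bigr => a _; rewrite inE; case: (_ || _). Qed.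

Lemma num_edges_sym i j : num_edges i j = num_edges j i.
Proof. by apply: eq_card => a; rewrite !inE orbC. Qed.

Lemma nbr_sum_ge y i : \sum_j num_edges i j * y j <= nbr_sum y i.
Proof.
rewrite /nbr_sum; under eq_bigr do rewrite num_edges_sum big_distrl /=.
rewrite exchange_big; apply: leq_sum => a _ /=.
apply: leq_trans (_ : \sum_j ((src a == i) * ((tgt a == j) * y j) +
    (tgt a == i) * ((src a == j) * y j)) <= _).
  apply: leq_sum => j _.
  by case: (src a == i); case: (tgt a == j); case: (src a == j); case: (tgt a == i) => //=; lia.
have pick v : \sum_j (v == j) * y j = y v.
  rewrite (bigD1 v) //= eqxx mul1n big1 ?addn0 // => j.
  by rewrite eq_sym => /negPf ->.
by rewrite big_split /= -!big_distrr /= !pick.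
Qed.

Lemma nbr_sumE y i : (forall j, num_edges j j = 0) ->
  nbr_sum y i = \sum_j num_edges i j * y j.
Proof.
move=> noloop; apply/eqP; rewrite eqn_leq nbr_sum_ge andbT.
rewrite /nbr_sum; under [X in _ <= X]eq_bigr do rewrite num_edges_sum big_distrl /=.
rewrite [X in _ <= X]exchange_big; apply: leq_sum => a _ /=.
have ne : src a != tgt a.
  apply: contra_eqN (noloop (src a)) => /eqP e; rewrite -lt0n.
  by apply/card_gt0P; exists a; rewrite !inE -e eqxx.
have [e1|e1] := eqVneq (src a) i.
  subst i; rewrite (eq_sym (tgt a)) (negPf ne) mul1n mul0n addn0.
  by rewrite (bigD1 (tgt a)) //= eqxx mul1n leq_addr.
rewrite mul0n add0n; have [e2|_] := eqVneq (tgt a) i; last by rewrite mul0n.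
subst i; rewrite mul1n (bigD1 (src a)) //=.
by rewrite !eqxx /= mul1n leq_addr.
Qed.

End NeighbourSums.

(** The Tits form of a quiver in which the vertex [i] is replaced by [mult i]
   copies, on vectors with value [x i] on [m i] of these copies. *)
Definition positive_mult (Q : quiver) (mult : vert Q -> nat) : Prop :=
  forall x m : vert Q -> nat, (forall i, m i <= mult i) ->
    (exists i, (0 < m i) && (0 < x i)) ->
    \sum_(a : arr Q) (m (src a) * x (src a)) * (m (tgt a) * x (tgt a)) <
    \sum_i m i * (x i * x i).

Lemma wpos_mult (Q : quiver) : weakly_positive Q -> positive_mult (fun _ : vert Q => 1).
Proof.
move=> wpos x m m1 [i /andP [mi xi]].
have := wpos (fun i => m i * x i); rewrite (eq_bigr (fun i => m i * (x i * x i))).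
  by apply; exists i => /eqP; rewrite muln_eq0; case: (m i) mi; case: (x i) xi.
by move=> j _; case: (m j) (m1 j) => [|[|n]]; rewrite ?mul0n ?mul1n.
Qed.

Section CriticalVectors.
Variables (Q : quiver) (mult : vert Q -> nat).
Hypothesis pos : positive_mult mult.

(** A vector on which the gradient is nonpositive in the directions of its
   support has nonpositive value; all the null vectors of extended Dynkin graphs
   arise in this way. *)
Lemma no_critical (x m : vert Q -> nat) : (forall i, m i <= mult i) ->
  (exists i, (0 < m i) && (0 < x i)) ->
  ~ forall i, 0 < m i -> 0 < x i -> 2 * x i <= nbr_sum (fun j => m j * x j) i.
Proof.
move=> mm ex crit; have := pos mm ex; rewrite ltnNge => /negP; apply.
rewrite -(leq_pmul2l (m := 2)) //.
have -> : 2 * (\sum_(a : arr Q) (m (src a) * x (src a)) * (m (tgt a) * x (tgt a))) =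
    \sum_i (m i * x i) * nbr_sum (fun j => m j * x j) i.
  rewrite nbr_sum_pair big_distrr; apply: eq_bigr => a _ /=; lia.
rewrite big_distrr; apply: leq_sum => i _ /=.
case m0 : (m i) => [|mi]; first by rewrite mul0n.
case x0 : (x i) => [|xi]; first by rewrite mul0n muln0.
have := crit i; rewrite m0 x0 => /(_ isT isT) h; nia.
Qed.

Definition adj (i j : vert Q) : bool := 0 < num_edges i j.

Lemma adj_sym i j : adj i j = adj j i.
Proof. by rewrite /adj num_edges_sym. Qed.

Lemma nbr_sum_seq (y : vert Q -> nat) i (s : seq (vert Q)) : uniq s -> all (adj i) s ->
  \sum_(j <- s) y j <= nbr_sum y i.
Proof.
move=> us hs; apply: leq_trans (nbr_sum_ge y i).
rewrite big_uniq //= [X in _ <= X](bigID (mem s)) /=.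
apply: leq_trans (leq_addr _ _); apply: leq_sum => j js.
by have := allP hs j js; rewrite /adj; case: (num_edges i j) => // n _; rewrite mulSn leq_addr.
Qed.

(** The same test for a vector supported on a list of vertices, with the weights
   and the multiplicities given by position. *)
Lemma no_critical_seq (x0 : vert Q) (q : seq (vert Q)) (W M : nat -> nat) :
  uniq q -> (forall t, t < size q -> M t <= mult (nth x0 q t)) ->
  (exists t, [&& t < size q, 0 < M t & 0 < W t]) ->
  (forall t, t < size q -> 0 < M t -> 0 < W t ->
     exists l : seq nat, [/\ uniq l,
       all (fun s => (s < size q) && adj (nth x0 q t) (nth x0 q s)) l &
       2 * W t <= \sum_(s <- l) M s * W s]) -> False.
Proof.
move=> uq hM [t0 /and3P [t0q M0 W0]] crit.
pose x v := if v \in q then W (index v q) else 0.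
pose m v := if v \in q then M (index v q) else 0.
have xn t : t < size q -> x (nth x0 q t) = W t.
  by move=> tq; rewrite /x mem_nth // index_uniq.
have mn t : t < size q -> m (nth x0 q t) = M t.
  by move=> tq; rewrite /m mem_nth // index_uniq.
apply: (@no_critical x m) => [v||v].
- by rewrite /m; case: ifP => // vq; rewrite -{2}(nth_index x0 vq) hM // index_mem.
- by exists (nth x0 q t0); rewrite xn // mn // M0.
rewrite {1}/m; case: ifP => // vq; set t := index v q.
have tq : t < size q by rewrite index_mem.
have ve : v = nth x0 q t by rewrite nth_index.
rewrite {1 2}ve xn // => Mt Wt; have [l [ul /allP hl le]] := crit t tq Mt Wt.
apply: leq_trans le _; rewrite (eq_big_seq (fun s => m (nth x0 q s) * x (nth x0 q s))).
  rewrite -(big_map (nth x0 q) xpredT (fun v => m v * x v)).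
  apply: nbr_sum_seq.
    rewrite map_inj_in_uniq // => s s' /hl /andP [sq _] /hl /andP [sq' _] /eqP.
    by rewrite nth_uniq // => /eqP.
  by apply/allP => _ /mapP [s /hl /andP [_ ast] ->]; rewrite ve.
by move=> s /hl /andP [sq _]; rewrite xn // mn.
Qed.

Lemma positive_no_loop i : 0 < mult i -> num_edges i i = 0.
Proof.
move=> mi; apply/eqP; rewrite -leqn0 leqNgt; apply/negP => /card_gt0P [a].
rewrite !inE orbb => /andP [/eqP sa /eqP ta].
apply: (@no_critical (fun j => (j == i : nat)) (fun j => (j == i : nat))).
- by move=> j; case: eqP => // ->.
- by exists i; rewrite eqxx.
move=> j; case: eqP => // -> _ _; rewrite /nbr_sum (bigD1 a) //= sa ta eqxx.
by rewrite -[2 * _]/(1 + 1) leq_addr.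
Qed.

(** A double edge carries the null vector of the Kronecker quiver. *)
Lemma positive_simple i j : (forall v, 0 < mult v) -> num_edges i j = adj i j.
Proof.
move=> m1; apply/eqP; rewrite /adj; case: ltnP => [lt|]; last by rewrite leqn0.
rewrite eqn_leq lt andbT leqNgt; apply/negP => gt1.
have ij : i != j by apply: contraTneq gt1 => ->; rewrite positive_no_loop.
pose d v : nat := (v == i) || (v == j).
apply: (@no_critical d d).
- by move=> v; rewrite /d; case: orb.
- by exists i; rewrite /d eqxx.
have le v w : (v == i) && (w == j) || (v == j) && (w == i) -> 2 <= nbr_sum (fun u => d u * d u) v.
  move=> vw; apply: leq_trans (nbr_sum_ge _ _); rewrite (bigD1 w) //=.
  apply: leq_trans (leq_addr _ _).
  case/orP: vw => /andP [/eqP -> /eqP ->]; rewrite /d eqxx ?orbT muln1 //.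
  by rewrite num_edges_sym.
move=> v _; rewrite {1}/d; case: (eqVneq v i) => [-> _|_].
  by rewrite /d eqxx muln1; apply: (le i j); rewrite !eqxx.
case: eqVneq => // -> _; rewrite /d eqxx orbT muln1; apply: (le j i).
by rewrite !eqxx orbT.
Qed.

End CriticalVectors.

(** A vector with positive gradient certifies that the form is positive, by the
   inequality between the geometric and the arithmetic mean on every arrow. *)
Lemma wpos_superharmonic (Q : quiver) (h : vert Q -> nat) :
  (forall i, 0 < h i) -> (forall i, nbr_sum h i < 2 * h i) -> weakly_positive Q.
Proof.
move=> h0 hn d [i0 n0].
pose H i : rat := (h i)%:R%R; pose D i : rat := (d i)%:R%R.
have H0 i : (0 < H i)%R by rewrite ltr0n.
suff : ((\sum_(a : arr Q) d (src a) * d (tgt a))%:R *+ 2 <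
        (\sum_i d i * d i)%:R *+ 2 :> rat)%R.
  by rewrite ltrMn2r //= ltr_nat.
rewrite !natr_sum -!sumrMnl.
apply: (@le_lt_trans _ _ (\sum_(a : arr Q) (D (src a) ^+ 2 / H (src a) * H (tgt a) +
    D (tgt a) ^+ 2 / H (tgt a) * H (src a)))%R).
  apply: ler_sum => a _; rewrite natrM -/(D _) -/(D _) -subr_ge0.
  set x := D _; set y := D _; set p := H (src a); set q := H (tgt a).
  have p0 : p != 0%R by rewrite gt_eqF ?H0.
  have q0 : q != 0%R by rewrite gt_eqF ?H0.
  have -> : (x ^+ 2 / p * q + y ^+ 2 / q * p - (x * y) *+ 2 =
      (x * q - y * p) ^+ 2 / (p * q))%R by field; rewrite p0 q0.
  by rewrite divr_ge0 ?sqr_ge0 // mulr_ge0 // ltW ?H0.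
have -> : (\sum_(a : arr Q) (D (src a) ^+ 2 / H (src a) * H (tgt a) +
    D (tgt a) ^+ 2 / H (tgt a) * H (src a)) =
    \sum_i D i ^+ 2 / H i * (nbr_sum h i)%:R)%R.
  rewrite /nbr_sum; under [RHS]eq_bigr do rewrite natr_sum mulr_sumr.
  rewrite exchange_big; apply: eq_bigr => a _ /=.
  under eq_bigr do rewrite natrD !natrM mulrDr.
  rewrite big_split /=; congr (_ + _)%R.
    rewrite (bigD1 (src a)) //= eqxx mul1r big1 ?addr0 // => i.
    by rewrite eq_sym => /negPf ->; rewrite mul0r mulr0.
  rewrite (bigD1 (tgt a)) //= eqxx mul1r big1 ?addr0 // => i.
  by rewrite eq_sym => /negPf ->; rewrite mul0r mulr0.
have le i : (D i ^+ 2 / H i * (nbr_sum h i)%:R <= (d i * d i)%:R *+ 2)%R.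
  rewrite natrM -/(D i) -expr2 -mulrA -[X in (_ <= X)%R]mulr_natr.
  rewrite ler_wpM2l ?sqr_ge0 // mulrC ler_pdivrMr ?H0 //.
  by rewrite -natrM ler_nat ltnW.
rewrite (bigD1 i0) //= [X in (_ < X)%R](bigD1 i0) //=.
apply: ltr_leD; last by apply: ler_sum.
rewrite natrM -/(D i0) -expr2 -mulrA -[X in (_ < X)%R]mulr_natr ltr_pM2l; last first.
  by rewrite exprn_gt0 // ltr0n lt0n; apply/eqP.
by rewrite mulrC ltr_pdivrMr ?H0 // -natrM ltr_nat.
Qed.

(** * Connected quivers with positive Tits form are Dynkin *)

Section Classification.
Variable Q : quiver.
Hypothesis wpos : weakly_positive Q.

Let pos := wpos_mult wpos.

Lemma crit1 (x0 : vert Q) (q : seq (vert Q)) (W : nat -> nat) :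
  uniq q -> (exists2 t, t < size q & 0 < W t) ->
  (forall t, t < size q -> 0 < W t -> exists l : seq nat, [/\ uniq l,
     all (fun s => (s < size q) && adj (nth x0 q t) (nth x0 q s)) l &
     2 * W t <= \sum_(s <- l) W s]) -> False.
Proof.
move=> uq [t0 t0q W0] h; apply: (no_critical_seq pos (x0 := x0) (W := W) (M := fun=> 1) uq) => //.
  by exists t0; rewrite t0q W0.
move=> t tq _ Wt; have [l [ul hl le]] := h t tq Wt; exists l; split=> //.
by apply: leq_trans le _; apply: leq_sum => s _; rewrite mul1n.
Qed.

Lemma adjxx (v : vert Q) : adj v v = false.
Proof. by rewrite /adj (positive_no_loop pos). Qed.

Lemma num_edges_adj (v w : vert Q) : num_edges v w = adj v w.
Proof. exact: (positive_simple pos). Qed.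

Section Path.
Variables (x0 : vert Q) (p : seq (vert Q)).
Hypotheses (up : uniq p) (sp : sorted (@adj Q) p).
Local Notation v t := (nth x0 p t).
Local Notation m := (size p).

Lemma adj_next t : t.+1 < m -> adj (v t) (v t.+1).
Proof. by move: t; apply/sortedP. Qed.

Lemma adj_prev t : 0 < t -> t < m -> adj (v t) (v t.-1).
Proof. by case: t => // t _ lt; rewrite adj_sym adj_next. Qed.

(** A chord of a path would close a cycle. *)
Lemma no_chord a b : a < b -> b < m -> adj (v a) (v b) -> b = a.+1.
Proof.
move=> ab bm ch; apply/eqP; apply: contraT => ne; exfalso.
apply: (@crit1 x0 p (fun t => if a <= t <= b then 1 else 0) up).
  by exists a; [lia|case: ifP; lia].
move=> t tm; case: ifP => // /andP [at_ tb] _.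
have [ta|ta] := eqVneq t a.
  subst t; exists [:: a.+1; b]; split; last by rewrite !big_cons big_nil; do !case: ifP; lia.
    by rewrite /= ?inE; lia.
  by rewrite /= ch adj_next; lia.
have [te|te] := eqVneq t b.
  subst t; exists [:: b.-1; a]; split; last by rewrite !big_cons big_nil; do !case: ifP; lia.
    by rewrite /= ?inE; lia.
  by rewrite /= (adj_sym (v b) (v a)) ch adj_prev; lia.
exists [:: t.-1; t.+1]; split; last by rewrite !big_cons big_nil; do !case: ifP; lia.
  by rewrite /= ?inE; lia.
by rewrite /= adj_prev ?adj_next; lia.
Qed.

Lemma adj_path a b : a < m -> b < m -> adj (v a) (v b) = (b == a.+1) || (a == b.+1).
Proof.
move=> am bm; apply/idP/idP.
  have [ab|ba|->] := ltngtP a b; last by rewrite adjxx.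
    by move=> h; rewrite (no_chord ab bm h) eqxx.
  by rewrite adj_sym => h; rewrite (no_chord ba am h) eqxx orbT.
case/orP => /eqP e; subst; first exact: adj_next.
by rewrite adj_sym; apply: adj_next.
Qed.

Section Extended.
Variables (z w : vert Q) (Wz Ww : nat) (W : nat -> nat) (sz sw : seq nat) (c : bool).
Hypotheses (zp : z \notin p) (Wz0 : 0 < Wz) (wp : 0 < Ww -> (w \notin p) && (z != w)).
Hypotheses (usz : uniq sz) (usw : uniq sw).
Hypotheses (adjz : all (fun t => (t < m) && adj z (v t)) sz)
  (adjw : all (fun t => (t < m) && adj w (v t)) sw) (adjzw : c -> adj z w).

(** The test for a vector supported on the path and at most two further vertices,
   attached to the path at the positions [sz] and [sw]; with [Ww = 0] only the
   vertex [z] is added. *)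
Lemma path_crit :
  (forall t, t < m -> 0 < W t -> 2 * W t <=
     (0 < t) * W t.-1 + (t.+1 < m) * W t.+1 + (t \in sz) * Wz + (t \in sw) * Ww) ->
  2 * Wz <= c * Ww + \sum_(t <- sz) W t -> 2 * Ww <= c * Wz + \sum_(t <- sw) W t -> False.
Proof.
move=> hp hz hw.
pose y u := (u == z) * Wz + (u == w) * Ww + (u \in p) * W (index u p).
have yv t : t < m -> y (v t) = W t.
  move=> tm; rewrite /y mem_nth // index_uniq // mul1n.
  have -> : (v t == z) = false by apply: contraNF zp => /eqP <-; apply: mem_nth.
  case: Ww wp => [|n] h; first by rewrite muln0.
  have /andP [wp' _] := h isT.
  by have -> : (v t == w) = false by apply: contraNF wp' => /eqP <-; apply: mem_nth.
have yz : y z = Wz.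
  rewrite /y eqxx (negPf zp) addn0 mul1n; case: Ww wp => [|n] h; first by rewrite muln0 addn0.
  by have /andP [_ /negPf ->] := h isT; rewrite addn0.
have yw : 0 < Ww -> y w = Ww.
  by move=> /wp /andP [wp' zw]; rewrite /y eqxx (negPf wp') eq_sym (negPf zw) addn0 mul1n.
have lower u l : uniq l -> all (fun t => (t < m) && adj u (v t)) l ->
    adj u z * Wz + adj u w * Ww + \sum_(t <- l) W t <= nbr_sum y u.
  move=> ul /allP hl; apply: leq_trans (nbr_sum_ge y u).
  have pick x n : \sum_u' num_edges u u' * ((u' == x) * n) = num_edges u x * n.
    rewrite (bigD1 x) //= eqxx mul1n big1 ?addn0 // => u' /negPf ->.
    by rewrite mul0n muln0.
  under [X in _ <= X]eq_bigr do rewrite !mulnDr.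
  rewrite !big_split /= !pick !num_edges_adj leq_add2l.
  rewrite (eq_big_seq (fun t => adj u (v t) * ((v t \in p) * W (index (v t) p)))); last first.
    by move=> t /hl /andP [tm ->]; rewrite mem_nth // index_uniq // !mul1n.
  rewrite -(big_map (nth x0 p) xpredT (fun u' => adj u u' * ((u' \in p) * W (index u' p)))).
  rewrite big_uniq /=; last first.
    rewrite map_inj_in_uniq // => t t' /hl /andP [tm _] /hl /andP [tm' _] /eqP.
    by rewrite nth_uniq // => /eqP.
  rewrite [X in _ <= X](bigID (fun u' => u' \in map (nth x0 p) l)) /=.
  by apply: leq_trans (leq_addr _ _); apply: leq_sum => u' _; rewrite num_edges_adj.
apply: (no_critical pos (x := y) (m := fun=> 1)) => //.
  by exists z; rewrite yz.
have -> : (fun u => 1 * y u) = y by apply/funext => u; rewrite mul1n.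
move=> u _ yu; have [tm|tm] := boolP (u \in p).
  rewrite -(nth_index x0 tm); rewrite -index_mem in tm; set t := index u p in tm *.
  have ut : u = v t by rewrite nth_index // -index_mem.
  rewrite ut yv // in yu; rewrite yv //; apply: leq_trans (hp t tm yu) _.
  apply: leq_trans (lower (v t) ((if 0 < t then [:: t.-1] else [::]) ++
     (if t.+1 < m then [:: t.+1] else [::])) _ _); last first.
  - have tp : t.-1 < m by move: tm; case: (t) => // t' /ltnW.
    rewrite all_cat; case t0: (0 < t); case t1: (t.+1 < m);
      by rewrite /= ?tp ?t1 ?(adj_prev t0 tm) ?(adj_next t1).
  - by case: ltnP => t0; case: ltnP => t1 //=; rewrite inE andbT; lia.
  rewrite [X in _ <= X]addnC -addnA leq_add //.
    by rewrite big_cat /=; case: (0 < t); case: (_ < m); rewrite ?big_seq1 ?big_nil ?mul1n.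
  apply: leq_add; rewrite leq_mul2r; apply/orP; right.
    by case: (boolP (t \in sz)) => // /(allP adjz) /andP [_]; rewrite adj_sym => ->.
  by case: (boolP (t \in sw)) => // /(allP adjw) /andP [_]; rewrite adj_sym => ->.
have [uz|uz] := eqVneq u z.
  subst u; rewrite yz; apply: leq_trans hz (leq_trans _ (lower z sz usz adjz)).
  rewrite leq_add2r; apply: leq_trans (leq_addl _ _); rewrite leq_mul2r; apply/orP; right.
  by case: (c) adjzw => // ->.
have uw : (u == w) && (0 < Ww).
  by move: yu; rewrite /y (negPf uz) (negPf tm); case: eqP => //=; rewrite mul1n addn0.
have /andP [/eqP uw' W0] := uw; subst u; rewrite yw //.
apply: leq_trans hw (leq_trans _ (lower w sw usw adjw)).
rewrite leq_add2r; apply: leq_trans (leq_addr _ _); rewrite leq_mul2r; apply/orP; right.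
by case: (c) adjzw => // h; rewrite adj_sym h.
Qed.
End Extended.

Lemma no_off_cycle z i j : z \notin p -> i < j -> j < m ->
  adj z (v i) -> adj z (v j) -> False.
Proof.
move=> zp ij jm zi zj; have im := ltn_trans ij jm.
apply: (@path_crit z z 1 0 (fun t => (i <= t <= j)%N) [:: i; j] [::] false) => //.
- by rewrite /= inE neq_ltn ij.
- by rewrite /= zi zj im jm.
- by move=> t tm; rewrite !inE; lia.
by rewrite !big_cons big_nil !leqnn (ltnW ij).
Qed.

(** Two branches off a path give an extended Dynkin graph of type D. *)
Lemma no_two_branches z w i j : z \notin p -> w \notin p -> z != w ->
  0 < i -> i <= j -> j.+1 < m -> adj w (v i) -> adj z (v j) -> False.
Proof.
move=> zp wp zw i0 ij jm wi zj.
pose W t := (i <= t <= j) + (i <= t.+1 <= j.+2).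
apply: (@path_crit z w 1 1 W [:: j] [:: i] false) => //.
- by rewrite wp.
- by rewrite /= zj ltnW.
- by rewrite /= wi (leq_ltn_trans ij) // ltnW.
- by move=> t tm; rewrite /W !inE; lia.
- by rewrite big_seq1 /W; lia.
- by rewrite big_seq1 /W; lia.
Qed.

(** Here and below the weights are the null vectors of the extended Dynkin graphs of
   type E. *)
Lemma no_E6 z w j : z \notin p -> w \notin p -> z != w -> 1 < j -> j.+2 < m ->
  adj z (v j) -> adj w z -> False.
Proof.
move=> zp wp zw j1 jm zj wz.
apply: (@path_crit z w 2 1 (fun t => 3 - ((t - j) + (j - t))) [:: j] [::] true) => //.
- by rewrite wp.
- by rewrite /= zj; lia.
- by rewrite adj_sym.
- by move=> t tm; rewrite !inE; lia.
by rewrite big_seq1; lia.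
Qed.

Lemma no_E7 z j : z \notin p -> 2 < j -> j.+3 < m -> adj z (v j) -> False.
Proof.
move=> zp j1 jm zj.
apply: (@path_crit z z 2 0 (fun t => 4 - ((t - j) + (j - t))) [:: j] [::] false) => //.
- by rewrite /= zj; lia.
- by move=> t tm; rewrite !inE; lia.
by rewrite big_seq1; lia.
Qed.

Lemma no_E8 z : z \notin p -> 7 < m -> adj z (v 2) -> False.
Proof.
move=> zp jm zj.
apply: (@path_crit z z 3 0 (fun t => minn (2 * t.+1) (8 - t)) [:: 2] [::] false) => //.
- by rewrite /= zj; lia.
- by move=> t tm; rewrite !inE; lia.
by rewrite big_seq1.
Qed.
End Path.

Hypothesis conn : cut_connected Q.

Lemma longest_path : exists p : seq (vert Q), [/\ uniq p, sorted (@adj Q) p &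
  forall p', uniq p' -> sorted (@adj Q) p' -> size p' <= size p].
Proof.
pose P n := `[< exists2 p : seq (vert Q), size p = n & uniq p /\ sorted (@adj Q) p >].
have exP : exists n, P n by exists 0; apply/asboolP; exists [::].
have bound n : P n -> n <= #|vert Q|.
  move=> /asboolP [p <- [up _]]; rewrite -(card_uniqP up); exact: max_card.
case: (ex_maxnP exP bound) => n /asboolP [p pn [up sp]] max.
exists p; split=> // p' up' sp'; rewrite pn; apply: max.
by apply/asboolP; exists p'.
Qed.

Lemma cut_adj (U : {set vert Q}) : (exists i, i \in U) -> (exists j, j \notin U) ->
  exists i j, [/\ i \in U, j \notin U & adj i j].
Proof.
move=> h1 h2; have [a] := conn h1 h2.
have sa : adj (src a) (tgt a) by apply/card_gt0P; exists a; rewrite !inE !eqxx.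
case: (boolP (src a \in U)) => su; case: (boolP (tgt a \in U)) => tu // _.
  by exists (src a), (tgt a).
by exists (tgt a), (src a); split=> //; rewrite adj_sym.
Qed.

Lemma of_type_list (x0 : vert Q) (q : seq (vert Q)) (e : rel nat) n :
  size q = n -> uniq q -> (forall v, v \in q) ->
  (forall a b, a < n -> b < n -> adj (nth x0 q a) (nth x0 q b) = e a.+1 b.+1) ->
  of_type Q e n.
Proof.
move=> <- uq allq h; exists (fun i : 'I_(size q) => nth x0 q i); split.
  have lt v : index v q < size q by rewrite index_mem.
  exists (fun v => Ordinal (lt v)) => [i|v]; last exact: nth_index.
  by apply: val_inj; rewrite /= index_uniq.
by move=> i j; rewrite num_edges_adj h.
Qed.

Section Longest.
Variables (x0 : vert Q) (p : seq (vert Q)) (z : vert Q) (j : nat).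
Hypotheses (up : uniq p) (sp : sorted (@adj Q) p).
Hypothesis longest : forall p', uniq p' -> sorted (@adj Q) p' -> size p' <= size p.
Hypotheses (zp : z \notin p) (jm : j < size p) (zj : adj z (nth x0 p j)).
Local Notation v t := (nth x0 p t).
Local Notation m := (size p).

(** Replacing the part of the path before [t] by vertices off the path cannot give a
   longer path. *)
Lemma longest_left w t (s : seq (vert Q)) : t < m -> uniq (rcons s w) ->
  sorted (@adj Q) (rcons s w) -> adj w (v t) -> all (fun y => y \notin p) (rcons s w) ->
  size s < t.
Proof.
move=> tm us ss wt off.
have := longest (p' := rcons s w ++ drop t p).
rewrite cat_uniq us drop_uniq // andbT size_cat size_drop size_rcons.
have -> : ~~ has (mem (rcons s w)) (drop t p).
  apply/hasPn => y /mem_drop yp; apply: contraL yp => /=; exact: (allP off).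
move=> /(_ isT) h.
have srt : sorted (@adj Q) (rcons s w ++ drop t p).
  rewrite (drop_nth x0) // cat_rcons -cat_rcons.
  case: s ss {us off h} => [_|y s] /=.
    by rewrite wt; have := drop_sorted t sp; rewrite (drop_nth x0).
  rewrite cat_path => -> /=; rewrite last_rcons wt.
  by have := drop_sorted t sp; rewrite (drop_nth x0).
by have := h srt; rewrite addnBA ?(ltnW tm) // leq_subLR leq_add2r.
Qed.
End Longest.

Section Branch.
Variables (x0 : vert Q) (p : seq (vert Q)) (z : vert Q) (j : nat).
Hypotheses (up : uniq p) (sp : sorted (@adj Q) p).
Hypothesis longest : forall p', uniq p' -> sorted (@adj Q) p' -> size p' <= size p.
Hypotheses (zp : z \notin p) (jm : j < size p) (zj : adj z (nth x0 p j)).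
Local Notation v t := (nth x0 p t).
Local Notation m := (size p).

Lemma longest_both w t (s : seq (vert Q)) : t < m -> uniq (rcons s w) ->
  sorted (@adj Q) (rcons s w) -> adj w (v t) -> all (fun y => y \notin p) (rcons s w) ->
  size s < t /\ t + size s < m.-1.
Proof.
move=> tm us ss wt off; split; first exact: (longest_left up sp longest tm us ss wt off).
have sym_rev (q : seq (vert Q)) : sorted (@adj Q) (rev q) = sorted (@adj Q) q.
  by rewrite rev_sorted; apply: eq_sorted => a b; apply: adj_sym.
have urp : uniq (rev p) by rewrite rev_uniq.
have srp : sorted (@adj Q) (rev p) by rewrite sym_rev.
have lrp p' : uniq p' -> sorted (@adj Q) p' -> size p' <= size (rev p).
  by rewrite size_rev; apply: longest.
have lt : m - t.+1 < m by rewrite -subn_gt0 subKn.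
have wt' : adj w (nth x0 (rev p) (m - t.+1)).
  by rewrite nth_rev // subnSK // subKn // ltnW.
have off' : all (fun y => y \notin rev p) (rcons s w).
  by rewrite -(eq_all (a1 := fun y => y \notin p)) // => y; rewrite mem_rev.
have ltr : m - t.+1 < size (rev p) by rewrite size_rev.
have := longest_left urp srp lrp ltr us ss wt' off'.
by case: (size p) tm => // n tn /=; rewrite subSS ltn_subRL.
Qed.

Lemma branch_all w : w \in p \/ w = z.
Proof.
have [j0 jm1] := @longest_both z j [::] jm isT isT zj (introT andP (conj zp isT)).
rewrite addn0 in jm1; have jm2 : j.+1 < m by move: jm1; case: (size p).
apply: contrapT => /not_orP [wp wz].
have [||u [w' [uU wU uw]]] := @cut_adj [set y | (y \in p) || (y == z)].
- by exists z; rewrite inE eqxx orbT.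
- by exists w; rewrite inE negb_or; apply/andP; split; [apply/negP|apply/eqP].
move: wU; rewrite inE negb_or => /andP [wp' wz'].
have zw : z != w' by rewrite eq_sym.
move: uU; rewrite inE => /orP [/(nthP x0) [i im ui]|/eqP uz].
  have wi : adj w' (v i) by rewrite adj_sym ui.
  have [i0 im1] := @longest_both w' i [::] im isT isT wi (introT andP (conj wp' isT)).
  rewrite addn0 in im1; have im2 : i.+1 < m by move: im1; case: (size p).
  have [le|/ltnW le] := leqP i j.
    exact: (no_two_branches up sp zp wp' zw i0 le jm2 wi zj).
  by apply: (no_two_branches up sp wp' zp _ j0 le im2 zj wi); rewrite eq_sym.
subst u; have wz2 : adj w' z by rewrite adj_sym.
have [||||j1 j2] := @longest_both z j [:: w'] jm.
- by rewrite /= inE eq_sym zw.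
- by rewrite /= wz2.
- exact: zj.
- by rewrite /= wp' zp.
apply: (no_E6 up sp zp wp' zw j1 _ zj wz2).
by move: j2; rewrite addn1; case: (size p) => // n; rewrite /= ltnS.
Qed.

Lemma branch_adj t : t < m -> adj z (v t) = (t == j).
Proof.
move=> tm; have [->|ne] := eqVneq t j; first exact: zj.
apply/negP => zt; have [lt|lt|e] := ltngtP t j.
- exact: (no_off_cycle up sp zp lt jm zt zj).
- exact: (no_off_cycle up sp zp lt tm zj zt).
- by rewrite e eqxx in ne.
Qed.

(** The numberings of the graphs of type D and E list the end of the short branch at
   a place [s] between the vertices of the path. *)
Lemma branch_list s (e : rel nat) : s <= m ->
  (forall a b, a < m.+1 -> b < m.+1 -> e a.+1 b.+1 =
     (let pa := if a < s then a else a.-1 in let pb := if b < s then b else b.-1 in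
      if a == s then (b != s) && (pb == j) else if b == s then pa == j else
      (pb == pa.+1) || (pa == pb.+1))) ->
  of_type Q e m.+1.
Proof.
move=> sm h; pose q := take s p ++ z :: drop s p.
have st : size (take s p) = s by rewrite size_takel.
have nq a : a < m.+1 -> nth x0 q a = if a == s then z else v (if a < s then a else a.-1).
  move=> am; rewrite nth_cat st; case: ltngtP => [lt|lt|->].
  - by rewrite nth_take.
  - case: a am lt => // a am lt; rewrite subSn //= nth_drop subnKC //.
  - by rewrite subnn.
apply: (@of_type_list x0 q).
- by rewrite size_cat /= addnS -size_cat cat_take_drop.
- rewrite cat_uniq /= drop_uniq // take_uniq // andbT.
  rewrite negb_or (contra (@mem_take s _ p z) zp) (contra (@mem_drop s _ p z) zp) !andbT /=.
  by have := up; rewrite -{1}(cat_take_drop s p) cat_uniq => /and3P [].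
- move=> w; rewrite mem_cat inE; have [wp|->] := branch_all w; last by rewrite eqxx orbT.
  by move: wp; rewrite -{1}(cat_take_drop s p) mem_cat => /orP [->|->]; rewrite ?orbT.
move=> a b am bm; rewrite h // !nq //=.
have rng c : c < m.+1 -> c != s -> (if c < s then c else c.-1) < m.
  move=> cm cs; case: ifP => cs'; first exact: leq_trans cs' sm.
  by move: (jm); lia.
have [_|as_] := eqVneq a s; have [_|bs] := eqVneq b s => //=.
- by rewrite adjxx.
- by rewrite branch_adj // rng.
- by rewrite adj_sym branch_adj // rng.
- by rewrite (adj_path x0 up sp) // rng.
Qed.

(** The length [j] of the shorter arm decides: for [1] the type is D, for [2] it is E,
   and more is excluded. *)
Lemma branch_dynkin : j <= m - j.+1 -> dynkinDE Q.
Proof.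
move=> arms.
have [j0 jm1] := @longest_both z j [::] jm isT isT zj (introT andP (conj zp isT)).
rewrite addn0 in jm1.
case E : j j0 => [//|[|[|j']]] _.
- left; exists m.+1; first lia.
  apply: (@branch_list 1) => [|a b am bm]; first lia.
  by rewrite E /edgeD /sym_rel; case: a am => [|[|a]] am; case: b bm => [|[|b]] bm /=; lia.
- right; have m8 : m < 8.
    rewrite ltnNge; apply/negP => m8; apply: (no_E8 (x0 := x0) up sp zp m8).
    by rewrite -E.
  have ty : of_type Q edgeE m.+1.
    apply: (@branch_list 3) => [|a b am bm]; first lia.
    rewrite E /edgeE /sym_rel.
    by case: a am => [|[|[|[|a]]]] am; case: b bm => [|[|[|[|b]]]] bm /=; lia.
  have : (m == 5) || (m == 6) || (m == 7) by lia.
  by case/orP => [/orP [/eqP e|/eqP e]|/eqP e]; rewrite e in ty; [left|right; left|right; right].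
exfalso; apply: (no_E7 up sp zp _ _ zj); lia.
Qed.

End Branch.

(** If a longest path contains all vertices, the graph is of type A. Otherwise some
   vertex is attached to it, by one edge and at an inner vertex of the path; this is
   the only vertex off the path, and the lengths of the arms are limited by the
   extended Dynkin graphs of type E. *)
Theorem wpos_dynkin : dynkin Q.
Proof.
have [p [up sp longest]] := longest_path.
have /card_gt0P [x0 _] := vert_gt0 Q.
have [all_p|/existsNP [w wp]] := pselect (forall w, w \in p).
  left; exists (size p).
    by have := all_p x0; case: (p).
  apply: (of_type_list (x0 := x0) _ up all_p) => // a b am bm.
  by rewrite (adj_path x0 up sp) // /edgeA /sym_rel !eqSS.
have p0 : 0 < size p by apply: (longest [:: x0]).
have [||u [z [up' zp uz]]] := @cut_adj [set y in p].
- by exists (nth x0 p 0); rewrite inE mem_nth.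
- by exists w; rewrite inE; apply/negP.
move: up' zp; rewrite !inE => /(nthP x0) [j jm ju] zp; subst u.
rewrite adj_sym in uz; right.
have [arms|arms] := leqP j (size p - j.+1).
  exact: (branch_dynkin up sp longest zp jm uz arms).
have jm' : size p - j.+1 < size (rev p) by rewrite size_rev -subn_gt0 subKn.
apply: (@branch_dynkin x0 (rev p) z (size p - j.+1)) => //.
- by rewrite rev_uniq.
- by rewrite rev_sorted (eq_sorted (e' := @adj Q)) // => a b; apply: adj_sym.
- by rewrite size_rev.
- by rewrite mem_rev.
- rewrite nth_rev; last by move: jm'; rewrite size_rev.
  have e n : j < n -> n - (n - j.+1).+1 = j by lia.
  by rewrite e.
have e n : n - j.+1 < j -> n - j.+1 <= n - (n - j.+1).+1 by lia.
by rewrite size_rev; apply: e.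
Qed.

End Classification.

(** * Multiplicities on the vertices of a Dynkin quiver *)

Section BlownUp.
Variables (G : quiver) (S : vert G -> quiver).
Local Notation l := (fun i => #|vert (S i)|).
Local Notation tagV := (Tagged (fun i => vert (S i))).

Lemma real_vert_sum (F : vert (real_quiver S) -> nat) :
  \sum_v F v = \sum_i \sum_(v : vert (S i)) F (tagV v).
Proof.
rewrite (sig_big_dep xpredT (fun=> xpredT) (fun i v => F (tagV v))).
by apply: eq_bigr => -[].
Qed.

Lemma real_arr_sum (F : arr (real_quiver S) -> nat) :
  \sum_a F a = \sum_a F (inl a) +
    \sum_(al : arr G) \sum_(a : vert (S (src al))) \sum_(b : vert (S (tgt al)))
      F (inr (Tagged (fun al => (vert (S (src al)) * vert (S (tgt al)))%type) (a, b))).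
Proof.
rewrite big_sumType /=; congr (_ + _).
under [RHS]eq_bigr do rewrite pair_big /=.
rewrite (sig_big_dep xpredT (fun=> xpredT) (fun al (p : vert (S (src al)) * vert (S (tgt al))) =>
  F (inr (Tagged (fun al => (vert (S (src al)) * vert (S (tgt al)))%type) (p.1, p.2))))).
by apply: eq_bigr => -[al [a b]].
Qed.

Lemma sum_first (T : finType) (m c : nat) : m <= #|T| ->
  \sum_(v : T) (if enum_rank v < m then c else 0) = m * c.
Proof.
move=> mT; rewrite (reindex (@enum_val T T)) /=; last exact/onW_bij/enum_val_bij.
under eq_bigr do rewrite enum_valK.
rewrite -big_mkcond /= -(big_ord_widen _ (fun=> c) mT).
by rewrite sum_nat_const card_ord.
Qed.

(** A vector with value [x i] on [m i] copies of [i] is a vector on the realization. *)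
Lemma wpos_real_mult : weakly_positive (real_quiver S) -> positive_mult l.
Proof.
move=> wpos x m ml [i /andP [mi xi]].
pose d (v : vert (real_quiver S)) := if enum_rank (tagged v) < m (tag v) then x (tag v) else 0.
have ex : exists v, d v <> 0.
  exists (tagV (enum_val (Ordinal (leq_trans mi (ml i)) : 'I_#|vert (S i)|))).
  by rewrite /d /= enum_valK /= mi; move: xi; case: (x i).
have dsum j : \sum_(v : vert (S j)) d (tagV v) = m j * x j.
  exact: (sum_first (x j) (ml j)).
apply: leq_ltn_trans (leq_trans (wpos d ex) _).
  rewrite real_arr_sum /=; apply: leq_trans (leq_addl _ _).
  rewrite leq_eqVlt; apply/orP; left; apply/eqP; apply: eq_bigr => al _.
  rewrite -!dsum big_distrlr /=; apply: eq_bigr => a _; exact: eq_bigr.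
rewrite real_vert_sum leq_eqVlt; apply/orP; left; apply/eqP; apply: eq_bigr => j _.
rewrite -(sum_first (x j * x j) (ml j)); apply: eq_bigr => v _; rewrite /d /=.
by case: ifP.
Qed.

Lemma copies_le j (w : vert (real_quiver S)) :
  \sum_(a : vert (S j)) (tagV a == w) <= (j == tag w).
Proof.
case: w => i v /=; have [e|ne] := eqVneq j i; last first.
  rewrite big1 // => a _; case: eqP => // /(congr1 tag) /= e.
  by rewrite e eqxx in ne.
subst j; rewrite (bigD1 v) //= eqxx big1 // => a av.
by rewrite eq_Tagged /= (negPf av).
Qed.

Hypothesis noarr : forall i, arr (S i) -> False.

(** Without arrows inside the blown up vertices, a test vector that is constant on
   the copies of each vertex is a test vector on [G], weighted by multiplicities. *)
Lemma real_superharmonic (h : vert G -> nat) :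
  (forall i, 0 < h i) -> (forall i, nbr_sum (fun j => l j * h j) i < 2 * h i) ->
  weakly_positive (real_quiver S).
Proof.
move=> h0 hn; apply: (@wpos_superharmonic (real_quiver S) (fun v => h (tag v))) => [v|[i v]].
  exact: h0.
apply: leq_ltn_trans (hn i); rewrite /nbr_sum real_arr_sum /= big1 ?add0n => [|[j a] _].
  apply: leq_sum => al _; under eq_bigr do rewrite big_split /=.
  rewrite big_split /=; apply: leq_add.
    under eq_bigr do rewrite sum_nat_const /= mulnCA.
    rewrite -big_distrl /= leq_mul2r; apply/orP; right.
    by exact: (copies_le (src al) (tagV v)).
  rewrite exchange_big /=; under eq_bigr do rewrite sum_nat_const /= mulnCA.
  rewrite -big_distrl /= leq_mul2r; apply/orP; right.
  exact: (copies_le (tgt al) (tagV v)).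
by case: (noarr a).
Qed.

End BlownUp.

Lemma arr_adj (Q : quiver) (a : arr Q) : adj (src a) (tgt a) /\ adj (tgt a) (src a).
Proof.
suff h : adj (src a) (tgt a) by split=> //; rewrite adj_sym.
by apply/card_gt0P; exists a; rewrite !inE !eqxx.
Qed.

(** The arrow joins two copies of [i], and both of these are joined to every copy of
   a neighbour of [i]. *)
Lemma triangle (G : quiver) (S : vert G -> quiver) (i : vert G) (a : arr (S i)) :
  cut_connected G -> 2 <= #|vert G| -> src a <> tgt a ->
  ~ weakly_positive (blow (fun _ : unit => Tagged (fun i => arr (S i)) a)).
Proof.
move=> conn card2 loop; set B := blow _ => wpos.
have [||al] := conn [set i].
- by exists i; rewrite inE.
- have : 0 < #|[set~ i]| by rewrite cardsC1; case: #|_| card2 => [|[]].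
  by case/card_gt0P => j; rewrite !inE => ji; exists j; rewrite inE.
rewrite !inE => ends.
have [j [c [ji nc]]] : exists j (c : vert (S j)), j != i /\
    forall v : vert (S i), adj (Tagged (fun i => vert (S i)) v : vert B)
                               (Tagged (fun i => vert (S i)) c : vert B).
  have /card_gt0P [c1 _] := vert_gt0 (S (src al)); have /card_gt0P [c2 _] := vert_gt0 (S (tgt al)).
  have key (b1 : vert (S (src al))) (b2 : vert (S (tgt al))) := @arr_adj B
     (inr (Tagged (fun al => (vert (S (src al)) * vert (S (tgt al)))%type) (b1, b2))).
  case: (eqVneq (src al) i) ends => [e|ne].
    rewrite eq_sym eqb_id => ti; exists (tgt al), c2; split=> //.
    by rewrite -e => v; have [] := key v c2.
  rewrite eq_sym eqbF_neg negbK => /eqP e; exists (src al), c1; split=> //.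
  by rewrite -e => v; have [_] := key c1 v.
pose u : vert B := Tagged (fun i => vert (S i)) (src a).
pose v : vert B := Tagged (fun i => vert (S i)) (tgt a).
pose w : vert B := Tagged (fun i => vert (S i)) c.
have [uv vu] := @arr_adj B (inl tt).
have uw := nc (src a); have vw := nc (tgt a).
apply: (@crit1 _ wpos u [:: u; v; w] (fun=> 1)).
- rewrite /= !inE negb_or -!andbA; apply/and4P; split=> //.
  + by rewrite eq_Tagged /=; apply/eqP.
  + by apply: contra ji => /eqP /(congr1 tag) /= ->.
  + by apply: contra ji => /eqP /(congr1 tag) /= ->.
- by exists 0.
move=> [|[|[|t]]] // _ _.
- by exists [:: 1; 2]; rewrite !big_cons big_nil; split=> //; apply/and3P; split.
- by exists [:: 0; 2]; rewrite !big_cons big_nil; split=> //; apply/and3P; split.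
exists [:: 0; 1]; rewrite !big_cons big_nil; split=> //.
by rewrite /= adj_sym uw adj_sym vw.
Qed.

Lemma numbering_list (Q : quiver) (e : rel nat) n (phi : 'I_n -> vert Q) (x0 : vert Q) :
  numbering e phi -> exists q : seq (vert Q), [/\ uniq q, size q = n,
    forall i : 'I_n, nth x0 q i = phi i &
    forall a b, a < n -> b < n -> adj (nth x0 q a) (nth x0 q b) = e a.+1 b.+1].
Proof.
move=> [phib h]; exists [seq phi i | i <- enum 'I_n].
have nq (i : 'I_n) : nth x0 [seq phi i | i <- enum 'I_n] i = phi i.
  by rewrite (nth_map i) ?nth_ord_enum // size_enum_ord.
split=> //.
- by rewrite map_inj_uniq ?enum_uniq //; apply: bij_inj.
- by rewrite size_map size_enum_ord.
move=> a b an bn; rewrite (nq (Ordinal an)) (nq (Ordinal bn)) /adj h /=.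
by case: (e _ _).
Qed.

Lemma numbering_rev (Q : quiver) n (phi : 'I_n -> vert Q) :
  numbering edgeA phi -> numbering edgeA (phi \o @rev_ord n).
Proof.
move=> [phib h]; split=> [|i j]; first by apply: bij_comp => //; exists (@rev_ord n); apply: rev_ordK.
rewrite h /= /edgeA /sym_rel; case: i j => i hi [j hj] /=; lia.
Qed.

Section Conditions.
Variables (G : quiver) (l : vert G -> nat).
Hypothesis l0 : forall i, 0 < l i.

(** The conditions of the theorem for powers [k ^ l i] of the ground field. *)
Definition dynkin_mult : Prop :=
  [/\ dynkin G, dynkinDE G -> forall i, l i = 1,
      forall phi : 'I_2 -> vert G, numbering edgeA phi ->
        (l (phi ord0) = 1 /\ l (phi ord_max) = 1) \/
        (exists2 m, m = 2 \/ m = 3 &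
          (l (phi ord0) = m /\ l (phi ord_max) = 1) \/
          (l (phi ord0) = 1 /\ l (phi ord_max) = m)) &
      forall n (phi : 'I_n.+1 -> vert G), 3 <= n.+1 -> numbering edgeA phi ->
        (forall i, l i = 1) \/
        (l (phi ord0) = 2 /\ forall i, i <> phi ord0 -> l i = 1) \/
        (l (phi ord_max) = 2 /\ forall i, i <> phi ord_max -> l i = 1)].

Section Forward.
Hypothesis pos : positive_mult l.

(** Two copies of [i] and the vertices [a] and [b] form a cycle of length four. *)
Lemma mult_degree2 i a b : a != b -> adj i a -> adj i b -> l i = 1.
Proof.
move=> ab ia ib; apply/eqP; rewrite eqn_leq l0 andbT leqNgt; apply/negP => li.
have noadj (v w : vert G) : adj v w -> v != w.
  by apply: contraTneq => ->; rewrite /adj (positive_no_loop pos (l0 w)).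
apply: (@no_critical_seq _ _ pos i [:: i; a; b] (fun=> 1) (fun t => if t is 0 then 2 else 1)).
- by rewrite /= !inE negb_or ab !noadj.
- by move=> [|[|[|t]]].
- by exists 0.
move=> [|[|[|t]]] // _ _ _.
- by exists [:: 1; 2]; rewrite !big_cons big_nil /= ia ib.
- by exists [:: 0]; rewrite !big_cons big_nil /= adj_sym ia.
- by exists [:: 0]; rewrite !big_cons big_nil /= adj_sym ib.
Qed.

(** The two copies of the leaf and the two neighbours [a] and [b] are the ends of an
   extended Dynkin graph of type D. *)
Lemma mult_leaf_branch (x0 : vert G) p a b : 1 < size p -> uniq [:: a, b & p] ->
  sorted (@adj G) p -> adj (last x0 p) a -> adj (last x0 p) b -> l (head x0 p) = 1.
Proof.
move=> sp uab srt pa pb; apply/eqP; rewrite eqn_leq l0 andbT leqNgt; apply/negP => li.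
rewrite -nth_last in pa pb.
apply: (@no_critical_seq _ _ pos x0 [:: a, b & p] (fun t => if t < 3 then 1 else 2)
  (fun t => if t == 2 then 2 else 1) uab).
- by move=> [|[|[|t]]] //= _; rewrite ?l0 // nth0.
- by exists 0.
have MW t : 1 < t -> (if t == 2 then 2 else 1) * (if t < 3 then 1 else 2) = 2.
  by case: t => [|[|[|t]]].
have stp : (size p).+1 = (size p).-1.+2 by rewrite prednK //; apply: ltnW.
have br : nth x0 [:: a, b & p] (size p).+1 = nth x0 p (size p).-1 by rewrite stp.
have nxt t : t.+1 < size p -> adj (nth x0 p t) (nth x0 p t.+1) by move: t; apply/sortedP.
move=> [|[|t]] tm _ _.
- exists [:: (size p).+1]; rewrite big_cons big_nil MW ?ltnS ?(ltnW sp) //; split=> //.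
  by apply/andP; split=> //; rewrite ltnSn br adj_sym pa.
- exists [:: (size p).+1]; rewrite big_cons big_nil MW ?ltnS ?(ltnW sp) //; split=> //.
  by apply/andP; split=> //; rewrite ltnSn br adj_sym pb.
have [e|ne] := eqVneq t (size p).-1.
  subst t; exists [:: (size p).-1.+1; 0; 1].
  case E : (size p) sp nxt pa pb => [|[|m]] //= _ nxt pa pb.
  rewrite !big_cons big_nil MW // E; split=> //.
  by rewrite pa pb adj_sym nxt // !ltnS leqnSn.
have tm' : t.+1 < size p by move: tm ne sp => /=; lia.
case: t {ne} tm tm' => [|t] tm tm'.
  exists [:: 3]; rewrite big_cons big_nil /=; split=> //.
  by rewrite !ltnS sp nxt.
exists [:: t.+2; t.+4]; rewrite !big_cons big_nil !MW //; split=> //.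
  by rewrite /= inE andbT neq_ltn !ltnS leqnSn.
by rewrite /= !ltnS tm' nxt // adj_sym nxt ?(ltnW tm') // ltnW.
Qed.

Section Numbered.
Variables (e : rel nat) (n : nat) (x0 : vert G) (q : seq (vert G)).
Hypotheses (uq : uniq q) (sq : size q = n).
Hypothesis adjq : forall a b, a < n -> b < n -> adj (nth x0 q a) (nth x0 q b) = e a.+1 b.+1.

Lemma idx_degree2 t a b : t < n -> a < n -> b < n -> a != b ->
  e t.+1 a.+1 -> e t.+1 b.+1 -> l (nth x0 q t) = 1.
Proof.
move=> tn an bn ab ta tb; apply: (@mult_degree2 _ (nth x0 q a) (nth x0 q b)).
- by rewrite nth_uniq ?sq.
- by rewrite adjq.
- by rewrite adjq.
Qed.

Lemma idx_leaf (s : seq nat) a b : 1 < size s -> uniq [:: a, b & s] ->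
  all (fun t => t < n) [:: a, b & s] -> sorted (fun i j => e i.+1 j.+1) s ->
  e (last 0 s).+1 a.+1 -> e (last 0 s).+1 b.+1 -> l (nth x0 q (head 0 s)) = 1.
Proof.
case: s => // t0 s ss us lt srt sa sb.
have /and3P [an bn sn] : [&& a < n, b < n & all (fun t => t < n) (t0 :: s)] by [].
have lastn : last t0 s < n by apply: (allP sn); apply: mem_last.
rewrite -[nth x0 q _]/(head x0 (map (nth x0 q) (t0 :: s))).
apply: (@mult_leaf_branch x0 _ (nth x0 q a) (nth x0 q b)).
- by rewrite size_map.
- rewrite -[_ :: _]/(map (nth x0 q) [:: a, b, t0 & s]) map_inj_in_uniq // => i j.
  by move=> /(allP lt) ii /(allP lt) jj /eqP; rewrite nth_uniq ?sq // => /eqP.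
- by apply: (homo_sorted_in (P := fun t => t < n)) sn srt => i j ii jj; rewrite adjq.
- by rewrite /= last_map adjq.
- by rewrite /= last_map adjq.
Qed.
End Numbered.

Lemma numbered_all n (phi : 'I_n -> vert G) (e : rel nat) :
  numbering e phi ->
  (forall q x0, uniq q -> size q = n ->
    (forall a b, a < n -> b < n -> adj (nth x0 q a) (nth x0 q b) = e a.+1 b.+1) ->
    forall t, t < n -> l (nth x0 q t) = 1) -> forall i, l i = 1.
Proof.
move=> num h i; have [q [uq sq qphi hq]] := numbering_list i num.
have [[psi _ psiK] _] := num.
by rewrite -(psiK i) -qphi; apply: h.
Qed.

Lemma mult_E m : (m == 6) || (m == 7) || (m == 8) -> of_type G edgeE m ->
  forall i, l i = 1.
Proof.
move=> m678 [phi num]; apply: numbered_all num _ => q x0 uq sq hq t tm.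
have d2 := idx_degree2 uq sq hq; have lf := idx_leaf uq sq hq.
have m6 : 6 <= m by lia.
case: t tm => [|[|[|[|t]]]] tm.
- by apply: (lf [:: 0; 1; 2] 3 4) => //=; lia.
- by apply: (d2 1 0 2) => //; lia.
- by apply: (d2 2 1 3) => //; lia.
- by apply: (lf [:: 3; 2] 1 4) => //=; lia.
have [tl|tl] := ltnP t.+4.+1 m.
  by case: t tm tl => [|t] tm tl;
    [apply: (d2 4 2 5) => //; lia | apply: (d2 t.+4.+1 t.+4 t.+4.+2) => //; rewrite /edgeE /sym_rel; lia].
have -> : t.+4 = m.-1 by lia.
case/orP: m678 => [/orP [] |] /eqP em.
- by rewrite em; apply: (lf [:: 5; 4; 2] 1 3); rewrite ?em.
- by rewrite em; apply: (lf [:: 6; 5; 4; 2] 1 3); rewrite ?em.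
- by rewrite em; apply: (lf [:: 7; 6; 5; 4; 2] 1 3); rewrite ?em.
Qed.

Lemma mult_D m : 4 <= m -> of_type G edgeD m -> forall i, l i = 1.
Proof.
move=> m4 [phi num]; apply: numbered_all num _ => q x0 uq sq hq t tm.
have d2 := idx_degree2 uq sq hq; have lf := idx_leaf uq sq hq.
case: t tm => [|[|t]] tm.
- by apply: (lf [:: 0; 2] 1 3) => //=; lia.
- by apply: (lf [:: 1; 2] 0 3) => //=; lia.
have [tl|tl] := ltnP t.+3 m.
  case: t tm tl => [|t] tm tl; first by apply: (d2 2 0 1) => //; lia.
  by apply: (d2 t.+3 t.+2 t.+4) => //; rewrite /edgeD /sym_rel; lia.
have hd : t.+2 = head 0 (rev (iota 2 (m - 2))).
  by rewrite -nth0 nth_rev size_iota ?nth_iota; lia.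
have ls : last 0 (rev (iota 2 (m - 2))) = 2.
  have -> : m - 2 = (m - 3).+1 by lia.
  by rewrite /= rev_cons last_rcons.
rewrite hd; apply: (lf _ 0 1).
- by rewrite size_rev size_iota; lia.
- by rewrite /= !inE !mem_rev !mem_iota rev_uniq iota_uniq.
- by rewrite /= all_rev; apply/and3P; split; [lia|lia|apply/allP => i; rewrite mem_iota; lia].
- rewrite rev_sorted; apply/(sortedP 0) => i; rewrite size_iota => im.
  by rewrite !nth_iota; rewrite /edgeD /sym_rel; lia.
- by rewrite ls.
- by rewrite ls.
Qed.

Lemma mult_A2 (phi : 'I_2 -> vert G) : numbering edgeA phi ->
  (l (phi ord0) = 1 /\ l (phi ord_max) = 1) \/
  (exists2 m, m = 2 \/ m = 3 &
    (l (phi ord0) = m /\ l (phi ord_max) = 1) \/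
    (l (phi ord0) = 1 /\ l (phi ord_max) = m)).
Proof.
move=> num; have [q [uq sq qphi hq]] := numbering_list (phi ord0) num.
set x0 := phi ord0 in qphi hq *.
have sym : edgeA 1 2 /\ edgeA 2 1 by [].
have both : 1 < l (nth x0 q 0) -> 1 < l (nth x0 q 1) -> False.
  move=> l1 l2; apply: (@no_critical_seq _ _ pos x0 q (fun=> 1) (fun=> 2)) => //.
  - by move=> [|[|t]]; rewrite sq.
  - by exists 0; rewrite sq.
  rewrite sq => t tq _ _; exists [:: 1 - t]; rewrite big_cons big_nil; split=> //=.
  by rewrite hq; case: t tq => [|[|t]].
have big3 a b : a < 2 -> b < 2 -> a != b -> l (nth x0 q a) <= 3.
  move=> a2 b2 ab; rewrite leqNgt; apply/negP => la.
  apply: (@no_critical_seq _ _ pos x0 q (fun t => if t == a then 1 else 2)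
    (fun t => if t == a then 4 else 1)) => //.
  - by move=> t _; case: eqP => // ->.
  - by exists a; rewrite sq a2 eqxx.
  rewrite sq => t tq _ _; have [->|ta] := eqVneq t a.
    exists [:: b]; rewrite big_cons big_nil; split=> //; last by rewrite eq_sym (negPf ab).
    by rewrite /= b2 hq // /edgeA /sym_rel; lia.
  have -> : t = b by lia.
  exists [:: a]; rewrite big_cons big_nil eqxx; split=> //.
  by rewrite /= a2 hq // /edgeA /sym_rel; lia.
have b0 := big3 0 1 isT isT isT; have b1 := big3 1 0 isT isT isT.
have e0 : nth x0 q 0 = x0 by exact: (qphi ord0).
have e1 : nth x0 q 1 = phi ord_max by exact: (qphi ord_max).
rewrite e0 e1 in b0 b1 both.
have p0 := l0 x0; have p1 := l0 (phi ord_max).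
have [h1|h1] := leqP (l x0) 1; have [h2|h2] := leqP (l (phi ord_max)) 1; last by case: both.
- by left; lia.
- by right; exists (l (phi ord_max)); [lia|right; lia].
- by right; exists (l x0); [lia|left; lia].
Qed.

(** Tripling an end, or doubling both ends, gives an extended Dynkin graph of type D,
   and doubling an inner vertex gives a cycle. *)
Lemma mult_A n (phi : 'I_n.+1 -> vert G) : 3 <= n.+1 -> numbering edgeA phi ->
  (forall i, l i = 1) \/
  (l (phi ord0) = 2 /\ forall i, i <> phi ord0 -> l i = 1) \/
  (l (phi ord_max) = 2 /\ forall i, i <> phi ord_max -> l i = 1).
Proof.
move=> n3 num.
have end2 (psi : 'I_n.+1 -> vert G) : numbering edgeA psi -> l (psi ord0) <= 2.
  move=> nump; have [q [uq sq qpsi hq]] := numbering_list (psi ord0) nump.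
  set x0 := psi ord0 in qpsi hq *; rewrite leqNgt; apply/negP => l3.
  have e0 : nth x0 q 0 = x0 by exact: (qpsi ord0).
  apply: (@no_critical_seq _ _ pos x0 q (fun t => if t < 3 then (if t == 1 then 2 else 1) else 0)
    (fun t => if t == 0 then 3 else 1)) => //.
  - by move=> [|t] _ //=; rewrite e0.
  - by exists 0; rewrite sq.
  rewrite sq => -[|[|[|t]]] tq // _ _.
  - exists [:: 1]; rewrite big_cons big_nil; split=> //.
    by rewrite /= hq // /edgeA /sym_rel; lia.
  - exists [:: 0; 2]; rewrite !big_cons big_nil; split=> //.
    by rewrite /= !hq // /edgeA /sym_rel; lia.
  - exists [:: 1]; rewrite big_cons big_nil; split=> //.
    by rewrite /= hq // /edgeA /sym_rel; lia.
have [q [uq sq qphi hq]] := numbering_list (phi ord0) num.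
set x0 := phi ord0 in qphi hq *.
have e0 : nth x0 q 0 = x0 by exact: (qphi ord0).
have en : nth x0 q n = phi ord_max by exact: (qphi ord_max).
have inner t : 0 < t -> t < n -> l (nth x0 q t) = 1.
  move=> t0 tn; apply: (idx_degree2 uq sq hq (a := t.-1) (b := t.+1)); rewrite ?/edgeA ?/sym_rel; lia.
have both : 1 < l x0 -> 1 < l (phi ord_max) -> False.
  move=> l1 l2; apply: (@no_critical_seq _ _ pos x0 q (fun t => if (t == 0) || (t == n) then 1 else 2)
    (fun t => if (t == 0) || (t == n) then 2 else 1)) => //.
  - by move=> t tq; case: ifP => // /orP [/eqP ->|/eqP ->]; rewrite ?e0 ?en.
  - by exists 0; rewrite sq.
  rewrite sq => t tq _ _; have MW u : (if (u == 0) || (u == n) then 2 else 1) *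
    (if (u == 0) || (u == n) then 1 else 2) = 2 by case: ifP.
  have [->|t0] := eqVneq t 0.
    exists [:: 1]; rewrite big_cons big_nil MW; split=> //.
    by rewrite /= hq // /edgeA /sym_rel; lia.
  have [->|tn] := eqVneq t n.
    exists [:: n.-1]; rewrite big_cons big_nil MW; split=> //.
    by rewrite /= hq // /edgeA /sym_rel; lia.
  exists [:: t.-1; t.+1]; rewrite !big_cons big_nil !MW; split=> //; first by rewrite /= inE; lia.
  by rewrite /= !hq // /edgeA /sym_rel; lia.
have l02 := end2 _ num; rewrite -/x0 in l02.
have ln2 : l (phi ord_max) <= 2.
  have := end2 _ (numbering_rev num); rewrite /= (_ : rev_ord ord0 = ord_max) //.
  by apply: val_inj; rewrite /= subn1.
have [[psi _ psiK] _] := num.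
have rest i : i <> x0 -> i <> phi ord_max -> l i = 1.
  move=> i0 i1; rewrite -(psiK i) -qphi; apply: inner.
    rewrite lt0n; apply/eqP => e; apply: i0; rewrite -(psiK i); congr phi; exact: val_inj.
  have := ltn_ord (psi i); rewrite ltnS leq_eqVlt => /orP [/eqP e|//].
  by case: i1; rewrite -(psiK i); congr phi; apply: val_inj.
have p0 := l0 x0; have p1 := l0 (phi ord_max).
have [h1|h1] := leqP (l x0) 1; have [h2|h2] := leqP (l (phi ord_max)) 1; last by case: both.
- left=> i; have [->|/eqP i0] := eqVneq i x0; first lia.
  by have [->|/eqP i1] := eqVneq i (phi ord_max); [lia|apply: rest].
- right; right; split=> [|i i1]; first lia.
  by have [->|/eqP i0] := eqVneq i x0; [lia|apply: rest].
right; left; split=> [|i i0]; first lia.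
by have [->|/eqP i1] := eqVneq i (phi ord_max); [lia|apply: rest].
Qed.

Lemma positive_mult_wpos : weakly_positive G.
Proof.
move=> d [i di]; rewrite (eq_bigr (fun a => (1 * d (src a)) * (1 * d (tgt a)))); last first.
  by move=> a _; rewrite !mul1n.
rewrite [X in _ < X](eq_bigr (fun i => 1 * (d i * d i))); last by move=> j _; rewrite mul1n.
by apply: (pos (x := d) (m := fun=> 1)) => //; exists i; rewrite /= lt0n; apply/eqP.
Qed.

Theorem positive_dynkin_mult : cut_connected G -> dynkin_mult.
Proof.
move=> conn; split.
- exact: wpos_dynkin positive_mult_wpos conn.
- by case=> [[n n4 /mult_D]|[/mult_E|[/mult_E|/mult_E]]]; apply.
- exact: mult_A2.
- exact: mult_A.
Qed.

End Forward.
End Conditions.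

Lemma sum_mem_le n (s : seq nat) (F : nat -> nat) :
  \sum_(t < n) (nat_of_ord t \in s) * F t <= \sum_(t <- s) F t.
Proof.
elim: s => [|u s IH]; first by rewrite big1.
rewrite big_cons; apply: leq_trans (leq_add (leqnn _) IH).
apply: leq_trans (_ : \sum_(t < n) ((nat_of_ord t == u) * F u + (nat_of_ord t \in s) * F t) <= _).
  apply: leq_sum => t _; rewrite inE.
  by case: (eqVneq (nat_of_ord t) u) => [->|_] /=; case: (_ \in s); lia.
rewrite big_split leq_add2r -big_distrl /=; case: (leqP n u) => [un|un].
  rewrite big1 // => t _; case: eqP => // tu; have := ltn_ord t.
  by rewrite tu ltnNge un.
rewrite (bigD1 (Ordinal un)) //= eqxx big1 ?addn0 ?mul1n // => t tu.
by case: (eqVneq (nat_of_ord t) u) tu => // e /negP []; apply/eqP/val_inj.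
Qed.

Section Converse.
Variables (G : quiver) (S : vert G -> quiver).
Hypothesis noarr : forall i, arr (S i) -> False.
Local Notation l := (fun i => #|vert (S i)|).

Lemma numbered_wpos n (e : rel nat) (phi : 'I_n -> vert G) (h L : nat -> nat)
    (nb : nat -> seq nat) :
  numbering e phi -> (forall a, e a a = false) ->
  (forall i t, i < n -> t < n -> e i.+1 t.+1 -> t \in nb i) ->
  (forall i : 'I_n, l (phi i) <= L i) ->
  (forall i, i < n -> 0 < h i) ->
  (forall i, i < n -> \sum_(t <- nb i) L t * h t < 2 * h i) ->
  weakly_positive (real_quiver S).
Proof.
move=> [[psi phiK psiK] num] irr enb lL h0 hn.
apply: (@real_superharmonic G S noarr (fun v => h (psi v))) => [v|v]; first exact: h0.
rewrite nbr_sumE; last by move=> j; rewrite -(psiK j) num irr.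
apply: leq_ltn_trans (hn _ (ltn_ord (psi v))).
apply: leq_trans (sum_mem_le n _ _).
rewrite (reindex phi) /=; last by apply: onW_bij; exists psi.
apply: leq_sum => t _; rewrite phiK -{1}(psiK v) num.
case E : (e _ _) => //; rewrite (enb _ _ _ _ E) // !mul1n leq_mul2r lL orbT //.
Qed.

Lemma edgeA_irr a : edgeA a a = false. Proof. by rewrite /edgeA /sym_rel; lia. Qed.
Lemma edgeD_irr a : edgeD a a = false. Proof. by rewrite /edgeD /sym_rel; lia. Qed.
Lemma edgeE_irr a : edgeE a a = false. Proof. by rewrite /edgeE /sym_rel; lia. Qed.

(** The weights here and below are, up to a factor, the coordinates of the sum of
   the positive roots of the resulting Dynkin graph, whose gradient is constant; for
   a path with a double end this graph is of type D. With a single end the same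
   weights still have positive gradient. *)
Lemma wpos_A n (phi : 'I_n.+1 -> vert G) : numbering edgeA phi ->
  l (phi ord0) <= 2 -> (forall i, i <> phi ord0 -> l i <= 1) ->
  weakly_positive (real_quiver S).
Proof.
move=> num l0 l1; pose N := n.+1.
apply: (numbered_wpos (h := fun t => if t == 0 then N * N.+1 else 2 * (N * N.+1) - 2 * (t * t.+1))
  (L := fun t => if t == 0 then 2 else 1)
  (nb := fun t => if t is t'.+1 then [:: t'; t'.+2] else [:: 1]) num edgeA_irr).
- by move=> [|i] t iN tN; rewrite /edgeA /sym_rel !inE; lia.
- move=> [i hi] /=; case: eqP => [i0|i0].
    by rewrite (_ : Ordinal hi = ord0) //; apply: val_inj.
  by apply: l1 => /(bij_inj (proj1 num)) /(congr1 val).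
- move=> [|i] iN //=; rewrite /N; nia.
move=> [|[|i]] iN; rewrite /= !big_cons big_nil /=; rewrite /N; nia.
Qed.

Lemma wpos_A2 (phi : 'I_2 -> vert G) : numbering edgeA phi ->
  l (phi ord0) <= 3 -> l (phi ord_max) <= 1 -> weakly_positive (real_quiver S).
Proof.
move=> num l0 l1.
apply: (numbered_wpos (h := fun t => if t == 0 then 3 else 5)
  (L := fun t => if t == 0 then 3 else 1) (nb := fun t => [:: 1 - t]) num edgeA_irr).
- by move=> [|[|i]] [|[|t]].
- move=> i; have [->|->] : i = ord0 \/ i = ord_max.
    by case: i => [[|[|i]] hi] //; [left|right]; apply: val_inj.
    by [].
  by [].
- by move=> [|[|i]].
by move=> [|[|i]] // _; rewrite big_cons big_nil.
Qed.

Lemma wpos_D n (phi : 'I_n -> vert G) : 4 <= n -> numbering edgeD phi ->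
  (forall i, l i <= 1) -> weakly_positive (real_quiver S).
Proof.
move=> n4 num l1.
apply: (numbered_wpos (h := fun t => if t < 2 then n * n.-1 else 2 * (n * n.-1) - 2 * (t * t.-1))
  (L := fun=> 1)
  (nb := fun t => if t < 2 then [:: 2] else if t == 2 then [:: 0; 1; 3] else [:: t.-1; t.+1])
  num edgeD_irr).
- move=> i t iN tN; rewrite /edgeD /sym_rel; case: ifP => h1; [|case: ifP => h2]; rewrite !inE; lia.
- by move=> i; apply: l1.
- by move=> i iN; case: ifP => i2; nia.
move=> i iN; case: n n4 iN {num phi} => [|[|[|[|n]]]] //= _ iN.
case: i iN => [|[|[|i]]] iN /=; rewrite !big_cons big_nil /= !mul1n; nia.
Qed.

Definition weightE (n : nat) : seq nat :=
  if n == 6 then [:: 16; 30; 42; 22; 30; 16]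
  else if n == 7 then [:: 34; 66; 96; 49; 75; 52; 27]
  else [:: 92; 182; 270; 136; 220; 168; 114; 58].

Lemma wpos_E n (phi : 'I_n -> vert G) : (n == 6) || (n == 7) || (n == 8) ->
  numbering edgeE phi -> (forall i, l i <= 1) -> weakly_positive (real_quiver S).
Proof.
move=> n678 num l1.
apply: (numbered_wpos (h := nth 0 (weightE n)) (L := fun=> 1)
  (nb := fun t => [seq u <- iota 0 n | edgeE t.+1 u.+1]) num edgeE_irr).
- by move=> i t iN tN h; rewrite mem_filter h mem_iota.
- by move=> i; apply: l1.
- by case/orP: n678 => [/orP [] |] /eqP ->; move=> [|[|[|[|[|[|[|[|i]]]]]]]] //.
by case/orP: n678 => [/orP [] |] /eqP ->; move=> [|[|[|[|[|[|[|[|i]]]]]]]] // _; rewrite /= !big_cons big_nil.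
Qed.

Theorem dynkin_mult_wpos : 2 <= #|vert G| -> dynkin_mult (fun i => #|vert (S i)|) ->
  weakly_positive (real_quiver S).
Proof.
move=> card2 [dyn DE A2 An].
case: dyn => [[n n1 [phi num]]|dyn]; last first.
  have l1 i : #|vert (S i)| <= 1 by rewrite (DE dyn).
  case: dyn => [[n n4 [phi num]]|[[phi num]|[[phi num]|[phi num]]]].
  - exact: (wpos_D n4 num l1).
  - exact: (wpos_E _ num l1).
  - exact: (wpos_E _ num l1).
  - exact: (wpos_E _ num l1).
have cn : #|vert G| = n by rewrite -(bij_eq_card (proj1 num)) card_ord.
have rev0 m (f : 'I_m.+1 -> vert G) : (f \o @rev_ord m.+1) ord0 = f ord_max.
  by congr f; apply: val_inj; rewrite /= subn1.
rewrite cn in card2; case: n n1 phi num card2 {cn} => [|[|[|n]]] // _ phi num _.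
  have e2 i : i = phi ord0 \/ i = phi ord_max.
    have [[psi _ psiK] _] := num; rewrite -(psiK i).
    by case: (psi i) => [[|[|t]] ht] //; [left|right]; congr phi; apply: val_inj.
  case: (A2 phi num) => [[a b]|[m m23 [[a b]|[a b]]]].
  - by apply: (wpos_A2 num); rewrite ?a ?b.
  - by case: m23 => e; apply: (wpos_A2 num); rewrite ?a ?b ?e.
  apply: (wpos_A2 (numbering_rev num)); rewrite ?rev0 /= ?b; first by case: m23 => ->.
  by rewrite (_ : rev_ord ord_max = ord0) ?a //; apply: val_inj; rewrite /= subnn.
case: (An _ phi isT num) => [l1|[[l2 l1]|[l2 l1]]].
- by apply: (wpos_A num) => [|i _]; rewrite l1.
- by apply: (wpos_A num) => [|i i0]; rewrite ?l2 ?l1.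
apply: (wpos_A (numbering_rev num)); rewrite ?rev0 ?l2 // => i i0.
by rewrite l1 // -rev0.
Qed.

End Converse.

(** * Paths and cuts of the realization *)

Section Paths.
Variable Q : quiver.
Hypothesis acyc : acyclic Q.

(** A repeated vertex would cut out an oriented cycle. *)
Lemma walk_uniq v p : @is_walk Q v p -> uniq (v :: [seq tgt a | a <- p]).
Proof.
elim: p v => [|a p IH] v //= /andP [/eqP sa hp]; have /= -> := IH _ hp.
rewrite andbT -[_ :: [seq _ | _ <- _]]/[seq tgt b | b <- a :: p]; apply/negP => vp.
have hw : is_walk v (a :: p) by rewrite /= sa eqxx.
set i := index v [seq tgt b | b <- a :: p].
have ip : i < size (a :: p) by rewrite -(size_map (@tgt Q)) index_mem.
apply: (acyc (v := v) (a := a) (p := take i p)).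
  by have := hw; rewrite -{1}(cat_take_drop i.+1 (a :: p)) is_walk_cat => /andP [].
rewrite -[a :: _]/(take i.+1 (a :: p)) /walk_end map_take.
move: ip; rewrite -(size_map (@tgt Q)); move: vp; rewrite /i; move: [seq _ | _ <- _] => s vs si.
by rewrite (last_nth v) size_takel // -[nth _ _ _]/(nth v (take _ s) _) nth_take // nth_index.
Qed.

Lemma finitely_many_paths : exists (T : finType) (p : T -> qpath Q), forall q, exists t, p t = q.
Proof.
exists (vert Q * {bseq #|vert Q| of arr Q})%type.
exists (fun t => insubd (path_id t.1) (t.1, val t.2)) => -[[v p] hw].
have sp : size p <= #|vert Q|.
  by have /card_uniqP := walk_uniq hw; rewrite /= size_map => e; rewrite ltnW // -e max_card.
by exists (v, Bseq sp); apply: val_inj; rewrite val_insubd /= hw.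
Qed.
End Paths.

Lemma acyclic_real (G : quiver) (S : vert G -> quiver) :
  (forall i, arr (S i) -> False) -> acyclic G -> acyclic (real_quiver S).
Proof.
move=> noarr acyc.
pose proj (a : arr (real_quiver S)) : arr G :=
  match a with inl x => False_rect _ (noarr _ (tagged x)) | inr y => tag y end.
have sproj a : src (proj a) = tag (src a) by case: a => [x|y] //; case: (noarr _ (tagged x)).
have tproj a : tgt (proj a) = tag (tgt a) by case: a => [x|y] //; case: (noarr _ (tagged x)).
have walk (v : vert (real_quiver S)) p : is_walk v p -> is_walk (tag v) (map proj p).
  elim: p v => [|a p IH] v //= /andP [/eqP <- hp].
  by rewrite sproj eqxx tproj; apply: IH.
have wend (v : vert (real_quiver S)) p : walk_end (tag v) (map proj p) = tag (walk_end v p).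
  by elim: p v => [|a p IH] v //; rewrite -[RHS]/(tag (walk_end (tgt a) p)) -IH -tproj.
move=> v a p hw ev; apply: (acyc (tag v) (proj a) (map proj p)).
  exact: (walk v (a :: p)).
by rewrite -[_ :: _]/(map proj (a :: p)) wend ev.
Qed.

(** If two copies of a vertex, or copies of two adjacent vertices of [G], are
   separated, then so are the ends of some arrow. *)
Lemma real_connected (G : quiver) (S : vert G -> quiver) :
  2 <= #|vert G| -> cut_connected G -> cut_connected (real_quiver S).
Proof.
move=> card2 conn U [[i0 v0] v0U] [[j0 w0] w0U]; apply: contrapT => nocut.
have same (al : arr G) (a : vert (S (src al))) (b : vert (S (tgt al))) :
    ((Tagged (fun i => vert (S i)) a : vert (real_quiver S)) \in U) =
    ((Tagged (fun i => vert (S i)) b : vert (real_quiver S)) \in U).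
  apply/eqP; apply: contrapT => /negP h; apply: nocut.
  by exists (inr (Tagged (fun al => (vert (S (src al)) * vert (S (tgt al)))%type) (a, b))).
have copies i (v v' : vert (S i)) :
    ((Tagged (fun i => vert (S i)) v : vert (real_quiver S)) \in U) =
    ((Tagged (fun i => vert (S i)) v' : vert (real_quiver S)) \in U).
  have [||al] := conn [set i].
  - by exists i; rewrite inE.
  - have : 0 < #|[set~ i]| by rewrite cardsC1; case: #|_| card2 => [|[]].
    by case/card_gt0P => j; rewrite !inE => ji; exists j; rewrite inE.
  have /card_gt0P [c1 _] := vert_gt0 (S (src al)).
  have /card_gt0P [c2 _] := vert_gt0 (S (tgt al)).
  rewrite !inE; case: (eqVneq (src al) i) => [e _|_].
    by subst i; rewrite (same al v c2) (same al v' c2).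
  by rewrite eq_sym eqbF_neg negbK => /eqP e; subst i; rewrite -(same al c1 v) -(same al c1 v').
pose U' := [set i | [exists v : vert (S i), (Tagged (fun i => vert (S i)) v : vert (real_quiver S)) \in U]].
have U'E i (v : vert (S i)) : (i \in U') = ((Tagged (fun i => vert (S i)) v : vert (real_quiver S)) \in U).
  rewrite inE; apply/existsP/idP => [[v']|vU]; last by exists v.
  by rewrite (copies i v v').
have [||al] := conn U'.
- by exists i0; rewrite (U'E _ v0).
- by exists j0; rewrite (U'E _ w0).
have /card_gt0P [c1 _] := vert_gt0 (S (src al)).
have /card_gt0P [c2 _] := vert_gt0 (S (tgt al)).
by rewrite (U'E _ c1) (U'E _ c2) (same al c1 c2) eqxx.
Qed.

Local Open Scope ring_scope.

(** * Representation-finite generalized path algebras *)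

Lemma rep_finite_image (k : fieldType) (B C : algType k) (h : B -> C) :
  alg_hom h -> (forall y, exists x, h x = y) -> rep_finite B -> rep_finite C.
Proof.
move=> /alg_hom_pack [g gE] hs; apply: (@rep_finite_quotient _ _ g) => y.
by have [x <-] := hs y; exists x; apply: gE.
Qed.

Lemma rep_finite_iso (k : fieldType) (B C : algType k) :
  alg_iso B C -> rep_finite B -> rep_finite C.
Proof.
move=> /alg_iso_hom [f [fh [g fK gK]]]; apply: rep_finite_image fh _ => y.
by exists (g y).
Qed.

Section Main.
Variables (k : closedFieldType) (Gamma : quiver) (A : vert Gamma -> falgType k).
Variables (Sigma : vert Gamma -> quiver) (I : forall i, ideal (path_alg k (Sigma i))).
Hypothesis adm : forall i, admissible (I i).
Hypothesis pres : forall i, alg_iso (A i) (alg_quot (I i)).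
Hypothesis loops : forall i (a : arr (Sigma i)), src a <> tgt a.
Hypothesis card2 : (2 <= #|vert Gamma|)%N.
Hypothesis conn : cut_connected Gamma.

(** Otherwise the path algebra of a quiver that contains a triangle is a quotient. *)
Lemma rep_finite_no_arrow : rep_finite (gen_path_alg A) ->
  forall i, arr (Sigma i) -> False.
Proof.
move=> rf i a.
have /dep_choice [f fP] j : exists f : A j -> alg_quot (I j), alg_hom f /\ bijective f.
  by apply/alg_iso_hom.
have /dep_choice [g gP] j : exists g, cancel (f j) g /\ cancel g (f j).
  by have [_ [g fK gK]] := fP j; exists g.
have fh j := proj1 (fP j); have fK j := proj1 (gP j); have gK j := proj2 (gP j).
have [||h [hh _ _ hs]] := @blow_map k Gamma A Sigma I adm f g fh gK unit
  (fun=> Tagged (fun i => arr (Sigma i)) a).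
- by case=> -[].
- move=> _ _ /eqP; rewrite eq_Tagged /= => /eqP e; exact: (loops (esym e)).
apply: (triangle conn card2 (@loops i a)).
exact: rep_finite_wpos (rep_finite_image hh hs rf).
Qed.

Lemma local_kpow i m : alg_iso (A i) (kpow k m.+1) ->
  (arr (Sigma i) -> False) /\ #|vert (Sigma i)| = m.+1.
Proof.
move=> /(alg_iso_trans (alg_iso_sym (pres i))) h; split.
  exact: (kpow_no_arrow (adm i) (@loops i) h).
exact: (kpow_card (adm i) (@loops i) h).
Qed.

Lemma local_of_card i m : (arr (Sigma i) -> False) -> #|vert (Sigma i)| = m.+1 ->
  alg_iso (A i) (kpow k m.+1).
Proof.
move=> na c; apply: alg_iso_trans (pres i) (alg_iso_sym _).
exact: (no_arrow_kpow (adm i) na c).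
Qed.

Lemma local_k i : alg_iso (A i) k^o ->
  (arr (Sigma i) -> False) /\ #|vert (Sigma i)| = 1%N.
Proof. exact: (@local_kpow i 0). Qed.

Definition algebra_conditions : Prop :=
    [/\ dynkin Gamma,
        dynkinDE Gamma -> forall i, alg_iso (A i) k^o,
        forall phi : 'I_2 -> vert Gamma, numbering edgeA phi ->
          let A1 := A (phi ord0) in
          let A2 := A (phi ord_max) in
          (alg_iso A1 k^o /\ alg_iso A2 k^o) \/
          (exists2 l : nat, l = 2%N \/ l = 3%N &
            (alg_iso A1 (kpow k l) /\ alg_iso A2 k^o) \/
            (alg_iso A1 k^o /\ alg_iso A2 (kpow k l))) &
        forall (n : nat) (phi : 'I_n.+1 -> vert Gamma), (3 <= n.+1)%N ->
          numbering edgeA phi ->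
          (forall i, alg_iso (A i) k^o) \/
          (alg_iso (A (phi ord0)) (kpow k 2) /\
            forall i, i <> phi ord0 -> alg_iso (A i) k^o) \/
          (alg_iso (A (phi ord_max)) (kpow k 2) /\
            forall i, i <> phi ord_max -> alg_iso (A i) k^o)].

Lemma mult_algebra_conditions : (forall i, arr (Sigma i) -> False) ->
  dynkin_mult (fun i => #|vert (Sigma i)|) -> algebra_conditions.
Proof.
move=> na [dyn DE A2 An].
have iso i m : #|vert (Sigma i)| = m.+1 -> alg_iso (A i) (kpow k m.+1).
  exact: local_of_card (@na i).
have iso1 i : #|vert (Sigma i)| = 1%N -> alg_iso (A i) k^o := @iso i 0.
split=> //.
- by move=> de i; apply: iso1; apply: DE.
- move=> phi num /=; case: (A2 phi num) => [[a b]|[m m23 h]].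
    by left; split; apply: iso1.
  right; exists m => //.
  case: h => -[a b]; [left|right]; split; try exact: iso1;
    by case: m23 a b => -> a b; apply: iso.
move=> n phi n3 num; case: (An n phi n3 num) => [h|[[a b]|[a b]]].
- by left=> i; apply: iso1.
- by right; left; split=> [|i i0]; [apply: iso|apply: iso1; apply: b].
by right; right; split=> [|i i0]; [apply: iso|apply: iso1; apply: b].
Qed.

Lemma algebra_mult_conditions : algebra_conditions ->
  (forall i, arr (Sigma i) -> False) /\ dynkin_mult (fun i => #|vert (Sigma i)|).
Proof.
move=> [dyn DE A2 An].
have cd i m : alg_iso (A i) (kpow k m.+1) -> #|vert (Sigma i)| = m.+1.
  by case/local_kpow.
have cd1 i : alg_iso (A i) k^o -> #|vert (Sigma i)| = 1%N by case/local_k.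
split; last first.
  split=> //.
  - by move=> de i; apply: cd1; apply: DE.
  - move=> phi num; case: (A2 phi num) => [[a b]|[m m23 h]].
      by left; split; apply: cd1.
    right; exists m => //.
    case: h => -[a b]; [left|right]; split; try exact: cd1;
      by case: m23 a b => -> a b; apply: cd.
  move=> n phi n3 num; case: (An n phi n3 num) => [h|[[a b]|[a b]]].
  - by left=> i; apply: cd1.
  - by right; left; split=> [|i i0]; [apply: cd|apply: cd1; apply: b].
  by right; right; split=> [|i i0]; [apply: cd|apply: cd1; apply: b].
suff pow i : exists m, alg_iso (A i) (kpow k m.+1).
  by move=> i; have [m /local_kpow []] := pow i.
have [[n n1 [phi num]]|de] := dyn; last by exists 0%N; apply: DE.
have cn : #|vert Gamma| = n by rewrite -(bij_eq_card (proj1 num)) card_ord.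
move: (card2); rewrite cn; have [[psi _ psiK] _] := num.
case: n n1 phi num psi psiK {cn} => [|[|[|n]]] // _ phi num psi psiK _; last first.
  case: (An _ phi isT num) => [h|[[a b]|[a b]]]; first by exists 0%N; apply: h.
    by have [->|] := pselect (i = phi ord0); [exists 1%N|move=> /b; exists 0%N].
  by have [->|] := pselect (i = phi ord_max); [exists 1%N|move=> /b; exists 0%N].
have e2 : i = phi ord0 \/ i = phi ord_max.
  rewrite -(psiK i).
  by case: (psi i) => [[|[|t]] ht] //; [left|right]; congr phi; apply: val_inj.
have pm j m : m = 2%N \/ m = 3%N -> alg_iso (A j) (kpow k m) ->
    exists m, alg_iso (A j) (kpow k m.+1).
  by case=> -> h; [exists 1%N|exists 2%N].
case: (A2 phi num) => [[a b]|[m m23 [[a b]|[a b]]]]; case: e2 => ->;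
  by [exists 0%N|apply: pm m23 _].
Qed.

End Main.

Theorem theorem3p2 (k : closedFieldType)
    (Gamma : quiver) (A : vert Gamma -> falgType k)
    (hacyclic : acyclic Gamma)
    (hcard : (2 <= #|vert Gamma|)%N)
    (hbasic : forall i, basic (A i))
    (hindec : alg_indecomposable (gen_path_alg A))
    (Sigma : vert Gamma -> quiver)
    (I : forall i, ideal (path_alg k (Sigma i)))
    (hadm : forall i, admissible (I i))
    (hpres : forall i, alg_iso (A i) (alg_quot (I i)))
    (hloops : forall i (a : arr (Sigma i)), src a <> tgt a) :
  (rep_finite (gen_path_alg A) <->
    [/\ dynkin Gamma,
        dynkinDE Gamma -> forall i, alg_iso (A i) k^o,
        forall phi : 'I_2 -> vert Gamma, numbering edgeA phi ->
          let A1 := A (phi ord0) in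
          let A2 := A (phi ord_max) in
          (alg_iso A1 k^o /\ alg_iso A2 k^o) \/
          (exists2 l : nat, l = 2%N \/ l = 3%N &
            (alg_iso A1 (kpow k l) /\ alg_iso A2 k^o) \/
            (alg_iso A1 k^o /\ alg_iso A2 (kpow k l))) &
        forall (n : nat) (phi : 'I_n.+1 -> vert Gamma), (3 <= n.+1)%N ->
          numbering edgeA phi ->
          (forall i, alg_iso (A i) k^o) \/
          (alg_iso (A (phi ord0)) (kpow k 2) /\
            forall i, i <> phi ord0 -> alg_iso (A i) k^o) \/
          (alg_iso (A (phi ord_max)) (kpow k 2) /\
            forall i, i <> phi ord_max -> alg_iso (A i) k^o)])
  /\
  (rep_finite (gen_path_alg A) ->
    (forall x, real_ideal I x -> x = 0) /\
    alg_iso (gen_path_alg A) (path_alg k (real_quiver Sigma)) /\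
    dynkin (real_quiver Sigma)).
Proof.
have conn := indecomposable_connected hindec.
have noarr := rep_finite_no_arrow hadm hpres hloops hcard conn.
have iso rf := no_arrow_iso hadm hpres (noarr rf).
have wpos (rf : rep_finite (gen_path_alg A)) : weakly_positive (real_quiver Sigma).
  exact: rep_finite_wpos (rep_finite_iso (iso rf) rf).
split; last first.
  move=> rf; split; [exact: no_arrow_ideal hadm (noarr rf)|split; first exact: iso].
  exact: wpos_dynkin (wpos rf) (real_connected hcard conn).
split=> [rf|conds].
  apply: (mult_algebra_conditions hadm hpres (noarr rf)).
  apply: positive_dynkin_mult conn => [i|]; first exact: vert_gt0.
  exact: wpos_real_mult (wpos rf).
have [na mult] := algebra_mult_conditions hadm hpres hloops hcard conds.
apply: rep_finite_iso (alg_iso_sym (no_arrow_iso hadm hpres na)) _.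
apply: wpos_rep_finite; last exact: dynkin_mult_wpos na hcard mult.
exact: finitely_many_paths (acyclic_real na hacyclic).
Qed.
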